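(* The colength of the central Wedderburn embedding $$Z(T\wr G)\;\overset{\omega^Z}{\hookrightarrow}\;\prod_{i\in[1,k]}Z(S_i),$$ i.e. the length of its cokernel as an $S$-module, is given by $$\frac12\left(\Big(\sum_{\nu\in\operatorname{Cl}^G_N}\delta_{T_\nu/S}+v([N:C_N(\nu)])\,h_\nu\Big)-\Big(\sum_{i\in[1,k]}\delta_{Z(S_i)/S}+v\Big(\frac{x_i^2d_i^2}{gh}\Big)c_i\Big)\right),$$ where each of the two sums extends over both displayed terms following it.
   Context: A finite group $G$ acts (from the right, $y\mapsto y^\sigma$, by field automorphisms, not necessarily faithfully) on a field $L$ with fixed field $K$. Let $N$ be the kernel of this operation, $g=|G|$, $h=[L:K]$, $n=|N|$, so $g=hn$. Assume that $n$ is invertible in $K$. The twisted group ring $L\wr G$ is the $K$-algebra which as a right $L$-vector space has basis $G$, with multiplication determined by $(\sigma y)(\tau z)=(\sigma\tau)(y^\tau z)$. It is semisimple. Let $X_1,\dots,X_k$ be representatives of the isomorphism classes of simple right $L\wr G$-modules, $K_i=\operatorname{End}_{L\wr G}X_i$ (a skew field), $x_i$ the left $K_i$-dimension of $X_i$, $c_i=[Z(K_i):K]$, $d_i^2=[K_i:Z(K_i)]$ with $d_i\ge1$. It is known that $x_id_i/h$ is an integer, nonzero in $K$; $\frac{x_i^2d_i^2}{gh}$ denotes the element $\frac1n\left(\frac{x_id_i}{h}\right)^2$ of $K$. The isomorphism $\omega^Z:Z(L\wr G)\to\prod_iZ(K_i)$ sends a central element to the tuple of elements of $Z(K_i)$ by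 which it acts on $X_i$. Let $S\subset K$ be a discrete valuation ring with field of fractions $K$, maximal ideal generated by $\pi$, and $\pi$-adic valuation $v$ on $K$. Let $T$ be the integral closure of $S$ in $L$, and $T\wr G\subset L\wr G$ the subring of elements with coefficients in $T$. For each $i$, $V_i\subset X_i$ is a finitely generated $T\wr G$-submodule with $KV_i=X_i$ such that $S_i=\operatorname{End}_{T\wr G}V_i$ is a maximal order in $K_i$. $\operatorname{Cl}^G_N\subset N$ is a set of representatives of the $G$-orbits on $N$ under conjugation. For $\nu\in N$, $h_\nu=g/|C_G(\nu)N|$, $L_\nu$ is the fixed field of $C_G(\nu)$ in $L$, $T_\nu=T\cap L_\nu$, $T_\nu^+=\{y\in L_\nu\mid\operatorname{Tr}_{L_\nu/K}(yT_\nu)\subset S\}$, and $\delta_{T_\nu/S}$ is the length of the $S$-module $T_\nu^+/T_\nu$. Similarly $Z(S_i)^+=\{z\in Z(K_i)\mid\operatorname{Tr}_{Z(K_i)/K}(zZ(S_i))\subset S\}$ and $\delta_{Z(S_i)/S}$ is the length of $Z(S_i)^+/Z(S_i)$. *)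

(* Defs.v *)
From HB Require Import structures.
From mathcomp Require Import all_boot all_order all_algebra all_fingroup all_field.

Set Implicit Arguments.
Unset Strict Implicit.
Unset Printing Implicit Defensive.

Import GRing.Theory.
Local Open Scope ring_scope.

Section LinearAlgebra.
Context {K : fieldType}.

(* This is the trace of the restriction of f to U when f maps U to U. *)
Definition trace_on {V : vectType K} (U : {vspace V}) (f : V -> V) : K :=
  \sum_(j < \dim U) coord (vbasis U) j (f (vbasis U)`_j).

Definition commutator_lfun {V : vectType K} (g f : 'End(V)) : 'End(V) :=
  ((f \o g) - (g \o f))%VF.

Fact commutator_lfun_is_linear {V : vectType K} (g : 'End(V)) :
  linear (commutator_lfun g).
Proof.
move=> c f1 f2; rewrite /commutator_lfun comp_lfunDl comp_lfunDr.
by rewrite -comp_lfunZl -comp_lfunZr scalerBr opprD addrACA.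
Qed.

HB.instance Definition _ {V : vectType K} (g : 'End(V)) :=
  GRing.isLinear.Build K 'End(V) 'End(V) _ (commutator_lfun g)
    (commutator_lfun_is_linear g).

(* Centraliser of W in 'End(V); see mem_lfun_cent. *)
Definition lfun_cent {V : vectType K} (W : {vspace 'End(V)}) :
    {vspace 'End(V)} :=
  (\bigcap_(j < \dim W) lker (linfun (commutator_lfun (vbasis W)`_j)))%VS.

Lemma mem_lfun_cent {V : vectType K} (W : {vspace 'End(V)}) (f : 'End(V)) :
  f \in lfun_cent W <-> (forall g, g \in W -> (f \o g = g \o f)%VF).
Proof.
have memP g : (f \in lker (linfun (commutator_lfun g))) =
              ((f \o g)%VF == (g \o f)%VF).
  by rewrite memv_ker lfunE /= subr_eq0.
split=> [fW g gW | fW]; last first.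
  rewrite memvE; apply/subv_bigcapP=> j _; rewrite -memvE memP.
  by apply/eqP/fW/vbasis_mem; rewrite mem_nth // size_tuple.
rewrite (coord_vbasis gW); apply/lfunP=> x.
rewrite !comp_lfunE !sum_lfunE linear_sum; apply: eq_bigr=> j _.
rewrite !scale_lfunE linearZ; congr (_ *: _).
move: fW; rewrite memvE => /subv_bigcapP/(_ j isT); rewrite -memvE memP.
by move/eqP/lfunP/(_ x); rewrite !comp_lfunE.
Qed.

End LinearAlgebra.

Definition dprod (K : fieldType) (I : finType) (V : I -> vectType K) : Type :=
  {dffun forall i, V i}.

Section DProd.
Context {K : fieldType} {I : finType} (V : I -> vectType K).
Local Notation P := (dprod V).

HB.instance Definition _ := Choice.on P.

Definition dprod_tuple (f : forall i, V i) : P := finfun f.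
Definition dprod_proj (p : P) (i : I) : V i := (p : {dffun forall i, V i}) i.

Lemma dprod_projE f i : dprod_proj (dprod_tuple f) i = f i.
Proof. exact: ffunE. Qed.

Lemma dprodP (p q : P) : (forall i, dprod_proj p i = dprod_proj q i) -> p = q.
Proof. by move=> pq; apply/ffunP. Qed.

Let zero : P := dprod_tuple (fun=> 0).
Let opp (p : P) : P := dprod_tuple (fun i => - dprod_proj p i).
Let add (p q : P) : P := dprod_tuple (fun i => dprod_proj p i + dprod_proj q i).
Let scale (c : K) (p : P) : P := dprod_tuple (fun i => c *: dprod_proj p i).

Fact dprod_addA : associative add.
Proof. by move=> p q r; apply: dprodP=> i; rewrite !dprod_projE addrA. Qed.
Fact dprod_addC : commutative add.
Proof. by move=> p q; apply: dprodP=> i; rewrite !dprod_projE addrC. Qed.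
Fact dprod_add0 : left_id zero add.
Proof. by move=> p; apply: dprodP=> i; rewrite !dprod_projE add0r. Qed.
Fact dprod_addN : left_inverse zero opp add.
Proof. by move=> p; apply: dprodP=> i; rewrite !dprod_projE addNr. Qed.

HB.instance Definition _ :=
  GRing.isZmodule.Build P dprod_addA dprod_addC dprod_add0 dprod_addN.

Fact dprod_scaleA c c' p : scale c (scale c' p) = scale (c * c') p.
Proof. by apply: dprodP=> i; rewrite !dprod_projE scalerA. Qed.
Fact dprod_scale1 : left_id 1 scale.
Proof. by move=> p; apply: dprodP=> i; rewrite !dprod_projE scale1r. Qed.
Fact dprod_scaleDr : right_distributive scale +%R.
Proof. by move=> c p q; apply: dprodP=> i; rewrite !dprod_projE scalerDr. Qed.
Fact dprod_scaleDl p : {morph scale^~ p : c c' / c + c'}.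
Proof. by move=> c c'; apply: dprodP=> i; rewrite !dprod_projE scalerDl. Qed.

HB.instance Definition _ := GRing.Zmodule_isLmodule.Build K P
  dprod_scaleA dprod_scale1 dprod_scaleDr dprod_scaleDl.

End DProd.

Section Dvr.
Context {K : fieldType} (S : subringClosed K).

Definition is_ideal (I : K -> Prop) : Prop :=
  [/\ forall a, I a -> a \in S,
      I 0,
      forall a b, I a -> I b -> I (a + b)
    & forall s a, s \in S -> I a -> I (s * a)].

Definition unit_in (a : K) : Prop := [/\ a \in S, a != 0 & a^-1 \in S].

(* S is a local principal ideal domain that is not a field, with field of
   fractions K and maximal ideal (that is, set of nonunits) pi S. *)
Record is_dvr (pi : K) : Prop := IsDvr {
  dvr_fractions : forall a : K,
    exists b c, [/\ b \in S, c \in S, c != 0 & a = b / c];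
  dvr_principal : forall I, is_ideal I ->
    exists2 b, b \in S & forall a, I a <-> exists2 s, s \in S & a = s * b;
  dvr_uniformizer_neq0 : pi != 0;
  dvr_max_ideal : forall a,
    (a \in S /\ ~ unit_in a) <-> exists2 s, s \in S & a = s * pi
}.

(* The value v 0 is irrelevant. *)
Definition is_padic_valuation (pi : K) (v : K -> int) : Prop :=
  forall a, a != 0 -> exists2 u, unit_in u & a = u * pi ^ v a.

Definition is_submodule {V : lmodType K} (M : V -> Prop) : Prop :=
  [/\ M 0, forall x y, M x -> M y -> M (x + y)
    & forall s x, s \in S -> M x -> M (s *: x)].

Definition fin_gen {V : lmodType K} (M : V -> Prop) : Prop :=
  exists m (b : 'I_m -> V), forall x,
    M x <-> exists2 c : 'I_m -> K, forall j, c j \in S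
                                 & x = \sum_j c j *: b j.

(* K M = U *)
Definition spans {V : vectType K} (M : V -> Prop) (U : {vspace V}) : Prop :=
  forall x, x \in U <->
    exists m (c : 'I_m -> K) (b : 'I_m -> V),
      (forall j, M (b j)) /\ x = \sum_j c j *: b j.

Definition subset {T : Type} (M M' : T -> Prop) : Prop :=
  forall x, M x -> M' x.

(* The S-module M1 / M2 has length l: the S-modules C 0 <= .. <= C l form a
   composition series from M2 to M1. *)
Definition has_length {V : lmodType K} (M1 M2 : V -> Prop) (l : nat) : Prop :=
  exists C : nat -> V -> Prop,
    [/\ forall x, C 0 x <-> M2 x,
        forall x, C l x <-> M1 x,
        forall j, (j <= l)%N -> is_submodule (C j)
      & forall j, (j < l)%N ->
        [/\ subset (C j) (C j.+1), ~ subset (C j.+1) (C j)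
          & forall D, is_submodule D -> subset (C j) D -> subset D (C j.+1) ->
              subset D (C j) \/ subset (C j.+1) D]].

(* The dual M^+ in U with respect to the trace form of the algebra (U, mul). *)
Definition trace_dual {V : vectType K} (mul : V -> V -> V) (U : {vspace V})
    (M : V -> Prop) (y : V) : Prop :=
  y \in U /\ forall z, M z -> trace_on U (mul (mul y z)) \in S.

Definition is_order {V : vectType K} (D : {vspace 'End(V)})
    (O : 'End(V) -> Prop) : Prop :=
  [/\ O \1%VF,
      forall f g, O f -> O g -> O (f - g),
      forall f g, O f -> O g -> O (f \o g)%VF,
      fin_gen O
    & spans O D].

Definition is_maximal_order {V : vectType K} (D : {vspace 'End(V)})
    (O : 'End(V) -> Prop) : Prop :=
  is_order D O /\
  forall O', is_order D O' -> subset O O' -> subset O' O.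

Definition integral_closure (L : fieldExtType K) (y : L) : Prop :=
  exists p : {poly K},
    [/\ p \is monic, p \is a polyOver S & root (map_poly (in_alg L) p) y].

End Dvr.

Arguments integral_closure {K} S L y.

(* Right action of a finite group on L by field automorphisms, with fixed
   field K; it need not be faithful. *)
Record galact (K : fieldType) (L : fieldExtType K) (gT : finGroupType) :=
  GalAct {
    galact_fun :> L -> gT -> L;
    galact1 : forall y, galact_fun y 1%g = y;
    galactM : forall y s t,
      galact_fun y (s * t)%g = galact_fun (galact_fun y s) t;
    galact_rD : forall s y z,
      galact_fun (y + z) s = galact_fun y s + galact_fun z s;
    galact_rM : forall s y z,
      galact_fun (y * z) s = galact_fun y s * galact_fun z s;
    galact_r1 : forall s, galact_fun 1 s = 1;
    galact_fix : forall y, (forall s, galact_fun y s = y) <-> y \in 1%VS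
  }.

Section Twisted.
Context {K : fieldType} {L : fieldExtType K} {gT : finGroupType}.
Variable to : galact L gT.

Lemma galact_scale s (c : K) y : to (c *: y) s = c *: to y s.
Proof.
rewrite -[c *: y]mulr_algl galact_rM -[RHS]mulr_algl; congr (_ * _).
by apply: (proj2 (galact_fix to _)); rewrite rpredZ ?mem1v.
Qed.

Definition galact_by s (y : L) : L := to y s.

Lemma galact_is_linear s : linear (galact_by s).
Proof. by move=> c y z; rewrite /galact_by galact_rD galact_scale. Qed.

HB.instance Definition _ s := GRing.isLinear.Build K L L _ (galact_by s)
  (galact_is_linear s).

(* See mem_fixed_field. *)
Definition fixed_field (H : {set gT}) : {vspace L} :=
  (\bigcap_(s in H) fixedSpace (linfun (galact_by s)))%VS.

Lemma mem_fixed_field H y :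
  y \in fixed_field H <-> (forall s, s \in H -> to y s = y).
Proof.
rewrite memvE; split=> [/subv_bigcapP yH s sH | yH].
  by have:= yH s sH; rewrite -memvE => /fixedSpaceP; rewrite lfunE.
by apply/subv_bigcapP=> s sH; rewrite -memvE; apply/fixedSpaceP;
  rewrite lfunE; apply: yH.
Qed.

(* The element a stands for the sum over s of s * (a s), the coefficients being
   on the right of the group elements. The phantom argument selects the ring
   structure. *)
Definition twisted (_ : galact L gT) : Type := {ffun gT -> L}.
Local Notation tw := (twisted to).

HB.instance Definition _ := Vector.copy tw {ffun gT -> L}.

Implicit Types a b : tw.

Definition twisted_one : tw := [ffun s => (s == 1%g)%:R].

(* (s y) (t z) = (s t) (y^t z), so that the coefficient at r comes from the
   pairs (s, t) = (r t^-1, t). *)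
Definition twisted_mul a b : tw :=
  [ffun r => \sum_t to (a (r * t^-1)%g) t * b t].

Fact twisted_mulA : associative twisted_mul.
Proof.
move=> a b c; apply/ffunP=> r; rewrite !ffunE.
under eq_bigr do rewrite ffunE mulr_sumr.
under [RHS]eq_bigr do rewrite ffunE -/(galact_by _ _) linear_sum mulr_suml.
rewrite exchange_big /=; apply: eq_bigr => s _.
rewrite (reindex_inj (mulIg s)) /=; apply: eq_bigr => t _.
by rewrite /galact_by mulgK invMg mulgA galact_rM galactM !mulrA.
Qed.

Fact twisted_mul1 : left_id twisted_one twisted_mul.
Proof.
move=> a; apply/ffunP=> r; rewrite ffunE (bigD1 r) //= ffunE mulgV eqxx.
rewrite galact_r1 mul1r big1 ?addr0 // => t tr.
by rewrite ffunE -eq_mulgV1 eq_sym (negPf tr) -/(galact_by _ _) linear0 mul0r.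
Qed.

Fact twisted_mulr1 : right_id twisted_one twisted_mul.
Proof.
move=> a; apply/ffunP=> r; rewrite ffunE (bigD1 1%g) //= ffunE eqxx.
rewrite invg1 mulg1 galact1 mulr1 big1 ?addr0 // => t tr.
by rewrite ffunE (negPf tr) mulr0.
Qed.

Fact twisted_mulDl : left_distributive twisted_mul +%R.
Proof.
move=> a b c; apply/ffunP=> r; rewrite !ffunE -big_split /=.
by apply: eq_bigr => t _; rewrite ffunE galact_rD mulrDl.
Qed.

Fact twisted_mulDr : right_distributive twisted_mul +%R.
Proof.
move=> a b c; apply/ffunP=> r; rewrite !ffunE -big_split /=.
by apply: eq_bigr => t _; rewrite ffunE mulrDr.
Qed.

Fact twisted_one_neq0 : twisted_one != 0.
Proof. by apply/eqP=> /ffunP/(_ 1%g)/eqP; rewrite !ffunE eqxx oner_eq0. Qed.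

HB.instance Definition _ := GRing.Zmodule_isNzRing.Build tw
  twisted_mulA twisted_mul1 twisted_mulr1 twisted_mulDl twisted_mulDr
  twisted_one_neq0.

Fact twisted_scaleAl (c : K) a b : c *: (a * b) = c *: a * b.
Proof.
apply/ffunP=> r; rewrite !ffunE scaler_sumr; apply: eq_bigr => t _.
by rewrite ffunE galact_scale scalerAl.
Qed.

HB.instance Definition _ := GRing.Lmodule_isLalgebra.Build K tw
  twisted_scaleAl.

Fact twisted_scaleAr (c : K) a b : c *: (a * b) = a * (c *: b).
Proof.
apply/ffunP=> r; rewrite !ffunE scaler_sumr; apply: eq_bigr => t _.
by rewrite ffunE scalerAr.
Qed.

HB.instance Definition _ := GRing.Lalgebra_isAlgebra.Build K tw
  twisted_scaleAr.

HB.instance Definition _ := Algebra_isFalgebra.Build K tw.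

(* The element s y. *)
Definition twisted_mono (s : gT) (y : L) : tw := [ffun t => y *+ (t == s)].

Lemma twisted_monoM s t y z :
  twisted_mono s y * twisted_mono t z = twisted_mono (s * t)%g (to y t * z).
Proof.
apply/ffunP=> r; rewrite [LHS]ffunE [RHS]ffunE (bigD1 t) //= !ffunE eqxx.
rewrite big1 ?addr0 => [|u ut]; last by rewrite !ffunE (negPf ut) mulr0.
rewrite (can2_eq (mulgKV t) (mulgK t)) mulr1n.
by case: eqP => _; rewrite // -/(galact_by _ _) linear0 mul0r.
Qed.

Definition twisted_over (T : L -> Prop) (a : tw) : Prop :=
  forall s, T (a s).

Definition twisted_center (T : L -> Prop) (z : tw) : Prop :=
  twisted_over T z /\ forall a, twisted_over T a -> z * a = a * z.

End Twisted.

Arguments twisted_over {K L gT} to T a.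
Arguments twisted_center {K L gT} to T z.

(* rmod_act M a is the map x |-> x a. *)
Record rmod (K : fieldType) (A : falgType K) := RMod {
  rmod_sort :> vectType K;
  rmod_act : 'Hom(A, 'End(rmod_sort));
  rmod_act1 : rmod_act 1 = \1%VF;
  rmod_actM : forall a b, rmod_act (a * b) = (rmod_act b \o rmod_act a)%VF
}.

Section RightModules.
Context {K : fieldType} {A : falgType K}.
Implicit Types X Y : rmod A.

Definition rmod_simple X : Prop :=
  (fullv : {vspace X}) <> 0%VS /\
  forall W : {vspace X},
    (forall a x, x \in W -> rmod_act X a x \in W) -> W = 0%VS \/ W = fullv.

Definition rmod_iso X Y : Prop :=
  exists2 f : 'Hom(X, Y), bijective f
    & forall a x, f (rmod_act X a x) = rmod_act Y a (f x).

Definition rmod_end X : {vspace 'End(X)} := lfun_cent (limg (rmod_act X)).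

Lemma mem_rmod_end X (f : 'End(X)) :
  f \in rmod_end X <-> (forall a x, f (rmod_act X a x) = rmod_act X a (f x)).
Proof.
apply: (iff_trans (mem_lfun_cent _ _)); split=> [fX a x | fX g].
  by have /lfunP/(_ x) := fX _ (memv_img _ (memvf a)); rewrite !comp_lfunE.
by case/memv_imgP=> a _ ->; apply/lfunP=> x; rewrite !comp_lfunE.
Qed.

Definition rmod_end_center X : {vspace 'End(X)} :=
  (rmod_end X :&: lfun_cent (rmod_end X))%VS.

(* B-submodule generated by finitely many elements, for a subring B of A. *)
Definition fin_gen_submod (B : A -> Prop) X (V : X -> Prop) : Prop :=
  exists m (b : 'I_m -> X), forall x,
    V x <-> exists2 a : 'I_m -> A, forall j, B (a j)
                                 & x = \sum_j rmod_act X (a j) (b j).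

(* End_B V, for a B-submodule V of X with K B = A and K V = X, viewed inside
   End_A X. *)
Definition lattice_end X (V : X -> Prop) (f : 'End(X)) : Prop :=
  f \in rmod_end X /\ forall x, V x -> V (f x).

Definition lattice_end_center X (V : X -> Prop) (f : 'End(X)) : Prop :=
  lattice_end V f /\ forall g, lattice_end V g -> (f \o g = g \o f)%VF.

End RightModules.

Section Wedderburn.
Context {K : fieldType} {A : falgType K} {k : nat} (X : 'I_k -> rmod A).

Definition simple_representatives : Prop :=
  [/\ forall i, rmod_simple (X i),
      forall i j, rmod_iso (X i) (X j) -> i = j
    & forall Y : rmod A, rmod_simple Y -> exists i, rmod_iso Y (X i)].

Local Notation ends := (fun i => 'End(X i) : vectType K).

Definition omega (z : A) : dprod ends :=
  dprod_tuple (V := ends) (fun i => rmod_act (X i) z).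

Definition omega_image (B : A -> Prop) (p : dprod ends) : Prop :=
  exists2 z, B z & p = omega z.

Definition prod_lattice_end_center (V : forall i, X i -> Prop)
    (p : dprod ends) : Prop :=
  forall i, lattice_end_center (V i) (dprod_proj p i).

End Wedderburn.

Arguments omega {K A k} X z.
Arguments omega_image {K A k} X B p.

(* Main.v *)
(** The form [psi z = z_1] (the coefficient at 1) on the centre of the twisted
    group ring is nondegenerate.  An element of the centre is determined by its
    coefficients at representatives [nu] of the conjugacy classes in [N], which
    range over [L_nu]; there [psi (z w)] is the sum of
    [[N : C_N(nu)] Tr_{L_nu/K} (z_{nu^-1} w_nu)].  On the Wedderburn side it is
    the sum of [e_i Tr_{Z(K_i)/K} (z_i w_i)] with [e_i = (1/n) (x_i d_i / h)^2]:
    the trace of [Z(K_i)] acting on [e L[N]], for a central idempotent [e], is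
    computed by matrices over [L] whose characteristic polynomials are Galois
    invariant, hence descend to [K], and the multiplicity is found by counting
    dimensions.  For a lattice on which both descriptions apply, the valuation of
    the determinant comparing it with its dual for [psi] is, up to sign, the sum
    of a discriminant length and a contribution [v([N : C_N(nu)]) h_nu], resp.
    [v(e_i) c_i], per factor.  Passing to a sublattice changes this by twice the
    colength, so the difference of the two computations is twice the length
    sought. *)
Require Import Defs.
From HB Require Import structures.
From mathcomp Require Import all_boot all_order all_algebra all_fingroup all_field.
From mathcomp Require Import zify ring.
From Stdlib Require Import Classical.

Set Implicit Arguments.
Unset Strict Implicit.
Unset Printing Implicit Defensive.

Import Order.TTheory GRing.Theory Num.Theory.
Local Open Scope ring_scope.

(** Semisimplicity enters as joint faithfulness of the modules [X i], and the obstacle to it is that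
    only n, and not g = h n, is invertible: an average over G cannot be divided by g. Averages are
    therefore weighted by an element of L whose conjugates over G sum to n; it takes the place of
    division by h. Since the action may have a kernel, Galois theory is replaced by finite families
    y_i, z_i in L with sum_i y_i^t z_i equal to 1 for t in N and to 0 otherwise. They yield traces
    of fixed fields, dual bases, dimensions and the Maschke argument. The multiplicity r of [Z(K_i)]
    in e L[N] satisfies h^2 r = (x_i d_i)^2, which forces h to divide x_i d_i; that the quotient is
    nonzero in K, and that the trace form of [Z(K_i)] is nondegenerate, comes back from
    nondegeneracy of psi. Determinants refer to arbitrary fixed bases. The resulting base change
    constant cancels between a lattice and its dual, and the Gram determinant of psi is common to
    both lattices and cancels in the final difference, so neither is ever computed. *)

(** * Discrete valuation rings, described by their valuation *)

Record valuation_ring (K : fieldType) (S : subringClosed K) (v : K -> int) :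
    Prop := ValuationRing {
  val_mem : forall a, a != 0 -> (a \in S) = (0 <= v a);
  val_mul : forall a b, a != 0 -> b != 0 -> v (a * b) = v a + v b;
  val_uniformizer : exists2 p, p != 0 & v p = 1
}.

(** The factorisations [a = u * p ^ v a] define a valuation because exponents are unique: if [p ^ z]
    were a unit for some nonzero [z], then [p] would be a unit, whereas [p] generates the
    nonunits. *)
Lemma dvr_valuation_ring (K : fieldType) (S : subringClosed K) (p : K)
    (v : K -> int) :
  is_dvr S p -> is_padic_valuation S p v -> valuation_ring S v.
Proof.
move=> dS vP; have p0 := dvr_uniformizer_neq0 dS.
have [pS pNu] : p \in S /\ ~ unit_in S p.
  by apply/(dvr_max_ideal dS); exists 1; rewrite ?rpred1 ?mul1r.
have uM a b : unit_in S a -> unit_in S b -> unit_in S (a * b).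
  move=> [aS a0 a'S] [bS b0 b'S]; split; rewrite ?mulf_neq0 ?rpredM //.
  by rewrite invfM rpredM.
have uV a : unit_in S a -> unit_in S a^-1.
  by move=> [aS a0 a'S]; split; rewrite ?invr_eq0 ?invrK.
have npos (z : int) : 0 < z -> ~ unit_in S (p ^ z).
  case: z => // [[//|n]] _ [_ _]; rewrite -exprnP exprS invfM => pn; apply: pNu.
  by split=> //; rewrite -[p^-1](mulfK (expf_neq0 n p0)) mulrAC rpredM ?rpredX.
have pu0 (z : int) : unit_in S (p ^ z) -> z = 0.
  move=> uz; apply/eqP; case: ltgtP => // z0; last by case: (npos _ z0).
  by case: (npos (- z)); rewrite ?oppr_gt0 // -invr_expz; apply: uV.
have vU u z : unit_in S u -> v (u * p ^ z) = z.
  move=> uu; have u0 : u != 0 by case: uu.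
  have [|u' uu' E] := vP (u * p ^ z); first by rewrite mulf_neq0 ?expfz_neq0.
  apply/eqP; rewrite -subr_eq0; apply/eqP/pu0.
  suff -> : p ^ (v (u * p ^ z) - z) = u / u' by apply: uM => //; apply: uV.
  have u'0 : u' != 0 by case: uu'.
  apply: (mulIf u'0); apply: (mulIf (expfz_neq0 z p0)); rewrite divfK //.
  by rewrite mulrAC -expfzDr // subrK [RHS]E mulrC.
split.
- move=> a a0; have [u uu ->] := vP a a0; rewrite vU //.
  have [uS u0 u'S] := uu; case: (v a) => [n|n] /=; first by rewrite rpredM ?rpredX.
  rewrite [RHS](_ : _ = false) //; apply/negP => aS.
  case: (npos n.+1%:Z) => //; split; rewrite -?exprnP ?rpredX ?expf_neq0 //.
  by rewrite -[_^-1](mulKf u0) rpredM.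
- move=> a b a0 b0; have [u uu ea] := vP a a0; have [w uw eb] := vP b b0.
  rewrite [X in v X](_ : _ = (u * w) * p ^ (v a + v b)) ?vU //; first exact: uM.
  by rewrite {1}ea {1}eb mulrACA -expfzDr.
- exists p => //; rewrite [X in v X](_ : _ = 1 * p ^ 1); last by rewrite mul1r.
  rewrite vU //.
  by split; rewrite ?invr1 ?rpred1 ?oner_eq0.
Qed.

Section ValuationRing.
Variables (K : fieldType) (S : subringClosed K) (v : K -> int).
Hypothesis vS : valuation_ring S v.

Lemma val_one : v 1 = 0.
Proof.
apply: (addrI (v 1)); rewrite addr0 -(val_mul vS) ?oner_eq0 //.
by rewrite mulr1.
Qed.

Lemma val_inv a : a != 0 -> v a^-1 = - v a.
Proof.
move=> a0; apply/eqP; rewrite -addr_eq0 -(val_mul vS) ?invr_eq0 //.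
by rewrite mulVf // val_one.
Qed.

Lemma val_exp a n : a != 0 -> v (a ^+ n) = v a * n%:Z.
Proof.
move=> a0; elim: n => [|n IHn]; first by rewrite val_one mulr0.
by rewrite exprS (val_mul vS) ?expf_neq0 // IHn intS mulrDr mulr1.
Qed.

Lemma val_prod (I : finType) (F : I -> K) :
  (forall i, F i != 0) -> v (\prod_i F i) = \sum_i v (F i).
Proof.
move=> F0; suff [] : \prod_i F i != 0 /\ v (\prod_i F i) = \sum_i v (F i) by [].
elim/big_rec2: _ => [|i y1 y2 _ [y10 <-]]; first by rewrite oner_eq0 val_one.
by rewrite mulf_neq0 ?(val_mul vS).
Qed.

(** If [a] is not in [S] then its inverse is. Dividing the monic equation of degree n + 1 by
    [a ^+ n] writes [a] as a polynomial in its inverse with coefficients in [S]. *)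
Lemma val_integrally_closed (p : {poly K}) a :
  p \is monic -> p \is a polyOver S -> root p a -> a \in S.
Proof.
move=> pm pS pa; have [->|a0] := eqVneq a 0; first by rewrite rpred0.
apply: contraT => aNS; rewrite -(negPf aNS).
have a'S : a^-1 \in S.
  by rewrite (val_mem vS) ?invr_eq0 // val_inv // oppr_ge0 ltW // ltNge -(val_mem vS).
move: pa; rewrite rootE horner_coef; move/monicP: (pm); rewrite lead_coefE.
have := monic_neq0 pm; rewrite -size_poly_gt0; case: (size p) => // n _ /= pn.
rewrite big_ord_recr /= pn mul1r addr_eq0.
case: n pn => [|n] pn; first by rewrite big_ord0 expr0 eq_sym oppr_eq0 oner_eq0.
move/eqP/(congr1 (fun x => - x / a ^+ n)); rewrite opprK exprS mulfK ?expf_neq0 // => aE.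
rewrite -[X in X \in _]aE mulNr rpredN mulr_suml rpred_sum // => i _.
rewrite -mulrA rpredM ?(polyOverP pS) //.
have le_in : (i <= n)%N by rewrite -ltnS.
rewrite -{2}(subnK le_in) exprD invfM mulrCA divff ?expf_neq0 // mulr1 -exprVn.
exact: rpredX.
Qed.

Lemma val_denominator (I : finType) (F : I -> K) :
  exists s, [/\ s != 0, s \in S & forall i, s * F i \in S].
Proof.
have [p p0 vp] := val_uniformizer vS.
pose m := \max_i absz (v (F i)); exists (p ^+ m); split.
- exact: expf_neq0.
- by rewrite rpredX // (val_mem vS) ?vp.
move=> i; have [->|Fi] := eqVneq (F i) 0; first by rewrite mulr0 rpred0.
rewrite (val_mem vS) ?mulf_neq0 ?expf_neq0 // (val_mul vS) ?expf_neq0 // val_exp //.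
rewrite vp mul1r; have : (absz (v (F i)) <= m)%N by exact: leq_bigmax.
by rewrite -lez_nat abszE => h; rewrite -lerBlDr sub0r (le_trans _ h) // -normrN ler_norm.
Qed.

End ValuationRing.

(** * Lattices and the valuation of their determinants *)

Lemma not_subset (T : Type) (M M' : T -> Prop) :
  ~ Defs.subset M M' -> exists2 x, M x & ~ M' x.
Proof.
move=> nMM'; apply: NNPP => nx; apply: nMM' => x Mx; apply: NNPP => M'x.
by apply: nx; exists x.
Qed.

(** Expansion along row [j]: its cofactors do not see that row, hence are those of the identity
    matrix, which are read off from the adjugate. *)
Lemma det_replace_row (R : comNzRingType) m (u : 'rV[R]_m) j :
  \det (\matrix_(i, k) if i == j then u 0 k else (i == k)%:R) = u 0 j.
Proof.
set E := \matrix_(_, _) _; rewrite (expand_det_row E j).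
have cof l : cofactor E j l = (l == j)%:R.
  transitivity ((\adj (1%:M : 'M[R]_m)) l j).
    rewrite !mxE /cofactor; congr (_ * \det _); apply/matrixP=> a b.
    by rewrite !mxE eq_sym (negPf (neq_lift _ _)).
  by rewrite -[\adj _]mul1mx mul_mx_adj det1 mxE.
rewrite (bigD1 j) //= cof eqxx mulr1 mxE eqxx big1 ?addr0 // => l /negPf lj.
by rewrite cof lj mulr0.
Qed.

Lemma det_mxOver (R : comNzRingType) (S : subringClosed R) m (P : 'M[R]_m) :
  P \is a mxOver S -> \det P \in S.
Proof.
move=> PS; rewrite rpred_sum // => s _; rewrite rpredM ?rpred_sign //.
by rewrite rpred_prod // => i _; apply: (mxOverP PS).
Qed.

Section Lattices.
Variables (K : fieldType) (S : subringClosed K) (v : K -> int).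
Hypothesis vS : valuation_ring S v.

(** The lattice spanned by the rows of [B], for [B] in [unitmx]: membership is integrality of the
    coordinates in that basis. *)
Definition lat m (B : 'M[K]_m) (x : 'rV[K]_m) : Prop :=
  x *m invmx B \is a mxOver S.

Lemma lat_mul m (B : 'M[K]_m) c :
  B \in unitmx -> c \is a mxOver S -> lat B (c *m B).
Proof. by move=> uB cS; rewrite /lat mulmxK. Qed.

Lemma lat_submodule m (B : 'M[K]_m) : is_submodule S (lat B).
Proof.
rewrite /lat; split=> [|x y xB yB|s x sS xB].
- by rewrite mul0mx rpred0.
- by rewrite mulmxDl rpredD.
- by rewrite -scalemxAl mxOverZ.
Qed.

Lemma submodule_sum (V : lmodType K) (M : V -> Prop) (I : finType)
    (c : I -> K) (b : I -> V) :
  is_submodule S M -> (forall i, c i \in S) -> (forall i, M (b i)) ->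
  M (\sum_i c i *: b i).
Proof.
move=> [M0 MD MZ] cS bM; elim/big_rec: _ => // i x _ Mx.
by apply: (MD) => //; apply: MZ.
Qed.

Lemma lat_sub m (B : 'M[K]_m) M :
  B \in unitmx -> is_submodule S M -> (forall i, M (row i B)) ->
  Defs.subset (lat B) M.
Proof.
move=> uB sM rB x xB; rewrite -[x](mulmxKV uB) mulmx_sum_row.
by apply: submodule_sum => // i; apply: (mxOverP xB).
Qed.

Lemma lat_sub_det m (B1 B2 : 'M[K]_m) :
  B1 \in unitmx -> B2 \in unitmx -> Defs.subset (lat B2) (lat B1) ->
  v (\det B1) <= v (\det B2).
Proof.
move=> u1 u2 s12; have PS : B2 *m invmx B1 \is a mxOver S.
  apply/mxOverP => i j.
  have /mxOverP/(_ 0 j) : lat B1 (row i B2).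
    apply: s12; rewrite rowE; apply: lat_mul => //; apply/mxOverP => a b.
    by rewrite mxE rpred_nat.
  by rewrite -row_mul mxE.
have d1 : \det B1 != 0 by rewrite -unitfE -unitmxE.
have d2 : \det B2 != 0 by rewrite -unitfE -unitmxE.
move: (det_mxOver PS); rewrite det_mulmx det_inv.
by rewrite (val_mem vS) ?mulf_neq0 ?invr_eq0 // (val_mul vS) ?invr_eq0 // (val_inv vS) // subr_ge0.
Qed.

Variable p : K.
Hypotheses (p0 : p != 0) (vp : v p = 1).

Let pS : p \in S. Proof. by rewrite (val_mem vS) // vp. Qed.

(** Some power of [p] moves [x] into the lattice; the last multiple that is still outside is the
    element sought. *)
Lemma lat_find m (B : 'M[K]_m) (M : 'rV[K]_m -> Prop) (x : 'rV[K]_m) :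
  is_submodule S M -> M x -> ~ lat B x ->
  exists y, [/\ M y, ~ lat B y & lat B (p *: y)].
Proof.
move=> [M0 MD MZ] Mx xB.
have [e xe] : exists e : nat, lat B (p ^+ e *: x).
  pose y : 'rV_m := x *m invmx B; pose e := \max_(j < m) absz (v (y ord0 j)); exists e.
  rewrite /lat -scalemxAl; apply/mxOverP=> i j; rewrite ord1 mxE -/y.
  have [->|y0] := eqVneq (y 0 j) 0; first by rewrite mulr0 rpred0.
  rewrite (val_mem vS) ?mulf_neq0 ?expf_neq0 // (val_mul vS) ?expf_neq0 //.
  rewrite (val_exp vS) // vp mul1r.
  have : (absz (v (y ord0 j)) <= e)%N by exact: leq_bigmax.
  rewrite -lez_nat abszE => h; rewrite -lerBlDr sub0r (le_trans _ h) //.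
  by rewrite -normrN ler_norm.
elim: e xe => [|e IHe] xe; first by case: xB; rewrite expr0 scale1r in xe.
have [xe'|xe'] := classic (lat B (p ^+ e *: x)); first exact: IHe.
exists (p ^+ e *: x); split=> //; first by apply: MZ; rewrite ?rpredX.
by rewrite scalerA -exprS.
Qed.

(** Some coordinate [u 0 j] of [y] is not in [S] while [p * u 0 j] is, so it has valuation exactly
    -1 and divides all other coordinates. Hence [y] can replace the basis vector number [j], and the
    determinant is multiplied by [u 0 j]. *)
Lemma lat_adjoin m (B : 'M[K]_m) y :
  B \in unitmx -> ~ lat B y -> lat B (p *: y) ->
  exists B', [/\ B' \in unitmx, v (\det B') = v (\det B) - 1
    & forall x, lat B' x <->
        exists a w, [/\ a \in S, lat B w & x = a *: y + w]].
Proof.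
move=> uB yB pyB; pose u := y *m invmx B.
have pu j : p * u 0 j \in S.
  by move: pyB => /mxOverP/(_ 0 j); rewrite -scalemxAl mxE.
have [j ujS] : exists j, u 0 j \notin S.
  apply/existsP; apply: contra_notT yB; rewrite negb_exists => /forallP uS.
  by apply/mxOverP => i j; rewrite ord1; apply/negPn/uS.
have yE : y = u *m B by rewrite mulmxKV.
clearbody u.
have uj0 : u 0 j != 0 by apply: contraNneq ujS => ->; rewrite rpred0.
have vuj : v (u 0 j) = -1.
  apply/eqP; rewrite eq_le; apply/andP; split.
    by move: ujS; rewrite (val_mem vS) // -ltNge.
  by move: (pu j); rewrite (val_mem vS) ?mulf_neq0 // (val_mul vS) // vp -lerBlDl.
have qS l : u 0 l / u 0 j \in S.
  have [->|ul] := eqVneq (u 0 l) 0; first by rewrite mul0r rpred0.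
  move: (pu l); rewrite !(val_mem vS) ?mulf_neq0 ?invr_eq0 //.
  by rewrite !(val_mul vS) ?invr_eq0 // (val_inv vS) // vuj vp opprK addrC.
pose E := \matrix_(i, k) if i == j then u 0 k else (i == k)%:R.
have dE : \det E = u 0 j by exact: det_replace_row.
have uE : E \in unitmx by rewrite unitmxE dE unitfE.
have Eval (c : 'rV_m) : c *m E = c 0 j *: u + (c - c 0 j *: delta_mx 0 j).
  apply/rowP=> k; rewrite !mxE (bigD1 j) //= mxE eqxx; congr (_ + _).
  have [->|kj] := eqVneq k j.
    by rewrite mulr1 subrr big1 // => i /negPf ij; rewrite mxE ij mulr0.
  rewrite mulr0 subr0 (bigD1 k) //= mxE (negPf kj) eqxx mulr1.
  by rewrite big1 ?addr0 // => i /andP[/negPf ij /negPf ik]; rewrite mxE ij ik mulr0.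
exists (E *m B); split=> [||x].
- by rewrite unitmx_mul uE.
- have dB : \det B != 0 by rewrite -unitfE -unitmxE.
  by rewrite det_mulmx dE (val_mul vS) // vuj addrC.
split=> [xB|[a [w [aS wB ->]]]].
  have [c cS ->] : exists2 c : 'rV_m, forall l, c 0 l \in S & x = c *m (E *m B).
    exists (x *m invmx (E *m B)); first by move=> l; apply: (mxOverP xB).
    by rewrite mulmxKV // unitmx_mul uE.
  exists (c 0 j), ((c - c 0 j *: delta_mx 0 j) *m B); split=> //.
    apply: lat_mul => //; apply/mxOverP => i l; rewrite ord1 !mxE.
    by rewrite rpredB ?rpredM ?rpred_nat.
  by rewrite yE scalemxAl -mulmxDl -Eval mulmxA.
have [_ lD lZ] := lat_submodule (E *m B); apply: (lD).
  apply: lZ => //; have -> : y = delta_mx 0 j *m (E *m B).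
    rewrite mulmxA Eval mxE !eqxx !scale1r subrr addr0; exact: yE.
  apply: lat_mul; first by rewrite unitmx_mul uE.
  by apply/mxOverP => a' b'; rewrite mxE rpred_nat.
have [c cS ->] : exists2 c : 'rV_m, forall l, c 0 l \in S & w = c *m B.
  by exists (w *m invmx B); [move=> l; apply: (mxOverP wB) | rewrite mulmxKV].
(* Coordinates of [w] in the new basis: the old vector [j] is eliminated by solving the expansion of
   [y] for it, which needs the quotients [u 0 l / u 0 j] to lie in [S]. *)
pose c' := \row_l if l == j then c 0 j / u 0 j else c 0 l - c 0 j * (u 0 l / u 0 j).
have u'S : (u 0 j)^-1 \in S by rewrite (val_mem vS) ?invr_eq0 // (val_inv vS) // vuj.
have -> : c *m B = c' *m (E *m B).
  rewrite mulmxA Eval; congr (_ *m B).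
  apply/rowP=> l; rewrite !mxE !eqxx; have [->|lj] := eqVneq l j.
    by rewrite mulr1 divfK // subrr addr0.
  by rewrite andbF mulr0 subr0 mulrAC mulrA addrC subrK.
apply: lat_mul; first by rewrite unitmx_mul uE.
apply/mxOverP => i l; rewrite mxE; case: eqP => _; first exact: rpredM.
by apply: rpredB => //; apply: rpredM.
Qed.

(** The quotient is generated by [y] and killed by [p], so it is the residue field: an element of
    [D] outside the smaller lattice has a unit as coefficient of [y], and then [y] itself lies in
    [D]. *)
Lemma lat_adjoin_simple m (B B' : 'M[K]_m) y :
  lat B (p *: y) ->
  (forall x, lat B' x <-> exists a w, [/\ a \in S, lat B w & x = a *: y + w]) ->
  forall D, is_submodule S D -> Defs.subset (lat B) D -> Defs.subset D (lat B') ->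
    Defs.subset D (lat B) \/ Defs.subset (lat B') D.
Proof.
move=> py B'P D [D0 DD DZ] BD DB'.
have [sDB|] := classic (Defs.subset D (lat B)); first by left.
move=> /not_subset[x Dx xB]; right.
have [lat0 latD latZ] := lat_submodule B.
have [a [w [aS wB ex]]] := (B'P x).1 (DB' _ Dx).
have a0 : a != 0 by apply: contra_notN xB => /eqP a0; rewrite ex a0 scale0r add0r.
have va : v a = 0.
  apply/eqP; rewrite eq_le -(val_mem vS) // aS andbT.
  rewrite leNgt; apply: contra_notN xB => va; rewrite ex; apply: (latD) => //.
  rewrite -(divfK p0 a) -scalerA; apply: (latZ) => //.
  rewrite (val_mem vS) ?mulf_neq0 ?invr_eq0 // (val_mul vS) ?invr_eq0 //.
  by rewrite (val_inv vS) // vp subr_ge0 -gtz0_ge1.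
have a'S : a^-1 \in S by rewrite (val_mem vS) ?invr_eq0 // (val_inv vS) // va.
have Dy : D y.
  have -> : y = a^-1 *: (x + -1 *: w).
    by rewrite ex scaleN1r addrK scalerA mulVf // scale1r.
  apply: (DZ) => //; apply: (DD) => //; apply: DZ; first by rewrite rpredN rpred1.
  exact: BD.
move=> z /(B'P z)[b [w' [bS w'B ->]]].
by apply: (DD); [apply: DZ | apply: BD].
Qed.

(** Each adjunction of an element is a simple step and lowers the valuation of the determinant by 1.
    When the valuations agree the lattices coincide, since one more step inside [lat B1] would
    contradict [lat_sub_det]. *)
Lemma lat_has_length m (B1 : 'M[K]_m) l B2 :
  B1 \in unitmx -> B2 \in unitmx -> Defs.subset (lat B2) (lat B1) ->
  v (\det B2) - v (\det B1) = l%:Z -> has_length S (lat B1) (lat B2) l.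
Proof.
move=> u1; elim: l B2 => [|l IHl] B2 u2 s21 dv.
  exists (fun=> lat B2); split=> // [x|j _]; last exact: lat_submodule.
  split=> [|xB1]; first exact: s21.
  apply: NNPP => xB2; have [y [yB1 yB2 pyB2]] := lat_find (lat_submodule _) xB1 xB2.
  have [B3 [u3 d3 B3P]] := lat_adjoin u2 yB2 pyB2.
  have /(lat_sub_det u1 u3) : Defs.subset (lat B3) (lat B1).
    move=> z /(B3P z)[a [w [aS wB2 ->]]].
    by have [_ lD lZ] := lat_submodule B1; apply: (lD); [apply: lZ | apply: s21].
  by rewrite d3 -subr_ge0 addrAC dv.
have [x xB1 xB2] : exists2 x, lat B1 x & ~ lat B2 x.
  by apply: not_subset => /(lat_sub_det u2 u1); rewrite -subr_le0 dv.
have [y [yB1 yB2 pyB2]] := lat_find (lat_submodule _) xB1 xB2.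
have [B3 [u3 d3 B3P]] := lat_adjoin u2 yB2 pyB2.
have s31 : Defs.subset (lat B3) (lat B1).
  move=> z /(B3P z)[a [w [aS wB2 ->]]].
  by have [_ lD lZ] := lat_submodule B1; apply: (lD); [apply: lZ | apply: s21].
have s23 : Defs.subset (lat B2) (lat B3).
  by move=> z zB2; apply/B3P; exists 0, z; rewrite rpred0 scale0r add0r.
have [|C [C0 Cl Csub Cstep]] := IHl B3 u3 s31.
  by rewrite d3 addrAC dv intS addrAC subrr add0r.
exists (fun j => if j is j'.+1 then C j' else lat B2); split=> //.
  by case=> [|j] jl; [exact: lat_submodule | exact: Csub].
case=> [|j] jl; last exact: Cstep.
split; first by move=> z /s23 /C0.
  move=> s32; apply: yB2; apply: s32; apply/C0/B3P; exists 1, 0.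
  by rewrite rpred1 scale1r addr0; split=> //; case: (lat_submodule B2).
move=> D sD B2D DC; have [|sDB|sBD] := lat_adjoin_simple pyB2 B3P sD B2D.
- by move=> z /DC /C0.
- by left.
- by right=> z /C0 /sBD.
Qed.

(** A basis is found by enlarging [lat B] inside [M] one element at a time. Every step lowers the
    valuation of the determinant, which stays bounded below by that of [B0], so the process stops at
    [M]. *)
Lemma lat_basis m (B0 : 'M[K]_m) M B :
  B0 \in unitmx -> B \in unitmx -> is_submodule S M ->
  Defs.subset M (lat B0) -> Defs.subset (lat B) M ->
  exists2 B', B' \in unitmx & forall x, M x <-> lat B' x.
Proof.
move=> u0 uB sM MB0 BM; have [n nP] : exists n : nat, v (\det B) - v (\det B0) < n%:Z.
  by exists (absz (v (\det B) - v (\det B0))).+1; rewrite intS abszE ltz1D ler_norm.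
elim: n B uB BM nP => [|n IHn] B uB BM nP.
  have /(lat_sub_det u0 uB) : Defs.subset (lat B) (lat B0) by move=> x /BM /MB0.
  by rewrite -subr_ge0 leNgt nP.
have [MB|] := classic (Defs.subset M (lat B)).
  by exists B => // x; split; [apply: MB | apply: BM].
move=> /not_subset[x Mx xB].
have [y [My yB pyB]] := lat_find sM Mx xB.
have [B' [uB' dB' B'P]] := lat_adjoin uB yB pyB.
apply: (IHn B') => //.
  move=> z /(B'P z)[a [w [aS wB2 ->]]].
  by have [_ MD MZ] := sM; apply: (MD); [apply: MZ | apply: BM].
by rewrite dB' addrAC ltrBlDr -[1]/(1%:Z) -PoszD addn1.
Qed.

End Lattices.

Lemma det_mxdiag (R : comNzRingType) k (p_ : 'I_k -> nat)
    (B_ : forall i, 'M[R]_(p_ i)) : \det (\mxdiag_i B_ i) = \prod_i \det (B_ i).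
Proof.
elim: k p_ B_ => [|k IHk] p_ B_.
  have det0 n (A : 'M[R]_n) : n = 0%N -> \det A = 1.
    by move=> n0; move: A; rewrite n0 => A; rewrite det_mx00.
  by rewrite [RHS]big_ord0; apply: det0; rewrite big_ord0.
rewrite mxdiag_recl [RHS]big_ord_recl.
by case: _ / mxsize_recl; rewrite castmx_id det_ublock IHk.
Qed.

(** * Coordinates in a subspace, and volumes of lattices *)

Section Coordinates.
Variables (K : fieldType) (V : vectType K) (U : {vspace V}).

Definition vcoord (x : V) : 'rV[K]_(\dim U) := \row_j coord (vbasis U) j x.
Definition vcomb (c : 'rV[K]_(\dim U)) : V := \sum_j c 0 j *: (vbasis U)`_j.

Lemma vbasis_nth_mem j : (j < \dim U)%N -> (vbasis U)`_j \in U.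
Proof. by move=> ltj; apply: vbasis_mem; rewrite mem_nth // size_tuple. Qed.

Lemma vcomb_mem c : vcomb c \in U.
Proof. by rewrite rpred_sum // => j _; rewrite rpredZ ?vbasis_nth_mem. Qed.

Lemma vcombK : cancel vcomb vcoord.
Proof.
move=> c; apply/rowP => j; rewrite mxE.
by rewrite coord_sum_free // (basis_free (vbasisP U)).
Qed.

Lemma vcoordK x : x \in U -> vcomb (vcoord x) = x.
Proof.
by move=> xU; rewrite [RHS](coord_vbasis xU); apply: eq_bigr => j _; rewrite mxE.
Qed.

Lemma vcoord_is_linear : linear vcoord.
Proof. by move=> a x y; apply/rowP => j; rewrite !mxE linearP. Qed.
HB.instance Definition _ :=
  GRing.isLinear.Build K V 'rV[K]_(\dim U) _ vcoord vcoord_is_linear.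

Lemma vcomb_is_linear : linear vcomb.
Proof.
move=> a c c'; rewrite /vcomb scaler_sumr -big_split; apply: eq_bigr => j _.
by rewrite !mxE scalerDl scalerA.
Qed.
HB.instance Definition _ :=
  GRing.isLinear.Build K 'rV[K]_(\dim U) V _ vcomb vcomb_is_linear.

Lemma vcoord_basis (j : 'I_(\dim U)) : vcoord (vbasis U)`_j = delta_mx 0 j.
Proof.
apply/rowP=> i; rewrite !mxE coord_free ?(basis_free (vbasisP U)) //=.
by rewrite ?eqxx /= eq_sym.
Qed.
End Coordinates.

Section Volume.
Variables (K : fieldType) (S : subringClosed K) (v : K -> int).
Hypothesis vS : valuation_ring S v.

(** Composition series are carried over in two places: from coordinate vectors to the subspace, and
    along [omega] from the centre to the product of endomorphism rings. *)
Lemma has_length_img (W V : lmodType K) (f : W -> V) (M1' M2' : W -> Prop)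
    (M1 M2 : V -> Prop) l :
  linear f -> injective f ->
  (forall x, M1 x <-> exists2 w, M1' w & x = f w) ->
  (forall x, M2 x <-> exists2 w, M2' w & x = f w) ->
  has_length S M1' M2' l -> has_length S M1 M2 l.
Proof.
move=> fL fI M1P M2P [C [C0 Cl Csub Cstep]].
have fD x y : f (x + y) = f x + f y by rewrite -[x]scale1r fL !scale1r.
have f0 : f 0 = 0 by apply: (addrI (f 0)); rewrite -fD !addr0.
have fZ a x : f (a *: x) = a *: f x by rewrite -[a *: x]addr0 fL f0 addr0.
exists (fun j x => exists2 w, C j w & x = f w); split.
- move=> x; apply: iff_trans (iff_sym (M2P x)).
  by split=> -[w /C0 ? ?]; exists w.
- move=> x; apply: iff_trans (iff_sym (M1P x)).
  by split=> -[w /Cl ? ?]; exists w.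
- move=> j /Csub[c0 cD cZ]; split.
  + by exists 0; rewrite ?f0.
  + by move=> _ _ [x Cx ->] [y Cy ->]; exists (x + y); rewrite ?fD //; apply: cD.
  + by move=> s _ sS [x Cx ->]; exists (s *: x); rewrite ?fZ //; apply: cZ.
move=> j ltj; have [sC nsC simC] := Cstep j ltj; split.
- by move=> _ [w Cw ->]; exists w => //; apply: sC.
- move=> sC'; apply: nsC => w Cw; have [|w' Cw' /fI ->] // := sC' (f w).
  by exists w.
move=> D [D0 DD DZ] CD DC; have [|||sDC|sCD] := simC (fun w => D (f w)).
- split=> [|x y Dx Dy|s x sS Dx]; first by rewrite f0.
    by rewrite fD; apply: DD.
  by rewrite fZ; apply: DZ.
- by move=> w Cw; apply: CD; exists w.
- by move=> w Dw; have [w' Cw' /fI ->] := DC _ Dw.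
- by left=> x Dx; have [w Cw ex] := DC _ Dx; exists w => //; apply: sDC; rewrite -ex.
- by right=> _ [w Cw ->]; apply: sCD.
Qed.

(* The lattice M spans U, and z is the valuation of the determinant of an
   S-basis of M with respect to the fixed basis vbasis U. *)
Definition volume (V : vectType K) (U : {vspace V}) (M : V -> Prop) (z : int) :=
  exists B : 'M[K]_(\dim U),
    [/\ B \in unitmx,
        forall x, M x <-> x \in U /\ lat S B (vcoord U x)
      & z = v (\det B)].

Lemma volume_ext (V : vectType K) (U : {vspace V}) M M' z :
  (forall x, M x <-> M' x) -> volume U M z -> volume U M' z.
Proof.
move=> MM' [B [uB MP ez]]; exists B; split=> // x.
exact: iff_trans (iff_sym (MM' x)) (MP x).
Qed.

Lemma volume_length (V : vectType K) (U : {vspace V}) M1 M2 z1 z2 :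
  volume U M1 z1 -> volume U M2 z2 -> Defs.subset M2 M1 ->
  exists2 l, has_length S M1 M2 l & l%:Z = z2 - z1.
Proof.
move=> [B1 [u1 M1P ->]] [B2 [u2 M2P ->]] s21.
have [p p0 vp] := val_uniformizer vS.
have s21' : Defs.subset (lat S B2) (lat S B1).
  move=> c cB2; have /s21/M1P[_] : M2 (vcomb c).
    by apply/M2P; rewrite vcomb_mem vcombK.
  by rewrite vcombK.
have /(lat_sub_det vS u1 u2) := s21'.
rewrite -subr_ge0 => /gez0_abs e; exists (absz (v (\det B2) - v (\det B1))) => //.
have img M B : (forall x, M x <-> x \in U /\ lat S B (vcoord U x)) ->
    forall x, M x <-> exists2 w, lat S B w & x = vcomb w.
  move=> MP x; split=> [/MP[xU xB]|[w wB ->]]; last first.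
    by apply/MP; rewrite vcomb_mem vcombK.
  by exists (vcoord U x); rewrite ?vcoordK.
have vL : linear (@vcomb K V U) by exact: linearP.
apply: (has_length_img vL (can_inj (@vcombK K V U)) (img _ _ M1P) (img _ _ M2P)).
exact: (lat_has_length vS p0 vp).
Qed.

Lemma volume_inside (V : vectType K) (U : {vspace V}) M : is_submodule S M ->
  (forall x, x \in U -> exists2 s, s != 0 & M (s *: x)) ->
  exists M0 z0, volume U M0 z0 /\ Defs.subset M0 M.
Proof.
move=> sM spM; have /fin_all_exists[s sP] (j : 'I_(\dim U)) :
    exists s, s != 0 /\ M (s *: (vbasis U)`_j).
  by have [|s s0 Ms] := spM (vbasis U)`_j; [exact: vbasis_nth_mem | exists s].
pose B := diag_mx (\row_j s j).
have uB : B \in unitmx.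
  rewrite unitmxE det_diag unitfE; apply/prodf_neq0 => j _; rewrite mxE.
  by case: (sP j).
exists (fun x => x \in U /\ lat S B (vcoord U x)), (v (\det B)); split.
  by exists B.
move=> x [xU xB]; rewrite -(vcoordK xU).
have [M0 MD MZ] := sM.
apply: (@lat_sub _ S _ _ (fun c => M (vcomb c)) uB) (xB).
  split=> [|c c' Mc Mc'|a c aS Mc]; first by rewrite linear0.
    by rewrite linearD; apply: MD.
  by rewrite linearZ; apply: MZ.
move=> i; rewrite row_diag_mx mxE linearZ /= -vcoord_basis vcoordK ?vbasis_nth_mem //.
by case: (sP i).
Qed.

Lemma volume_exists (V : vectType K) (U : {vspace V}) M M0 z0 :
  is_submodule S M -> Defs.subset M M0 -> volume U M0 z0 ->
  (forall x, x \in U -> exists2 s, s != 0 & M (s *: x)) ->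
  exists z, volume U M z.
Proof.
move=> sM MM0 [B0 [u0 M0P _]] spM; have [p p0 vp] := val_uniformizer vS.
have [M1 [_ [[B1 [u1 M1P _]] M1M]]] := volume_inside sM spM.
have [M00 MD MZ] := sM.
have [|||B uB BP] := @lat_basis _ _ _ vS p p0 vp _ B0 (fun c => M (vcomb c)) B1 u0 u1.
- split=> [|c c' Mc Mc'|a c aS Mc]; first by rewrite linear0.
    by rewrite linearD; apply: MD.
  by rewrite linearZ; apply: MZ.
- by move=> c /MM0 /M0P[_]; rewrite vcombK.
- by move=> c cB; apply/M1M/M1P; rewrite vcomb_mem vcombK.
exists (v (\det B)), B; split=> // x; split=> [Mx|[xU]].
  have xU : x \in U by case/MM0/M0P: (Mx).
  by split=> //; apply/BP; rewrite vcoordK.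
by move/BP; rewrite vcoordK.
Qed.

Lemma volume_exists_bounded (V : vectType K) (U : {vspace V}) M s :
  is_submodule S M -> (forall x, M x -> x \in U) -> s != 0 ->
  (forall x j, M x -> s * coord (vbasis U) j x \in S) ->
  (forall x, x \in U -> exists2 s, s != 0 & M (s *: x)) ->
  exists z, volume U M z.
Proof.
(* The rows of this scalar matrix span the multiple by the inverse of [s] of the standard coordinate
   lattice, which contains [M] by hypothesis. *)
move=> sM MU s0 sP spM; pose B := s^-1%:M : 'M[K]_(\dim U).
have uB : B \in unitmx by rewrite unitmxE det_scalar unitfE expf_neq0 ?invr_eq0.
have iB : invmx B = s%:M.
  rewrite -[LHS]mul1mx; apply: (canLR (mulmxK uB)).
  by rewrite -scalar_mxM divff.
apply: (@volume_exists _ _ _ (fun x => x \in U /\ lat S B (vcoord U x)) (v (\det B)));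
  rewrite //; last by exists B; split.
move=> x Mx; split; first exact: MU.
by apply/mxOverP => i j; rewrite iB mul_mx_scalar !mxE; apply: sP.
Qed.

Lemma volume_exists_fin_gen (V : vectType K) (U : {vspace V}) M M' :
  is_submodule S M -> (forall x, M x -> x \in U) -> fin_gen S M' ->
  Defs.subset M M' ->
  (forall x, x \in U -> exists2 s, s != 0 & M (s *: x)) ->
  exists z, volume U M z.
Proof.
move=> sM MU [m [b bP]] MM' spM.
have [s [s0 sS scS]] := val_denominator vS
  (fun ij : 'I_m * 'I_(\dim U) => coord (vbasis U) ij.2 (b ij.1)).
apply: (volume_exists_bounded sM MU s0) => // x j /MM' /bP[c cS ->].
rewrite linear_sum mulr_sumr rpred_sum // => i _.
by rewrite linearZ /= mulrCA rpredM //; apply: (scS (i, j)).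
Qed.

Lemma scalar_sum (V : vectType K) (f : V -> K) (I : finType) (c : I -> K) b :
  scalar f -> f (\sum_i c i *: b i) = \sum_i c i * f (b i).
Proof.
move=> fL; have f0 : f 0 = 0.
  by have := fL (-1) 0 0; rewrite scaleN1r addNr mulN1r addNr.
by elim/big_rec2: _ => [|i x y _ <-] //; rewrite fL.
Qed.

(** If [Q] is the Gram matrix, the dual of the lattice with basis [B] has basis the inverse of
    [Q *m B^T]. Hence [q] is minus the valuation of the Gram determinant, and it is quantified
    before [M] so that one [q] serves several lattices. *)
Lemma volume_dual (V : vectType K) (U : {vspace V}) (beta : V -> V -> K) :
  (forall x, scalar (beta x)) -> (forall y, scalar (beta^~ y)) ->
  (forall y, y \in U -> (forall z, z \in U -> beta y z = 0) -> y = 0) ->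
  exists q, forall M z, volume U M z ->
    volume U (fun y => y \in U /\ forall x, M x -> beta y x \in S) (q - z).
Proof.
move=> bl br nd; pose e i := (vbasis U)`_i.
pose Q := \matrix_(i < \dim U, j < \dim U) beta (e i) (e j).
have QE y x : y \in U -> x \in U ->
    beta y x = (vcoord U y *m Q *m (vcoord U x)^T) 0 0.
  move=> yU xU; rewrite -{1}(vcoordK yU) -{1}(vcoordK xU) mxE.
  rewrite (scalar_sum _ _ (bl _)); apply: eq_bigr => j _.
  rewrite (scalar_sum _ _ (br _)) mulrC !mxE; congr (_ * _).
  by apply: eq_bigr => i _; rewrite !mxE.
have uQ : Q \in unitmx.
  rewrite -row_free_unit; apply: inj_row_free => c cQ.
  apply: (can_inj (@vcombK _ _ U)); rewrite linear0; apply: nd => [|z zU].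
    exact: vcomb_mem.
  by rewrite QE ?vcomb_mem // vcombK cQ mul0mx mxE.
have dQ : \det Q != 0 by rewrite -unitfE -unitmxE.
exists (- v (\det Q)) => M z [B [uB MP ->]].
have dB : \det B != 0 by rewrite -unitfE -unitmxE.
have uB' : Q *m B^T \in unitmx by rewrite unitmx_mul uQ unitmx_tr.
exists (invmx (Q *m B^T)); split; first by rewrite unitmx_inv.
  move=> y; rewrite /lat invmxK; split=> -[yU yP]; split=> //.
    apply/mxOverP => i j; rewrite ord1.
    have jP : M (vcomb (row j B)).
      apply/MP; rewrite vcomb_mem vcombK rowE; split=> //; apply: lat_mul => //.
      by apply/mxOverP => a b; rewrite mxE rpred_nat.
    have := yP _ jP; rewrite QE ?vcomb_mem // vcombK tr_row -mulmxA colE.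
    by rewrite !mulmxA -colE mxE.
  move=> x /MP[xU xB]; rewrite QE // -(mulmxKV uB (vcoord U x)) trmx_mul.
  rewrite mulmxA -(mulmxA _ Q) mxE rpred_sum // => j _; rewrite rpredM //.
    exact: (mxOverP yP).
  by rewrite mxE; apply: (mxOverP xB).
rewrite det_inv det_mulmx det_tr (val_inv vS) ?mulf_neq0 // (val_mul vS) //.
by rewrite opprD.
Qed.

Lemma volume_scale (V : vectType K) (U : {vspace V}) M z a :
  a != 0 -> volume U M z ->
  volume U (fun x => M (a *: x)) (z - v a * (\dim U)%:Z).
Proof.
move=> a0 [B [uB MP ->]]; have dB : \det B != 0 by rewrite -unitfE -unitmxE.
have u1 : a^-1 *: B \in unitmx by rewrite unitmxZ // unitfE invr_eq0.
exists (a^-1 *: B); split=> // [x|].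
  rewrite /lat invmxZ // invrK -scalemxAr; apply: iff_trans (MP _) _.
  rewrite linearZ /= /lat -scalemxAl; split=> -[xU xB]; split=> //.
    by rewrite -[x](scalerK a0) rpredZ.
  exact: rpredZ.
by rewrite detZ (val_mul vS) ?expf_neq0 ?invr_eq0 // (val_exp vS) ?invr_eq0 //
           (val_inv vS) // mulNr addrC.
Qed.

(** The sizes [m] and [n] are kept apart because in the application one is the dimension of a
    subspace and the other a sum of dimensions, equal only propositionally. *)
Lemma lat_pullback m n (W : 'M[K]_(m, n)) :
  row_free W -> row_full W ->
  exists c0, forall B : 'M[K]_n, B \in unitmx ->
    exists B' : 'M[K]_m, [/\ B' \in unitmx,
      forall x, lat S B' x <-> lat S B (x *m W) & v (\det B') = c0 + v (\det B)].
Proof.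
move=> fW FW; have emn : m = n by rewrite -(eqP fW) (eqP FW).
case: n / emn in W fW FW *; have uW : W \in unitmx by rewrite -row_free_unit.
have dW : \det W != 0 by rewrite -unitfE -unitmxE.
exists (- v (\det W)) => B uB; exists (B *m invmx W).
have dB : \det B != 0 by rewrite -unitfE -unitmxE.
have uBW : B *m invmx W \in unitmx by rewrite unitmx_mul uB unitmx_inv.
split=> // [x|].
  rewrite /lat; suff -> : invmx (B *m invmx W) = W *m invmx B by rewrite mulmxA.
  rewrite -[LHS]mul1mx; apply: (canLR (mulmxK uBW)).
  by rewrite mulmxA mulmxKV // mulmxV.
by rewrite det_mulmx (val_mul vS) ?det_inv ?invr_eq0 // (val_inv vS) // addrC.
Qed.

(** The [p_ i] identify [U] with the product of the [U_ i], and [C] measures the change between the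
    chosen bases on the two sides. Only its independence of the lattices matters: applied to a
    lattice and to its dual, it drops out. *)
Lemma volume_sum (V : vectType K) (U : {vspace V}) m (V_ : 'I_m -> vectType K)
    (U_ : forall i, {vspace V_ i}) (p_ : forall i, V -> V_ i) :
  (forall i, linear (p_ i)) ->
  (forall x, x \in U -> forall i, p_ i x \in U_ i) ->
  (forall x, x \in U -> (forall i, p_ i x = 0) -> x = 0) ->
  (forall y : forall i, V_ i, (forall i, y i \in U_ i) ->
     exists2 x, x \in U & forall i, p_ i x = y i) ->
  exists C, forall (M_ : forall i, V_ i -> Prop) z_,
    (forall i, volume (U_ i) (M_ i) (z_ i)) ->
    volume U (fun x => x \in U /\ forall i, M_ i (p_ i x)) (C + \sum_i z_ i).
Proof.
move=> pL pU pI pS; pose X x := \mxrow_i vcoord (U_ i) (p_ i x).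
pose W := \matrix_(j < \dim U) X (vbasis U)`_j.
have XL : linear X.
  move=> a x y; apply/mxrowP => i; rewrite mxrowK submxrowD.
  rewrite pL linearD linearZ /=; congr (_ + _); last by rewrite mxrowK.
  have sZ (r : 'rV_(\sum_i \dim (U_ i))) : submxrow (a *: r) i = a *: submxrow r i.
    by apply/rowP => j; rewrite !mxE.
  by rewrite sZ mxrowK.
pose Xl := GRing.isLinear.Build K V _ _ X XL.
pose XX : {linear V -> 'rV[K]_(\sum_i \dim (U_ i))} := HB.pack X Xl.
have XE x : x \in U -> X x = vcoord U x *m W.
  move=> xU; rewrite -[in LHS](vcoordK xU) -[X _]/(XX _) linear_sum mulmx_sum_row.
  by apply: eq_bigr => j _; rewrite linearZ /= rowK.
have fW : row_free W.
  apply: inj_row_free => c cW; apply: (can_inj (@vcombK _ _ U)); rewrite linear0.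
  apply: pI => [|i]; first exact: vcomb_mem.
  have : X (vcomb c) = 0 by rewrite XE ?vcomb_mem // vcombK.
  move/mxrowP/(_ i); rewrite mxrowK submxrow0 => e0.
  by rewrite -[LHS](vcoordK (pU _ (vcomb_mem _) i)) e0 linear0.
have FW : row_full W.
  rewrite -sub1mx; apply/row_subP => j.
  have [|x xU xP] := pS (fun i => vcomb (submxrow (row j 1%:M) i)).
    by move=> i; apply: vcomb_mem.
  suff -> : row j 1%:M = vcoord U x *m W by exact: submxMl.
  by rewrite -XE //; apply/mxrowP => i; rewrite mxrowK xP vcombK.
have [c0 c0P] := lat_pullback fW FW; exists c0 => M_ z_ /fin_all_exists[B_ BP].
have uB i : B_ i \in unitmx by case: (BP i).
have dB i : \det (B_ i) != 0 by rewrite -unitfE -unitmxE.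
have [|B' [uB' B'P dB']] := c0P (\mxdiag_i B_ i).
  by rewrite unitmxE det_mxdiag unitfE; apply/prodf_neq0 => i _.
exists B'; split=> //; last first.
  rewrite dB' det_mxdiag (val_prod vS) //; congr (_ + _); apply: eq_bigr => i _.
  by case: (BP i).
have uD : \mxdiag_i B_ i \in unitmx by rewrite unitmxE det_mxdiag unitfE; apply/prodf_neq0 => i _.
move=> x; split=> -[xU Mx]; split=> //.
  apply/B'P; rewrite -XE //.
  have -> : X x = \mxrow_i (vcoord (U_ i) (p_ i x) *m invmx (B_ i)) *m \mxdiag_i B_ i.
    by rewrite mul_mxrow_mxdiag; apply/eq_mxrow => i; rewrite mulmxKV.
  apply: lat_mul => //; apply/mxOverP => a b; rewrite mxE ord1.
  have [_ MP _] := BP (tagnat.sig1 b); have /MP[_ /mxOverP] := Mx (tagnat.sig1 b).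
  exact.
move=> i; have [_ MP _] := BP i; apply/MP; split; first exact: pU.
have := Mx; move/B'P; rewrite -XE //; set D := \mxdiag_i B_ i => XD.
have := mulmxKV uD (X x); rewrite -/D.
set c := X x *m invmx D => e.
have := congr1 (fun r => submxrow r i) e.
rewrite -{1}(submxrowK c) mul_mxrow_mxdiag !mxrowK => <-.
apply: lat_mul => //; apply/mxOverP => a b; rewrite mxE.
exact: (mxOverP XD).
Qed.

End Volume.

(** * Galois traces on fixed fields *)

(** A trace may be computed from any reproducing system, even a redundant one: expanding both the
    values and the [z i] in a basis and exchanging sums gives the same double sum. *)
Lemma trace_on_dual (K : fieldType) (V : vectType K) (U : {vspace V})
    (I : finType) (phi : I -> V -> K) (z : I -> V) (f : V -> V) :
  (forall i, scalar (phi i)) -> (forall i, z i \in U) -> linear f ->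
  (forall x, x \in U -> f x \in U) ->
  (forall x, x \in U -> x = \sum_i phi i x *: z i) ->
  trace_on U f = \sum_i phi i (f (z i)).
Proof.
move=> phiL zU fL fU E; rewrite /trace_on.
have f_sum m (c : 'I_m -> K) b : f (\sum_j c j *: b j) = \sum_j c j *: f (b j).
  have f0 : f 0 = 0 by have := fL (-1) 0 0; rewrite scaleN1r addNr scaleN1r addNr.
  by elim/big_rec2: _ => [|i x y _ <-] //; rewrite fL.
transitivity (\sum_(j < \dim U) \sum_i
    phi i (f (vbasis U)`_j) * coord (vbasis U) j (z i)).
  apply: eq_bigr => j _; rewrite {1}(E (f _)) ?fU ?vbasis_nth_mem //.
  by rewrite linear_sum; apply: eq_bigr => i _; rewrite linearZ.
rewrite exchange_big; apply: eq_bigr => i _ /=.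
rewrite {2}(coord_vbasis (zU i)) f_sum (scalar_sum _ _ (phiL i)).
by apply: eq_bigr => j _; rewrite mulrC.
Qed.

Section GaloisAction.
Variables (K : fieldType) (L : fieldExtType K) (gT : finGroupType).
Variable to : galact L gT.

Lemma galact_by_monoid_morphism s : monoid_morphism (galact_by to s).
Proof. by split=> [|y z]; rewrite /galact_by ?galact_r1 ?galact_rM. Qed.
HB.instance Definition _ s := GRing.isMonoidMorphism.Build L L (galact_by to s)
  (galact_by_monoid_morphism s).

Lemma galact_sum (I : Type) (r : seq I) (P : pred I) (F : I -> L) s :
  to (\sum_(i <- r | P i) F i) s = \sum_(i <- r | P i) to (F i) s.
Proof. exact: (rmorph_sum (galact_by to s)). Qed.

Lemma galact0 s : to 0 s = 0.
Proof. exact: (rmorph0 (galact_by to s)). Qed.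

Lemma galactV y s : to y^-1 s = (to y s)^-1.
Proof. exact: (fmorphV (galact_by to s)). Qed.

Lemma galact_nat m s : to m%:R s = m%:R.
Proof. exact: (rmorph_nat (galact_by to s)). Qed.

Lemma galact_alg (a : K) s : to a%:A s = a%:A.
Proof. by rewrite galact_scale galact_r1. Qed.

Lemma galactK s y : to (to y s) s^-1%g = y.
Proof. by rewrite -galactM mulgV galact1. Qed.

Lemma galactKV s y : to (to y s^-1%g) s = y.
Proof. by rewrite -galactM mulVg galact1. Qed.

Lemma galact_invariant y : (forall s, to y s = y) -> exists a : K, y = a%:A.
Proof. by move/galact_fix/vlineP. Qed.

Variable N : {group gT}.
Hypothesis hN : forall s, s \in N <-> (forall y : L, to y s = y).

Lemma galact_kerJ nu s : nu \in N -> (nu ^ s)%g \in N.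
Proof.
move=> /hN nuN; apply/hN => y.
by rewrite /conjg !galactM nuN galactKV.
Qed.

(* The element sum_k y_k (x) z_k of L (x)_K L constructed here is the
   separability idempotent of L over K. *)
Lemma separability_pairs :
  exists m (y z : 'I_m -> L), forall t,
    \sum_i to (y i) t * z i = (t \in N)%:R.
Proof.
pose ev (s : seq (L * L)) t := \sum_(p <- s) to p.1 t * p.2.
suff [s [s0 s1]] : exists s, (forall t, t \in enum gT -> t \notin N -> ev s t = 0) /\
                     (forall t, t \in N -> ev s t = 1).
  pose a i := nth (0, 0) s i; exists (size s), (fun i => (a i).1), (fun i => (a i).2) => t.
  transitivity (ev s t); first by rewrite /ev (big_nth (0, 0)) big_mkord.
  by case: (boolP (t \in N)) => tN; [rewrite s1 | rewrite s0 // mem_enum].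
elim: (enum gT) => [|u r [s [s0 s1]]].
  exists [:: (1, 1)]; split=> // t _; rewrite /ev big_seq1 galact_r1 mulr1 //.
have evM s1' s2 t : ev [seq (a.1 * b.1, a.2 * b.2) | a <- s1', b <- s2] t
    = ev s1' t * ev s2 t.
  rewrite /ev big_allpairs_dep big_distrl; apply: eq_bigr => a _ /=.
  by rewrite big_distrr; apply: eq_bigr => b _ /=; rewrite galact_rM mulrACA.
have [uN|uN] := boolP (u \in N).
  exists s; split=> // t; rewrite inE => /orP[/eqP ->|]; last exact: s0.
  by rewrite uN.
have [y yu] : exists y, to y u != y.
  apply: NNPP => ny; move/negP: uN; apply; apply/hN => y.
  by apply/eqP; apply: contra_notT ny => yu; exists y.
have y0 : y - to y u != 0 by rewrite subr_eq0 eq_sym.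
(* The tensor (y (x) 1 - 1 (x) y^u) / (y - y^u): its evaluation vanishes at [u] and is 1 on N.
   Multiplying such factors removes the elements outside N one by one. *)
pose s' := [:: (y, (y - to y u)^-1); (1, - to y u / (y - to y u))].
have ev' t : ev s' t = (to y t - to y u) / (y - to y u).
  by rewrite /ev big_cons big_seq1 galact_r1 mul1r mulrBl mulNr.
exists [seq (a.1 * b.1, a.2 * b.2) | a <- s', b <- s]; split=> [t|t tN]; rewrite evM.
  rewrite inE => /orP[/eqP ->|tr tN]; first by rewrite ev' subrr !mul0r.
  by rewrite s0 // mulr0.
by rewrite s1 // mulr1 ev' (hN t).1 // divff.
Qed.

Hypothesis n_inv : (#|N|%:R : K) != 0.

Lemma natr_alg m : (m%:R : L) = (m%:R : K)%:A.
Proof. by rewrite -[RHS]/(in_alg L _) rmorph_nat. Qed.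

Lemma natr_alg_neq0 m : (m%:R : K) != 0 -> (m%:R : L) != 0.
Proof. by move=> m0; rewrite natr_alg scaler_eq0 oner_eq0 orbF. Qed.

Lemma card_ker_neq0 : (#|N|%:R : L) != 0.
Proof. exact: natr_alg_neq0. Qed.

Lemma galact_ker_norm (A : {set gT}) : A \subset 'N(N)%g.
Proof.
apply/subsetP => u _; apply/normP/eqP; rewrite eqEcard cardJg leqnn andbT.
by apply/subsetP => _ /imsetP[nu nuN ->]; apply: galact_kerJ.
Qed.

Section Subgroup.
Variable C : {group gT}.
Let F := fixed_field to C.
Let kappa : L := #|C :&: N|%:R.

Lemma fixed_field_galact y s : y \in F -> s \in C -> to y s = y.
Proof. by move=> /mem_fixed_field yF /yF. Qed.

Lemma fixed_field_mulG y s : y \in F -> s \in (C * N)%g -> to y s = y.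
Proof.
by move=> yF /mulsgP[c nu cC nuN ->]; rewrite galactM (fixed_field_galact yF cC) (hN nu).1.
Qed.

Lemma fixed_fieldM y z : y \in F -> z \in F -> y * z \in F.
Proof.
move=> yF zF; apply/mem_fixed_field => s sC.
by rewrite galact_rM (fixed_field_galact yF) ?(fixed_field_galact zF).
Qed.

Lemma card_capN_neq0 : (#|C :&: N|%:R : K) != 0.
Proof.
have /dvdnP[q Nq] : (#|C :&: N| %| #|N|)%N by rewrite cardSg ?subsetIr.
by move: n_inv; rewrite Nq natrM mulf_eq0 negb_or => /andP[].
Qed.

Let kappa0 : kappa != 0. Proof. by rewrite natr_alg_neq0 ?card_capN_neq0. Qed.

Lemma count_mulgN t :
  \sum_(s in C) ((s * t)%g \in N)%:R = (t \in (C * N)%g)%:R * kappa.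
Proof.
have [/mulsgP[c nu cC nuN ->]|tCN] := boolP (t \in (C * N)%g); last first.
  rewrite mul0r big1 // => s sC; case: (boolP (_ \in N)) => // stN.
  case/negP: tCN; apply/mulsgP; exists s^-1%g (s * t)%g; rewrite ?groupV //.
  by rewrite mulKg.
rewrite mul1r (reindex_inj (mulIg c^-1%g)) /=.
rewrite (eq_bigl (fun s => s \in C)) => [|s]; last by rewrite /= groupMr ?groupV.
rewrite /kappa -sum1_card natr_sum big_mkcond [RHS]big_mkcond.
apply: eq_bigr => s _; rewrite mulgA mulgKV groupMr //.
by rewrite in_setI; case: (s \in C); case: (s \in N).
Qed.

Let trC (y : L) : L := \sum_(s in C) to y s.

Let trC_fix y : trC y \in F.
Proof.
apply/mem_fixed_field => t tC; rewrite /trC galact_sum.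
rewrite [RHS](reindex_inj (mulIg t)); apply: eq_big => s; first by rewrite groupMr.
by rewrite galactM.
Qed.

Let trCM w y : w \in F -> trC (w * y) = w * trC y.
Proof.
move=> wF; rewrite /trC mulr_sumr; apply: eq_bigr => s sC.
by rewrite galact_rM (fixed_field_galact wF).
Qed.

(** Up to the factor |C :&: N| by which each automorphism is repeated, this is an element of trace 1
    from L to [F]. The sum over C cannot vanish on all of L, for the separability pairs would then
    give |C :&: N| = 0; the sum is linear over [F], so a nonzero value can be rescaled. *)
Lemma fixed_field_trace_elt : exists c : L, \sum_(s in C) to c s = kappa.
Proof.
have [m [y [z yz]]] := separability_pairs.
have [i ti] : exists i, trC (y i) != 0.
  apply: NNPP => ti; case/eqP: kappa0.
  transitivity (\sum_i trC (y i) * z i); last first.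
    rewrite big1 // => i _; have [->|tn] := eqVneq (trC (y i)) 0; first by rewrite mul0r.
    by case: ti; exists i.
  rewrite (eq_bigr (fun i => \sum_(s in C) to (y i) s * z i)); last first.
    by move=> i _; rewrite /trC mulr_suml.
  rewrite exchange_big /=; under eq_bigr do rewrite yz.
  rewrite -[RHS]/(\sum_(s in C) _); transitivity (\sum_(s in C) ((s * 1)%g \in N)%:R : L).
    by rewrite count_mulgN -(mulg1 1%g) mem_mulg ?mul1r.
  by apply: eq_bigr => s _; rewrite mulg1.
exists ((trC (y i))^-1 * kappa * y i); rewrite -/(trC _) trCM; last first.
  apply/mem_fixed_field => s sC; rewrite galact_rM galactV fixed_field_galact //.
  by rewrite galact_nat.
by rewrite mulrAC mulVf // mul1r.
Qed.

Lemma sum_mulGN (f : gT -> L) :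
  \sum_(s in C) \sum_(nu in N) f (s * nu)%g = kappa * \sum_(t in (C * N)%g) f t.
Proof.
transitivity (\sum_(s in C) \sum_t ((s^-1 * t)%g \in N)%:R * f t).
  apply: eq_bigr => s sC; rewrite (reindex_inj (mulgI s^-1%g)) big_mkcond /=.
  by apply: eq_bigr => t _; rewrite mulKVg; case: (_ \in N); rewrite ?mul1r ?mul0r.
rewrite exchange_big mulr_sumr [RHS]big_mkcond /=; apply: eq_bigr => t _.
rewrite -mulr_suml (reindex_inj invg_inj) /=.
rewrite (eq_bigl (fun s => s \in C)) => [|s]; last by rewrite /= groupV.
under eq_bigr do rewrite invgK.
by rewrite count_mulgN; case: (t \in _); rewrite ?mul1r // mul0r mul0r.
Qed.

Section Trace.
Variable c : L.
Hypothesis cC : \sum_(s in C) to c s = kappa.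

(** The trace of [c * y] from L to K. As [c] has relative trace 1 over [F], it restricts on [F] to
    the trace of [F] over K, which is proved below. *)
Let lam y : L := #|N|%:R^-1 * \sum_t to (c * y) t.

Lemma fixed_field_trace_elt_mulG : \sum_(t in (C * N)%g) to c t = #|N|%:R.
Proof.
apply: (mulfI kappa0); rewrite -sum_mulGN.
transitivity (\sum_(s in C) to c s * #|N|%:R); last by rewrite -mulr_suml cC.
apply: eq_bigr => s sC; rewrite -sum1_card natr_sum mulr_sumr.
by apply: eq_bigr => nu nuN; rewrite galactM (hN nu).1 ?mulr1.
Qed.

Let lam_alg y : exists a : K, lam y = a%:A.
Proof.
apply: galact_invariant => s; rewrite galact_rM galactV galact_nat galact_sum.
congr (_ * _); rewrite [RHS](reindex_inj (mulIg s)).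
by apply: eq_bigr => t _; rewrite galactM.
Qed.

Let lamK (y : L) : K := coord [tuple (1 : L)] ord0 (lam y).

Let lamKE y : (lamK y)%:A = lam y.
Proof.
rewrite /lamK; have [a ->] := lam_alg y; rewrite linearZ /=.
have := @coord_free _ _ _ [tuple (1 : L)] ord0 ord0; rewrite /= => -> //.
  by rewrite mulr1.
by rewrite seq1_free oner_eq0.
Qed.

Let lamK_scalar : scalar lamK.
Proof.
move=> a y z; rewrite /lamK -linearP; congr (coord _ _ _).
rewrite /lam scalerAr -mulrDr scaler_sumr -big_split /=; congr (_ * _).
by apply: eq_bigr => t _; rewrite -galact_scale -galact_rD scalerAr mulrDr.
Qed.

(** The separability pairs of L are pushed down to [F] by relative traces, the second factors being
    weighted by [c] so that the evaluation at the identity stays 1. The indicator of N widens to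
    that of C N, whose elements act trivially on [F]. *)
Lemma fixed_field_dual : exists m (y z : 'I_m -> L),
  [/\ forall i, y i \in F, forall i, z i \in F
    & forall t, \sum_i to (y i) t * z i = (t \in (C * N)%g)%:R].
Proof.
have [m [y [z yz]]] := separability_pairs.
have ykN t : \sum_i to (kappa^-1 * trC (y i)) t * z i = (t \in (C * N)%g)%:R.
  transitivity (kappa^-1 * \sum_i \sum_(s in C) to (y i) (s * t)%g * z i).
    rewrite mulr_sumr; apply: eq_bigr => i _.
    rewrite galact_rM galactV galact_nat -mulrA; congr (_ * _).
    by rewrite galact_sum mulr_suml; apply: eq_bigr => s _; rewrite galactM.
  rewrite exchange_big /=; under eq_bigr do rewrite yz.
  by rewrite count_mulgN mulrCA mulVf ?mulr1.
have kF w : trC w \in F -> kappa^-1 * trC w \in F.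
  move=> wF; apply/mem_fixed_field => s sC.
  by rewrite galact_rM galactV galact_nat fixed_field_galact.
exists m, (fun i => kappa^-1 * trC (y i)), (fun i => kappa^-1 * trC (c * z i)).
split=> [i|i|t]; [exact: kF | exact: kF |].
transitivity (kappa^-1 * \sum_(s in C) \sum_i
    to (to (kappa^-1 * trC (y i)) (t * s^-1)%g * z i * c) s).
  rewrite exchange_big mulr_sumr; apply: eq_bigr => i _ /=.
  rewrite mulrCA; congr (_ * _); rewrite [trC (c * z i)]/trC mulr_sumr.
  apply: eq_bigr => s sC.
  set w := kappa^-1 * trC (y i).
  by clearbody w; rewrite !galact_rM -galactM mulgKV mulrAC mulrA.
have tE s : s \in C -> ((t * s^-1)%g \in (C * N)%g) = (t \in (C * N)%g).
  move=> sC.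
  rewrite -(norm_joinEl (galact_ker_norm C)) groupMr // groupV; apply: subsetP sC.
  by rewrite joing_subl.
transitivity (kappa^-1 * \sum_(s in C) (t \in (C * N)%g)%:R * to c s).
  congr (_ * _); apply: eq_bigr => s sC.
  rewrite -galact_sum -mulr_suml ykN tE // galact_rM; congr (_ * _).
  by rewrite galact_nat.
by rewrite -mulr_sumr cC mulrCA mulVf ?mulr1.
Qed.

Let lam_reproducing m (y z : 'I_m -> L) x :
  (forall i, y i \in F) ->
  (forall t, \sum_i to (y i) t * z i = (t \in (C * N)%g)%:R) ->
  x \in F -> x = \sum_i lamK (x * y i) *: z i.
Proof.
move=> yF yz xF; transitivity (#|N|%:R^-1 * \sum_t to (c * x) t * (t \in (C * N)%g)%:R).
  transitivity (#|N|%:R^-1 * \sum_(t in (C * N)%g) to c t * x).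
    by rewrite -mulr_suml fixed_field_trace_elt_mulG mulKf ?card_ker_neq0.
  congr (_ * _); rewrite big_mkcond; apply: eq_bigr => t _.
  case: (boolP (t \in _)) => tCN; last by rewrite mulr0.
  by rewrite mulr1 galact_rM (fixed_field_mulG xF tCN).
transitivity (\sum_i lam (x * y i) * z i); last first.
  by apply: eq_bigr => i _; rewrite -lamKE mulr_algl.
transitivity (#|N|%:R^-1 * \sum_t \sum_i to (c * x) t * (to (y i) t * z i)).
  by congr (_ * _); apply: eq_bigr => t _; rewrite -mulr_sumr yz.
rewrite exchange_big mulr_sumr; apply: eq_bigr => i _ /=.
rewrite /lam -mulrA mulr_suml; congr (_ * _); apply: eq_bigr => t _.
by rewrite mulrA -galact_rM mulrA.
Qed.

(** The pairs of [fixed_field_dual] form a reproducing system for [lamK], so [trace_on_dual]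
    applies, and the sum of the products [y' i * z' i] is the evaluation at the identity, namely
    1. *)
Lemma fixed_field_trace y : y \in F ->
  #|N|%:R * (trace_on F ( *%R y))%:A = \sum_t to (c * y) t.
Proof.
move=> yF; have [m [y' [z' [y'F z'F yz]]]] := fixed_field_dual.
rewrite (@trace_on_dual _ _ F _ (fun i x => lamK (x * y' i)) z').
- have -> : \sum_i lamK (y * z' i * y' i) = lamK y.
    transitivity (lamK (\sum_i 1 *: (y * z' i * y' i))).
      by rewrite (scalar_sum _ _ lamK_scalar); apply: eq_bigr => i _; rewrite mul1r.
    have e1 : (1%g \in (C * N)%g)%:R = 1 :> L by rewrite -(mulg1 1%g) mem_mulg.
    congr lamK; rewrite -[RHS]mulr1 -e1 -yz mulr_sumr; apply: eq_bigr => i _.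
    by rewrite galact1 scale1r -mulrA [z' i * _]mulrC.
  by rewrite lamKE mulVKf ?card_ker_neq0.
- by move=> i a u w; rewrite mulrDl -scalerAl lamK_scalar.
- exact: z'F.
- by move=> a u w; rewrite mulrDr scalerAr.
- by move=> x xF; apply: fixed_fieldM.
- by move=> x xF; apply: lam_reproducing.
Qed.

Let lam_trace y : y \in F -> lamK y = trace_on F ( *%R y).
Proof.
move=> yF; apply: (fmorph_inj (in_alg L)).
by rewrite /= lamKE /lam -fixed_field_trace // mulKf ?card_ker_neq0.
Qed.

Lemma fixed_field_nondegenerate y : y \in F ->
  (forall z, z \in F -> trace_on F ( *%R (y * z)) = 0) -> y = 0.
Proof.
move=> yF yz0; have [m [y' [z' [y'F z'F yz]]]] := fixed_field_dual.
rewrite (lam_reproducing y'F yz yF) big1 // => i _.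
by rewrite lam_trace ?fixed_fieldM // yz0 ?scale0r.
Qed.

(** Expanding the second factors of the pairs in [vbasis F] and regrouping makes the first factors
    the trace-dual basis. *)
Lemma fixed_field_dual_basis : exists y : 'I_(\dim F) -> L,
  [/\ forall i, y i \in F,
      forall t, \sum_i to (y i) t * (vbasis F)`_i = (t \in (C * N)%g)%:R
    & forall i j : 'I_(\dim F), trace_on F ( *%R (y i * (vbasis F)`_j)) = (i == j)%:R].
Proof.
have [m [y [z [yF zF yz]]]] := fixed_field_dual.
pose y' j : L := \sum_i coord (vbasis F) j (z i) *: y i.
have y'F j : y' j \in F by rewrite rpred_sum // => i _; rewrite rpredZ.
have y'z t : \sum_i to (y' i) t * (vbasis F)`_i = (t \in (C * N)%g)%:R.
  rewrite -yz [RHS](eq_bigr (fun i => \sum_j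
      (coord (vbasis F) j (z i) *: to (y i) t) * (vbasis F)`_j)); last first.
    move=> i _; rewrite {1}(coord_vbasis (zF i)) mulr_sumr; apply: eq_bigr => j _.
    by rewrite -scalerAr scalerAl.
  rewrite exchange_big; apply: eq_bigr => j _ /=.
  rewrite -mulr_suml galact_sum; congr (_ * _); apply: eq_bigr => i _.
  by rewrite galact_scale.
exists y'; split=> // i j.
have bF : (vbasis F)`_j \in F by apply: vbasis_nth_mem.
have := lam_reproducing y'F y'z bF.
move=> /(congr1 (coord (vbasis F) i)).
rewrite coord_sum_free ?(basis_free (vbasisP F)) //.
rewrite coord_free ?(basis_free (vbasisP F)) // => e.
by rewrite eq_sym e [in RHS]mulrC lam_trace // fixed_fieldM.
Qed.

Let H := (C <*> N)%G.
Let HE : H = (C * N)%g :> {set gT}.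
Proof. exact: norm_joinEl (galact_ker_norm C). Qed.

(** The classical sum over embeddings of [F]. It has no denominator, so the trace of an integral
    element is visibly integral. *)
Lemma fixed_field_trace_cosets y : y \in F ->
  (trace_on F ( *%R y))%:A = \sum_(Y in rcosets (C <*> N) [set: gT]) to y (repr Y).
Proof.
move=> yF; apply: (mulfI card_ker_neq0); rewrite fixed_field_trace // mulr_sumr.
transitivity (\sum_(t in [set: gT]) to (c * y) t).
  by apply: eq_bigl => t; rewrite inE.
rewrite (set_partition_big _ (rcosets_partition (subsetT H))) /=.
apply: eq_bigr => _ /rcosetsP[x0 _ ->]; set x := repr _.
have -> : (H :* x0)%g = (H :* x)%g by rewrite rcoset_repr.
rewrite (reindex_inj (mulIg x)) /=.
rewrite (eq_bigl (fun s => s \in (C * N)%g)) => [|s]; last first.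
  by rewrite mem_rcoset mulgK HE.
rewrite -(galact_nat #|N| x) -fixed_field_trace_elt_mulG -galact_rM mulr_suml.
rewrite galact_sum; apply: eq_bigr => s sCN; rewrite galactM; congr (to _ _).
by rewrite galact_rM (fixed_field_mulG yF sCN).
Qed.

(** Conjugates of a basis and of its dual basis over the cosets of C N form two matrices. That
    [U' *m U] is the identity bounds the number of cosets by the dimension; independence of the rows
    of [U] gives the converse. For centralizers this identifies h_nu with the degree of L_nu. *)
Lemma dim_fixed_field : \dim F = (#|gT| %/ #|(C * N)%g|)%N.
Proof.
have [b [bF bz tb]] := fixed_field_dual_basis.
pose R := rcosets H [set: gT].
have cR : #|R| = (#|gT| %/ #|(C * N)%g|)%N.
  by rewrite -HE -[#|gT|]cardsT divgS ?subsetT.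
rewrite -cR; pose x (i : 'I_#|R|) := repr (enum_val i).
have xE i : enum_val i = (H :* x i)%g.
  by have /rcosetsP[t _ e] := enum_valP i; rewrite /x e rcoset_repr.
have xx i j : ((x i * (x j)^-1)%g \in (C * N)%g) = (i == j).
  rewrite -HE -mem_rcoset; apply/idP/eqP => [|->]; last by rewrite rcoset_refl.
  by move/rcoset_eqP => e; apply: enum_val_inj; rewrite !xE.
pose U := \matrix_(j < \dim F, i < #|R|) to (vbasis F)`_j (x i).
pose U' := \matrix_(i < #|R|, j < \dim F) to (b j) (x i).
have U'U : U' *m U = 1%:M.
  apply/matrixP=> i j; rewrite !mxE -xx -(galact_nat _ (x j)) -bz galact_sum.
  by apply: eq_bigr => l _; rewrite !mxE galact_rM -galactM mulgKV.
apply/eqP; rewrite eqn_leq; apply/andP; split; last first.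
  by rewrite -(mxrank1 L #|R|) -U'U (leq_trans (mxrankM_maxr _ _)) ?rank_leq_row.
suff /eqP <- : row_free U by apply: rank_leq_col.
apply: inj_row_free => a aU; apply/rowP => i; rewrite mxE.
have a0 t : \sum_j a 0 j * to (vbasis F)`_j t = 0.
  have tR : (H :* t)%g \in R by apply/rcosetsP; exists t.
  have tx : t \in (H :* x (enum_rank_in tR (H :* t)%g))%g.
    by rewrite -xE enum_rankK_in // rcoset_refl.
  move: tx; move: (enum_rank_in _ _) => l /rcosetP[s sH ->].
  move/rowP/(_ l): aU; rewrite !mxE => e; rewrite -[RHS]e; apply: eq_bigr => j _.
  rewrite mxE galactM (fixed_field_mulG (vbasis_nth_mem _)) //.
  by rewrite -HE.
(* The relation [a0] is multiplied by the conjugates of [c * b i] and summed over G; by trace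
   duality only n times the coefficient [a 0 i] survives. *)
apply: (mulIf card_ker_neq0).
transitivity (\sum_j a 0 j * (\sum_t to (c * (b i * (vbasis F)`_j)) t)).
  rewrite (bigD1 i) //= -fixed_field_trace ?fixed_fieldM ?vbasis_nth_mem //.
  rewrite tb eqxx scale1r mulr1 big1 ?addr0 // => j ji.
  rewrite -fixed_field_trace ?fixed_fieldM ?vbasis_nth_mem //.
  by rewrite tb eq_sym (negPf ji) scale0r !mulr0.
under eq_bigr do rewrite mulr_sumr; rewrite exchange_big mul0r big1 // => t _.
transitivity (to (c * b i) t * \sum_j a 0 j * to (vbasis F)`_j t).
  by rewrite mulr_sumr; apply: eq_bigr => j _; rewrite mulrA galact_rM mulrCA.
by rewrite a0 mulr0.
Qed.

End Trace.
End Subgroup.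
End GaloisAction.

(** * The integral closure of S in L *)

Section SubringType.
Variables (K : fieldType) (S : subringClosed K).
(** [S] as a ring of its own, so that integrality over [S] becomes an instance of [integralOver] and
    inherits its closure properties. *)
Definition subring_sort : Type := {x : K | x \in S}.
HB.instance Definition _ := SubChoice.on subring_sort.
HB.instance Definition _ := [SubChoice_isSubComNzRing of subring_sort by <:].
End SubringType.

Section IntegralClosure.
Variables (K : fieldType) (S : subringClosed K) (L : fieldExtType K).

Let RtoL_rmorphism : {rmorphism subring_sort S -> L} := (in_alg L \o val)%FUN.

Lemma integral_closureE y :
  integral_closure S L y <-> integralOver RtoL_rmorphism y.
Proof.
split=> [[p [pm pS py]]|[p pm py]]; last first.
  exists (map_poly val p); split.
  - exact: monic_map.
  - by apply/polyOverP => i; rewrite coef_map; apply: valP.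
  - by rewrite -map_poly_comp.
apply: (integral_root_monic _ py); first by rewrite map_monic.
move=> _ /(nthP 0)[i _ <-]; rewrite coef_map.
have pi := polyOverP pS i.
exact: (integral_id RtoL_rmorphism (Sub p`_i pi : subring_sort S)).
Qed.

Lemma integral_closure_alg a : a \in S -> integral_closure S L a%:A.
Proof.
move=> aS; apply/integral_closureE.
exact: (integral_id RtoL_rmorphism (Sub a aS : subring_sort S)).
Qed.

Lemma integral_closure0 : integral_closure S L 0.
Proof. exact/integral_closureE/integral0. Qed.

Lemma integral_closureD y z :
  integral_closure S L y -> integral_closure S L z -> integral_closure S L (y + z).
Proof.
by move=> /integral_closureE ? /integral_closureE ?; exact/integral_closureE/integral_add.
Qed.

Lemma integral_closureM y z :
  integral_closure S L y -> integral_closure S L z -> integral_closure S L (y * z).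
Proof.
by move=> /integral_closureE ? /integral_closureE ?; exact/integral_closureE/integral_mul.
Qed.

Lemma integral_closureZ a y :
  a \in S -> integral_closure S L y -> integral_closure S L (a *: y).
Proof.
by move=> aS yT; rewrite -mulr_algl; apply: integral_closureM => //; apply: integral_closure_alg.
Qed.

Lemma integral_closure_sum (I : Type) (r : seq I) (P : pred I) (F : I -> L) :
  (forall i, P i -> integral_closure S L (F i)) ->
  integral_closure S L (\sum_(i <- r | P i) F i).
Proof.
move=> FT; elim/big_ind: _ => //; first exact: integral_closure0.
exact: integral_closureD.
Qed.

Lemma integral_closure_galact (gT : finGroupType) (to : galact L gT) y s :
  integral_closure S L y -> integral_closure S L (to y s).
Proof.
move=> [p [pm pS py]]; exists p; split=> //.
have /= := rmorph_root (galact_by to s) py.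
rewrite -map_poly_comp; congr (root _ _); apply: eq_map_poly => a /=.
exact: galact_alg.
Qed.

Variable v : K -> int.
Hypothesis vS : valuation_ring S v.

Lemma integral_closure_base a : integral_closure S L a%:A -> a \in S.
Proof.
move=> [p [pm pS]]; rewrite -[a%:A]/(in_alg L a) fmorph_root.
exact: (val_integrally_closed vS pm pS).
Qed.

(** A common denominator [s] makes the matrix of multiplication by [s *: y] integral. Its
    characteristic polynomial is monic over [S] and has [s *: y] as a root, the row of basis vectors
    being an eigenvector over L. *)
Lemma integral_closure_spans y :
  exists s, [/\ s != 0, s \in S & integral_closure S L (s *: y)].
Proof.
pose b := vbasis {:L}.
pose A := \matrix_(j < \dim {:L}, i < \dim {:L}) coord b j (y * b`_i).
have [s [s0 sS sA]] := val_denominator vS (fun ij => A ij.1 ij.2).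
exists s; split=> //; exists (char_poly (s *: A)); split.
- exact: char_poly_monic.
- apply: det_mxOver; apply/mxOverP => i j; rewrite !mxE.
  rewrite rpredB ?rpredMn ?polyOverX // polyOverC.
  by have := sA (i, j); rewrite mxE.
rewrite map_char_poly -eigenvalue_root_char; apply/eigenvalueP.
exists (\row_i b`_i); last first.
  have d0 : (0 < \dim {:L})%N by rewrite adim_gt0.
  apply/negP => /eqP/rowP/(_ (Ordinal d0)); rewrite !mxE /= => b0.
  have := basis_free (vbasisP {:L}); move/free_not0 => /(_ 0); rewrite -/b.
  by rewrite -b0 mem_nth ?size_tuple // => /(_ isT); rewrite eqxx.
apply/rowP=> i; rewrite !mxE -scalerAl (coord_vbasis (memvf (y * b`_i))).
rewrite scaler_sumr; apply: eq_bigr => j _; rewrite !mxE /=.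
by rewrite mulr_algr scalerA.
Qed.

End IntegralClosure.

(** * Simple modules and density *)

Section RmodEval.
Variables (K : fieldType) (A : falgType K).
Implicit Types X Y : rmod A.

Definition rmod_ev X (x : X) (a : A) : X := rmod_act X a x.

Lemma rmod_ev_is_linear X (x : X) : linear (rmod_ev x).
Proof. by move=> c a b; rewrite /rmod_ev linearP !lfunE /= !lfunE. Qed.
HB.instance Definition _ X (x : X) :=
  GRing.isLinear.Build K A X _ (rmod_ev x) (rmod_ev_is_linear x).

Lemma rmod_actMx X (x : X) a b :
  rmod_act X (a * b) x = rmod_act X b (rmod_act X a x).
Proof. by rewrite rmod_actM comp_lfunE. Qed.

Lemma rmod_act1x X (x : X) : rmod_act X 1 x = x.
Proof. by rewrite rmod_act1 id_lfunE. Qed.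

Definition rmod_hom X Y (f : 'Hom(X, Y)) : Prop :=
  forall a x, f (rmod_act X a x) = rmod_act Y a (f x).

Lemma rmod_schur X Y (f : 'Hom(X, Y)) :
  rmod_simple X -> rmod_simple Y -> rmod_hom f -> f <> 0 ->
  lker f = 0%VS /\ limg f = fullv.
Proof.
move=> [_ sX] [_ sY] fH f0; split.
  have [|//|kf] := sX (lker f); last case: f0.
    by move=> a x; rewrite !memv_ker fH => /eqP ->; rewrite linear0.
  by apply/lfunP => x; apply/eqP; rewrite [X in _ == X]lfunE /= -memv_ker kf memvf.
have [|li|//] := sY (limg f); last case: f0.
  by move=> a y /memv_imgP[x _ ->]; rewrite -fH memv_img ?memvf.
by apply/lfunP => x; apply/eqP; rewrite [X in _ == X]lfunE /= -memv0 -li memv_img ?memvf.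
Qed.

Lemma rmod_end_inverse X (f : 'End(X)) :
  rmod_simple X -> f \in rmod_end X -> f <> 0 ->
  exists2 g, g \in rmod_end X & (g \o f = \1)%VF /\ (f \o g = \1)%VF.
Proof.
move=> sX /mem_rmod_end fX f0; have [kf lf] := rmod_schur sX sX fX f0.
have gf : (f^-1 \o f = \1)%VF by rewrite lker0_compVf ?kf.
have fg : (f \o f^-1 = \1)%VF by rewrite lker0_compfV ?kf.
exists (f^-1)%VF => //; apply/mem_rmod_end => a x.
have fE y : f ((f^-1)%VF y) = y by rewrite -comp_lfunE fg id_lfunE.
have fE' y : (f^-1)%VF (f y) = y by rewrite -comp_lfunE gf id_lfunE.
by rewrite -{1}(fE x) -fX fE'.
Qed.

Lemma rmod_end_comp X (f g : 'End(X)) :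
  f \in rmod_end X -> g \in rmod_end X -> (f \o g)%VF \in rmod_end X.
Proof.
move=> /mem_rmod_end fX /mem_rmod_end gX; apply/mem_rmod_end => a x.
by rewrite !comp_lfunE /= gX fX.
Qed.

Lemma rmod_end1 X : \1%VF \in rmod_end X.
Proof. by apply/mem_rmod_end => a x; rewrite !id_lfunE. Qed.

End RmodEval.

Section DivisionSpan.
Variables (K : fieldType) (V : vectType K) (E : {vspace 'End(V)}) (W : {vspace V}).
Hypothesis E_id : \1%VF \in E.
Hypothesis E_comp : forall e e', e \in E -> e' \in E -> (e \o e')%VF \in E.
Hypothesis E_div : forall e, e \in E -> e <> 0 ->
  exists2 e', e' \in E & (e' \o e = \1)%VF.
Hypothesis E_stable : forall e x, e \in E -> x \in W -> e x \in W.

Definition lfun_at (x : V) (e : 'End(V)) : V := e x.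
Lemma lfun_at_is_linear x : linear (lfun_at x).
Proof. by move=> c e e'; rewrite /lfun_at !lfunE /= !lfunE. Qed.
HB.instance Definition _ x :=
  GRing.isLinear.Build K 'End(V) V _ (lfun_at x) (lfun_at_is_linear x).

Definition orbit_span (t : seq V) : {vspace V} :=
  (\sum_(x <- t) (linfun (lfun_at x) @: E))%VS.

(** Linear independence over the division algebra [E], with [orbit_span] as the corresponding
    span. *)
Fixpoint orbit_free (t : seq V) : Prop :=
  if t is x :: t' then x \notin orbit_span t' /\ orbit_free t' else True.

Lemma mem_lfun_orbit (x y : V) :
  (y \in linfun (lfun_at x) @: E)%VS <-> exists2 e, e \in E & y = e x.
Proof.
split=> [/memv_imgP[e eE ->]|[e eE ->]].
  by exists e => //; rewrite lfunE.
by apply/memv_imgP; exists e => //; rewrite lfunE.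
Qed.

Lemma orbit_span_cons x t :
  orbit_span (x :: t) = (linfun (lfun_at x) @: E + orbit_span t)%VS.
Proof. by rewrite /orbit_span big_cons. Qed.

Lemma orbit_span_stable t e y : e \in E -> y \in orbit_span t -> e y \in orbit_span t.
Proof.
elim: t y => [|x t IHt] y eE.
  by rewrite /orbit_span big_nil memv0 => /eqP ->; rewrite linear0 mem0v.
rewrite orbit_span_cons => /memv_addP[u /mem_lfun_orbit[e' e'E ->]] [w wt ->].
rewrite linearD; apply: memv_add; last exact: IHt.
by apply/mem_lfun_orbit; exists (e \o e')%VF; rewrite ?comp_lfunE //; apply: E_comp.
Qed.

(** A nonzero [e] in [E] with [e x] in the span could be inverted and would put [x] there; so the
    orbit of [x] is a copy of [E] meeting the span trivially. *)
Lemma orbit_span_dim x t : x \notin orbit_span t ->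
  \dim (orbit_span (x :: t)) = (\dim E + \dim (orbit_span t))%N.
Proof.
move=> xt; have ex e : e \in E -> e x \in orbit_span t -> e = 0.
  move=> eE ext; apply: NNPP => e0; case/negP: xt.
  have [e' e'E ee] := E_div eE e0.
  by rewrite -[x](id_lfunE x) -ee comp_lfunE orbit_span_stable.
rewrite orbit_span_cons dimv_disjoint_sum; last first.
  apply/eqP; rewrite -subv0; apply/subvP => y /memv_capP[/mem_lfun_orbit[e eE ->]].
  by move/(ex e eE) => ->; rewrite lfunE /= mem0v.
congr (_ + _)%N; rewrite limg_dim_eq //; apply/eqP; rewrite -subv0.
apply/subvP => e /memv_capP[eE]; rewrite memv_ker lfunE /= => /eqP e0.
by rewrite (ex e eE) ?mem0v // -[e x]/(lfun_at x e) e0 mem0v.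
Qed.

(** Existence of a basis over a division algebra. It is used for [X] over its endomorphism ring and,
    with left composition, for that ring over its centre. *)
Lemma orbit_basis : exists t : seq V,
  [/\ orbit_free t, orbit_span t = W & (size t * \dim E)%N = \dim W].
Proof.
have stepP n : forall t, orbit_free t -> (orbit_span t <= W)%VS ->
    (size t * \dim E)%N = \dim (orbit_span t) ->
    (\dim W - \dim (orbit_span t) <= n)%N ->
    exists t', [/\ orbit_free t', orbit_span t' = W & (size t' * \dim E)%N = \dim W].
  elim: n => [|n IHn] t ft tW st le.
    exists t; have e : orbit_span t = W.
      by apply/eqP; rewrite eqEdim tW -subn_eq0 -leqn0.
    by split=> //; rewrite st e.
  have [sWt|] := boolP (W <= orbit_span t)%VS.
    exists t; have e : orbit_span t = W by [apply: subv_anti; rewrite tW].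
    by split=> //; rewrite st e.
  case/subvPn => x xW xt; apply: (IHn (x :: t)) => //.
  - rewrite orbit_span_cons subv_add tW andbT.
    by apply/subvP => y /mem_lfun_orbit[e eE ->]; apply: E_stable.
  - by rewrite orbit_span_dim //= mulSn st.
  have E0 : (0 < \dim E)%N.
    rewrite lt0n dimv_eq0; apply: contraNneq xt => E0.
    by have := E_id; rewrite E0 memv0 => /eqP id0; rewrite -[x]id_lfunE id0 lfunE mem0v.
  have := dimvS tW; rewrite orbit_span_dim //; lia.
apply: (stepP _ [::]) => //.
- by rewrite /orbit_span big_nil sub0v.
- by rewrite /orbit_span big_nil dimv0.
Qed.

End DivisionSpan.

Lemma rmod_end_basis (K : fieldType) (A : falgType K) (X : rmod A) :
  rmod_simple X -> exists t : seq X,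
  [/\ orbit_free (rmod_end X) t, orbit_span (rmod_end X) t = fullv
    & (size t * \dim (rmod_end X))%N = \dim {:X}].
Proof.
move=> sX; apply: orbit_basis.
- exact: rmod_end1.
- exact: rmod_end_comp.
- by move=> e eE e0; have [g gE [ge _]] := rmod_end_inverse sX eE e0; exists g.
- by move=> e x _ _; apply: memvf.
Qed.

Section Density.
Variables (K : fieldType) (A : falgType K) (k : nat) (X : 'I_k -> rmod A).
Hypothesis sX : forall i, rmod_simple (X i).
Hypothesis isoX : forall i j, rmod_iso (X i) (X j) -> i = j.

(** Tagged vectors, so that one list can contain vectors of several simple modules and density holds
    for all of them at once. *)
Definition rmod_point := {i : 'I_k & X i}.
Implicit Type (s : seq rmod_point) (p : rmod_point).

Definition point_ev p : 'Hom(A, X (tag p)) := linfun (rmod_ev (tagged p)).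

Lemma point_evE p a : point_ev p a = rmod_act (X (tag p)) a (tagged p).
Proof. by rewrite lfunE. Qed.

Fixpoint annihilator s : {vspace A} :=
  if s is p :: s' then (annihilator s' :&: lker (point_ev p))%VS else fullv.

Lemma annihilatorP s a :
  a \in annihilator s <-> forall p, p \in s -> rmod_act (X (tag p)) a (tagged p) = 0.
Proof.
elim: s => [|p s IHs] /=; first by split=> // _; apply: memvf.
split=> [/memv_capP[/IHs as0]|ps].
  rewrite memv_ker point_evE => /eqP ap q; rewrite inE => /orP[/eqP -> //|].
  exact: as0.
apply/memv_capP; split; last by rewrite memv_ker point_evE ps ?mem_head.
by apply/IHs => q qs; apply: ps; rewrite inE qs orbT.
Qed.

Lemma annihilator_mulr s a b : a \in annihilator s -> a * b \in annihilator s.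
Proof.
move=> /annihilatorP as0; apply/annihilatorP => p ps.
by rewrite rmod_actMx as0 // linear0.
Qed.

(** Says that [y] is a sum of images of the listed points under module homomorphisms into [X j]; the
    recursion accommodates the varying sources. *)
Fixpoint hom_span s j (y : X j) : Prop :=
  if s is p :: s' then
    exists2 f : 'Hom(X (tag p), X j), rmod_hom f & hom_span s' (y - f (tagged p))
  else y = 0.

Lemma annihilator_ev s p :
  (exists2 a, a \in annihilator s & rmod_act (X (tag p)) a (tagged p) <> 0) ->
  (point_ev p @: annihilator s)%VS = fullv.
Proof.
move=> [a as0 pa]; have [_ simp] := sX (tag p).
have [|e|//] := simp (point_ev p @: annihilator s)%VS.
  move=> b _ /memv_imgP[c cs ->]; apply/memv_imgP; exists (c * b).
    exact: annihilator_mulr.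
  by rewrite !point_evE rmod_actMx.
by case: pa; rewrite -point_evE; apply/eqP; rewrite -memv0 -e memv_img.
Qed.

(** Jacobson density in dual form. If the annihilator of [s] does not kill [p], it maps [p] onto the
    whole simple module, and sending p a to y a for [a] in that annihilator is a well defined
    homomorphism [f]; then [y - f p] is killed by the annihilator of [s] alone. *)
Lemma jacobson_density s j (y : X j) :
  (forall a, a \in annihilator s -> rmod_act (X j) a y = 0) -> hom_span s y.
Proof.
elim: s j y => [|p s IHs] j y ys /=.
  by rewrite -[y]rmod_act1x ys ?memvf.
have [/annihilator_ev evp|np] := classic
    (exists2 a, a \in annihilator s & rmod_act (X (tag p)) a (tagged p) <> 0); last first.
  exists 0; first by move=> a x; rewrite !lfunE /= linear0.
  rewrite lfunE subr0; apply: IHs => a as0; apply: ys => /=.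
  apply/memv_capP; split=> //; rewrite memv_ker point_evE.
  by apply/eqP; apply: NNPP => pa; apply: np; exists a.
(* The inverse of [E], followed by the projection, chooses for each [u] an element [a] of the
   annihilator of [s] with p a = u. *)
pose E := (point_ev p \o projv (annihilator s))%VF.
have EE u : exists2 a, a \in annihilator s &
    u = rmod_act _ a (tagged p) /\ (projv (annihilator s) \o E^-1)%VF u = a.
  have uE : u \in limg E by rewrite limg_comp limg_proj evp memvf.
  exists (projv (annihilator s) ((E^-1)%VF u)); last split.
  - by rewrite -{2}(limg_proj (annihilator s)) memv_img ?memvf.
  - by rewrite -point_evE -[LHS](limg_lfunVK uE) comp_lfunE.
  - by rewrite comp_lfunE.
pose f : 'Hom(X (tag p), X j) :=
  (linfun (rmod_ev y) \o (projv (annihilator s) \o E^-1))%VF.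
have fE a : a \in annihilator s ->
    f (rmod_act _ a (tagged p)) = rmod_act _ a y.
  move=> as0; rewrite comp_lfunE; have [b bs [eb ->]] := EE (rmod_act _ a (tagged p)).
  rewrite lfunE /= -[RHS]/(rmod_ev y a); apply/eqP.
  rewrite -subr_eq0 -linearB; apply/eqP.
  apply: ys; apply/memv_capP; split; first by rewrite rpredB.
  by rewrite memv_ker linearB /= !point_evE eb subrr.
have fH : rmod_hom f.
  move=> a u; have [b bs [-> _]] := EE u.
  by rewrite -rmod_actMx !fE ?annihilator_mulr // rmod_actMx.
exists f => //; apply: IHs => a as0.
by rewrite linearB /= -fH fE // subrr.
Qed.

Fixpoint point_free s : Prop :=
  if s is p :: s' then ~ hom_span s' (tagged p) /\ point_free s' else True.

Lemma point_free_ev p s : point_free (p :: s) ->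
  (point_ev p @: annihilator s)%VS = fullv.
Proof.
move=> [ps _]; apply: annihilator_ev; apply: NNPP => na; apply: ps.
by apply: jacobson_density => a as0; apply: NNPP => pa; apply: na; exists a.
Qed.

Lemma point_free_interpolation s (y : forall p, X (tag p)) : point_free s ->
  exists a, forall p, p \in s -> rmod_act (X (tag p)) a (tagged p) = y p.
Proof.
elim: s => [|p s IHs] fs; first by exists 0.
have [a aP] := IHs (proj2 fs).
have : y p - rmod_act _ a (tagged p) \in (point_ev p @: annihilator s)%VS.
  by rewrite point_free_ev // memvf.
move=> /memv_imgP[b /annihilatorP bs]; rewrite point_evE => eb; exists (a + b) => q.
rewrite linearD lfunE /= inE => /orP[/eqP ->|qs]; first by rewrite -eb addrC subrK.
by rewrite aP // bs // addr0.
Qed.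

Lemma annihilator_dim s1 s2 : point_free (s1 ++ s2) ->
  \dim (annihilator s2) =
    (\dim (annihilator (s1 ++ s2)) + \sum_(p <- s1) \dim {:X (tag p)})%N.
Proof.
elim: s1 => [|p s1 IHs1] fs /=; first by rewrite big_nil addn0.
rewrite IHs1; last by case: fs.
by rewrite big_cons -(limg_ker_dim (point_ev p) (annihilator (s1 ++ s2)))
  point_free_ev // addnA.
Qed.

Lemma rmod_hom_neq i j (f : 'Hom(X i, X j)) : rmod_hom f -> i != j -> f = 0.
Proof.
move=> fH ij; apply: NNPP => f0; case/eqP: ij; apply: isoX; exists f => //.
have [kf lf] := rmod_schur (sX i) (sX j) fH f0.
exists (f^-1)%VF; first exact: lker0_lfunK (introT eqP kf).
by move=> y; rewrite limg_lfunVK // lf memvf.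
Qed.

Definition points i (t : seq (X i)) : seq rmod_point :=
  [seq Tagged (fun i => X i : Type) x | x <- t].

Lemma hom_span_points_neq i j (t : seq (X i)) s (y : X j) : i != j ->
  hom_span (points t ++ s) y -> hom_span s y.
Proof.
move=> ij; elim: t y => [//|x t IHt] y /= [f fH].
by rewrite (rmod_hom_neq fH ij) lfunE subr0; apply: IHt.
Qed.

Lemma hom_span_points i (t : seq (X i)) s (y : X i) :
  hom_span (points t ++ s) y ->
  exists2 w, w \in orbit_span (rmod_end (X i)) t & hom_span s (y - w).
Proof.
elim: t y => [|x t IHt] y /=.
  by exists 0; rewrite ?mem0v ?subr0.
move=> [f /mem_rmod_end fE /IHt[w wt sw]]; exists (f x + w).
  by rewrite orbit_span_cons memv_add //; apply/mem_lfun_orbit; exists f.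
by rewrite opprD addrA.
Qed.

Variable t_ : forall i, seq (X i).
Hypothesis t_free : forall i, orbit_free (rmod_end (X i)) (t_ i).
Hypothesis t_span : forall i, orbit_span (rmod_end (X i)) (t_ i) = fullv.

Definition all_points (l : seq 'I_k) : seq rmod_point :=
  flatten [seq points (t_ i) | i <- l].

Lemma hom_span_all_points l j (y : X j) :
  j \notin l -> hom_span (all_points l) y -> y = 0.
Proof.
elim: l => [//|i l IHl]; rewrite inE negb_or => /andP[ji jl].
by rewrite eq_sym in ji; move/(hom_span_points_neq ji)/(IHl jl).
Qed.

Lemma all_points_free l : uniq l -> point_free (all_points l).
Proof.
elim: l => [//|i l IHl] /= /andP[il ul].
rewrite -[all_points _]/(points (t_ i) ++ all_points l).
elim: (t_ i) (t_free i) => [_|x t IHt [xt ft]] /=; first exact: IHl.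
split; last exact: IHt.
move=> /hom_span_points[w wt /(hom_span_all_points il)/eqP].
by rewrite subr_eq0 => /eqP xw; rewrite xw wt in xt.
Qed.

Lemma mem_all_points l i x :
  i \in l -> x \in t_ i -> Tagged (fun i => X i : Type) x \in all_points l.
Proof.
move=> il xt; apply/flattenP; exists (points (t_ i)).
  by apply/mapP; exists i.
exact: map_f.
Qed.

Lemma annihilator_orbit l i a : i \in l -> a \in annihilator (all_points l) ->
  rmod_act (X i) a = 0.
Proof.
move=> il /annihilatorP al; apply/lfunP => x; rewrite [RHS]lfunE /=.
have : x \in orbit_span (rmod_end (X i)) (t_ i) by rewrite t_span memvf.
have : {subset t_ i <= [pred x | Tagged (fun i => X i : Type) x \in all_points l]}.
  by move=> z; apply: mem_all_points.
elim: (t_ i) x => [|z t IHt] x tl.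
  by rewrite /orbit_span big_nil memv0 => /eqP ->; rewrite linear0.
rewrite orbit_span_cons => /memv_addP[_ /mem_lfun_orbit[e /mem_rmod_end eE ->] [w wt ->]].
rewrite linearD /= -eE (al _ (tl _ (mem_head _ _))) linear0 add0r.
by apply: IHt wt => u ut; apply: tl; rewrite inE ut orbT.
Qed.

Hypothesis faithful : forall a, (forall i, rmod_act (X i) a = 0) -> a = 0.

(** The bicommutant statement for all modules together: [a] is chosen to agree with [f i] on a basis
    over the endomorphism ring, and both commute with that ring. *)
Lemma centralizer_interpolation (f : forall i, 'End(X i)) :
  (forall i, f i \in lfun_cent (rmod_end (X i))) ->
  exists a, forall i, rmod_act (X i) a = f i.
Proof.
move=> fC; have fp := all_points_free (enum_uniq 'I_k).
have [a aP] := point_free_interpolation (fun p => f (tag p) (tagged p)) fp.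
exists a => i; apply/lfunP => x.
have : x \in orbit_span (rmod_end (X i)) (t_ i) by rewrite t_span memvf.
have : {subset t_ i <= [pred x | rmod_act (X i) a x == f i x]}.
  move=> z zt; rewrite inE; apply/eqP.
  by apply: (aP (Tagged (fun i => X i : Type) z)); apply: mem_all_points; rewrite ?mem_enum.
elim: (t_ i) x => [|z t IHt] x tl.
  by rewrite /orbit_span big_nil memv0 => /eqP ->; rewrite !linear0.
rewrite orbit_span_cons => /memv_addP[_ /mem_lfun_orbit[e eE ->] [w wt ->]].
rewrite !linearD /=; congr (_ + _).
  have /mem_rmod_end <- := eE; have /mem_lfun_cent/(_ _ eE)/lfunP/(_ z) := fC i.
  by rewrite !comp_lfunE => ->; congr (e _); apply/eqP/(tl z)/mem_head.
by apply: IHt wt => u ut; apply: tl; rewrite inE ut orbT.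
Qed.

(** The component is the annihilator of bases of all other modules. Adding the points of a basis of
    [X i] lowers the dimension by that of [X i] each time and ends at 0 by faithfulness. *)
Lemma dim_isotypic i :
  (\dim (\bigcap_(j | j != i) lker (rmod_act (X j)))%VS = size (t_ i) * \dim {:X i})%N.
Proof.
set I := (\bigcap_(j | _) _)%VS; pose l := rem i (enum 'I_k).
have ul : uniq (i :: l).
  by rewrite /= rem_uniq ?enum_uniq // mem_rem_uniq ?enum_uniq // !inE eqxx.
have lE j : (j \in l) = (j != i).
  by rewrite mem_rem_uniq ?enum_uniq // !inE mem_enum andbT.
have -> : I = annihilator (all_points l).
  apply: subv_anti; apply/andP; split; apply/subvP => a.
    rewrite memvE => /subv_bigcapP aI; apply/annihilatorP => p /flattenP[q /mapP[j]].
    rewrite lE => ji -> /mapP[x xt ->] /=.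
    have := aI j ji; rewrite -memvE memv_ker => /eqP ->; exact: lfunE.
  move=> al; rewrite memvE; apply/subv_bigcapP => j ji; rewrite -memvE memv_ker.
  by rewrite (annihilator_orbit _ al) ?lE.
have -> := @annihilator_dim (points (t_ i)) (all_points l) (all_points_free ul).
have -> : annihilator (points (t_ i) ++ all_points l) = 0%VS.
  apply/eqP; rewrite -subv0; apply/subvP => a aa; rewrite memv0; apply/eqP/faithful => j.
  by apply: (@annihilator_orbit (i :: l)) aa; rewrite inE lE; case: eqP.
by rewrite dimv0 add0n big_map /= big_const_seq count_predT iter_addn addn0 mulnC.
Qed.

End Density.

(** * Right ideals as modules, and faithfulness *)

Section RightIdeal.
Variables (K : fieldType) (A : falgType K).

Definition right_ideal (W : {vspace A}) : Prop :=
  forall w a, w \in W -> w * a \in W.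

Section Rmod.
Variables (W : {vspace A}) (idW : right_ideal W).

Definition ideal_act (a : A) (u : subvs_of W) : subvs_of W := vsproj W (vsval u * a).

Lemma val_ideal_act a u : vsval (ideal_act a u) = vsval u * a.
Proof. by rewrite vsprojK // idW // subvsP. Qed.

Lemma ideal_act_is_linear a : linear (ideal_act a).
Proof.
move=> c u w; apply: subvs_inj; rewrite linearP /= !val_ideal_act linearP /=.
by rewrite mulrDl scalerAl.
Qed.
HB.instance Definition _ a :=
  GRing.isLinear.Build K (subvs_of W) (subvs_of W) _ (ideal_act a) (ideal_act_is_linear a).

Definition ideal_act_lfun (a : A) : 'End(subvs_of W) := linfun (ideal_act a).

Lemma ideal_act_lfun_is_linear : linear ideal_act_lfun.
Proof.
move=> c a b; apply/lfunP => u; rewrite !lfunE /= !lfunE /= !lfunE /=.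
apply: subvs_inj; rewrite linearP /= !val_ideal_act.
by rewrite mulrDr scalerAr.
Qed.
HB.instance Definition _ :=
  GRing.isLinear.Build K A 'End(subvs_of W) _ ideal_act_lfun
    ideal_act_lfun_is_linear.

Definition ideal_rmod_act : 'Hom(A, 'End(subvs_of W)) :=
  linfun ideal_act_lfun.

Lemma ideal_rmod_actE a u : vsval (ideal_rmod_act a u) = vsval u * a.
Proof. by rewrite lfunE /= /ideal_act_lfun lfunE /= val_ideal_act. Qed.

Lemma ideal_rmod_act1 : ideal_rmod_act 1 = \1%VF.
Proof.
by apply/lfunP => u; apply: subvs_inj; rewrite ideal_rmod_actE id_lfunE mulr1.
Qed.

Lemma ideal_rmod_actM a b :
  ideal_rmod_act (a * b) = (ideal_rmod_act b \o ideal_rmod_act a)%VF.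
Proof.
by apply/lfunP => u; apply: subvs_inj; rewrite comp_lfunE !ideal_rmod_actE mulrA.
Qed.

Definition ideal_rmod : rmod A := RMod ideal_rmod_act1 ideal_rmod_actM.

Lemma ideal_rmod_simple : W <> 0%VS ->
  (forall W', right_ideal W' -> (W' <= W)%VS -> W' = 0%VS \/ W' = W) ->
  rmod_simple ideal_rmod.
Proof.
move=> W0 minW; split.
  move=> f0; apply: W0; apply/eqP; rewrite -subv0; apply/subvP => w wW.
  have : (vsproj W w : ideal_rmod) \in (fullv : {vspace ideal_rmod}) by apply: memvf.
  rewrite f0 memv0 => /eqP/(congr1 (@vsval _ _ W)); rewrite vsprojK // => ->.
  by rewrite linear0 mem0v.
move=> U Ust; pose W' := (linfun (@vsval _ _ W) @: (U : {vspace subvs_of W}))%VS.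
have W'P w : w \in W' <-> exists2 u, u \in U & w = vsval u.
  split=> [/memv_imgP[u uU ->]|[u uU ->]]; first by exists u; rewrite ?lfunE.
  by apply/memv_imgP; exists u; rewrite ?lfunE.
have [||e|e] := minW W'.
- move=> w a /W'P[u uU ->]; apply/W'P; exists (rmod_act ideal_rmod a u).
    exact: Ust.
  by rewrite ideal_rmod_actE.
- by apply/subvP => w /W'P[u uU ->]; apply: subvsP.
- left; apply/eqP; rewrite -subv0; apply/subvP => u uU; rewrite memv0.
  have : vsval u \in W' by apply/W'P; exists u.
  by rewrite e memv0 => /eqP u0; apply/eqP/subvs_inj; rewrite u0 linear0.
right; apply/vspaceP => u; rewrite memvf.
have : vsval u \in W' by rewrite e subvsP.
by move=> /W'P[u' u'U /subvs_inj ->].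
Qed.

End Rmod.

Lemma minimal_right_ideal (J : {vspace A}) : right_ideal J -> J <> 0%VS ->
  exists W, [/\ right_ideal W, (W <= J)%VS, W <> 0%VS
    & forall W', right_ideal W' -> (W' <= W)%VS -> W' = 0%VS \/ W' = W].
Proof.
have [n le] := ubnP (\dim J); elim: n J le => [//|n IHn] J le idJ J0.
have [[W' [iW' W'J W'0 nW']]|nJ] := classic
    (exists W', [/\ right_ideal W', (W' <= J)%VS, W' <> 0%VS & W' <> J]).
  have lt : (\dim W' < n)%N.
    rewrite -ltnS (leq_trans _ le) // ltnS ltn_neqAle (dimvS W'J) andbT.
    by apply: contra_notN nW' => /eqP e; apply/eqP; rewrite eqEdim W'J e leqnn.
  have [W [iW WW' W0 mW]] := IHn W' lt iW' W'0.
  by exists W; split=> //; apply: subv_trans W'J.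
exists J; split=> // W' iW' W'J; apply: NNPP => /not_or_and[W'0 nW'].
by apply: nJ; exists W'.
Qed.

(* A minimal right ideal killed by all simple modules is killed by its own
   left identity. *)
Lemma faithful_of_left_identities (k : nat) (X : 'I_k -> rmod A) :
  simple_representatives X ->
  (forall W, right_ideal W -> exists2 e, e \in W & forall w, w \in W -> e * w = w) ->
  forall a, (forall i, rmod_act (X i) a = 0) -> a = 0.
Proof.
move=> [_ _ allX] idem a aX; pose J := (\bigcap_(i < k) lker (rmod_act (X i)))%VS.
have JP b : b \in J <-> forall i, rmod_act (X i) b = 0.
  rewrite memvE; split=> [/subv_bigcapP bJ i|bX]; last first.
    by apply/subv_bigcapP => i _; rewrite -memvE memv_ker bX.
  by have := bJ i isT; rewrite -memvE memv_ker => /eqP.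
have idJ : right_ideal J.
  by move=> w b /JP wX; apply/JP => i; rewrite rmod_actM wX comp_lfun0r.
apply: NNPP => a0; have J0 : J <> 0%VS.
  by move=> J0; case: a0; apply/eqP; rewrite -memv0 -J0; apply/JP.
have [W [iW WJ W0 mW]] := minimal_right_ideal idJ J0.
have [e eW eP] := idem W iW.
have [i [f bf fH]] := allX _ (ideal_rmod_simple iW W0 mW).
have ee : e * e = 0.
  have /JP/(_ i) eX : e \in J by apply: (subvP WJ).
  have : f (rmod_act (ideal_rmod iW) e (vsproj W e)) = f 0.
    by rewrite fH eX lfunE /= linear0.
  move/(bij_inj bf)/(congr1 (@vsval _ _ W)).
  have := ideal_rmod_actE iW e (vsproj W e); rewrite vsprojK // => <- e0.
  by rewrite [LHS]e0 linear0.
apply: W0; apply/eqP; rewrite -subv0; apply/subvP => w wW.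
by rewrite -(eP w wW) -(eP e eW) ee mul0r mem0v.
Qed.

End RightIdeal.

(** * The twisted group ring and its centre *)

Lemma trace_on_mul_scalar (K : fieldType) (A : falgType K) (U : {vspace A}) (u : A) :
  scalar (fun z => trace_on U ( *%R (u * z))).
Proof.
move=> c y z; rewrite /trace_on mulr_sumr -big_split; apply: eq_bigr => i _ /=.
by rewrite mulrDr mulrDl -scalerAr -scalerAl linearP.
Qed.

Lemma trace_on_mul_scalarl (K : fieldType) (A : falgType K) (U : {vspace A}) (u : A) :
  scalar (fun z => trace_on U ( *%R (z * u))).
Proof.
move=> c y z; rewrite /trace_on mulr_sumr -big_split; apply: eq_bigr => i _ /=.
by rewrite !mulrDl -!scalerAl linearP.
Qed.

Section TwistedRing.
Variables (K : fieldType) (L : fieldExtType K) (gT : finGroupType).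
Variable to : galact L gT.
Local Notation tw := (twisted to).
Local Notation mono := (twisted_mono to).
Implicit Types a b z : tw.

Lemma twisted_mulE a b r : (a * b) r = \sum_t to (a (r * t^-1)%g) t * b t.
Proof. exact: ffunE. Qed.

Lemma twisted_oneE s : (1 : tw) s = (s == 1%g)%:R.
Proof. exact: ffunE. Qed.

Lemma twisted_monoE s y t : mono s y t = y *+ (t == s).
Proof. exact: ffunE. Qed.

Lemma twisted_mul_mono a t y r : (a * mono t y) r = to (a (r * t^-1)%g) t * y.
Proof.
rewrite twisted_mulE (bigD1 t) //= twisted_monoE eqxx big1 ?addr0 // => u /negPf ut.
by rewrite twisted_monoE ut mulr0.
Qed.

Lemma twisted_mono_mul a t y r :
  (mono t y * a) r = to y (t^-1 * r)%g * a (t^-1 * r)%g.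
Proof.
rewrite twisted_mulE (bigD1 (t^-1 * r)%g) //= twisted_monoE invMg invgK mulKVg eqxx.
rewrite big1 ?addr0 // => u ur; rewrite twisted_monoE.
have /negPf -> : (r * u^-1)%g != t.
  by apply: contraNneq ur => <-; rewrite invMg invgK mulgKV.
by rewrite galact0 mul0r.
Qed.

Lemma twisted_mono1 : mono 1%g 1 = 1.
Proof. by apply/ffunP => s; apply: etrans (twisted_monoE _ _ _) (esym (twisted_oneE _)). Qed.

Lemma twisted_mono_is_linear s : linear (mono s).
Proof.
move=> c y z; apply/ffunP => t; rewrite !ffunE; case: eqP => _; rewrite ?mulr1n //.
by rewrite !mulr0n scaler0 addr0.
Qed.
HB.instance Definition _ s := GRing.isLinear.Build K L tw _ (mono s)
  (twisted_mono_is_linear s).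

Lemma twisted_decomp a : a = \sum_s mono s (a s).
Proof.
apply/ffunP => t; rewrite sum_ffunE (bigD1 t) //= twisted_monoE eqxx big1 ?addr0 //.
by move=> s st; rewrite twisted_monoE eq_sym (negPf st).
Qed.

Variable N : {group gT}.
Hypothesis hN : forall s, s \in N <-> (forall y : L, to y s = y).
Hypothesis n_inv : (#|N|%:R : K) != 0.

(* (y i) and (b i) are trace-dual, so that sum_i y i (x) b i commutes with the
   action of L on both sides of L (x)_K L. *)
Lemma separability_idempotent : exists m (y b : 'I_m -> L),
  (forall t, \sum_i to (y i) t * b i = (t \in N)%:R) /\
  (forall l, exists M : 'I_m -> 'I_m -> K,
     (forall j, l * b j = \sum_i M i j *: b i) /\
     (forall i, l * y i = \sum_j M i j *: y j)).
Proof.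
pose F := fixed_field to 1%G; have FT u : u \in F.
  by apply/mem_fixed_field => s /set1P ->; rewrite galact1.
have [c cC] := fixed_field_trace_elt hN n_inv 1%G.
have [y [yF yb tyb]] := fixed_field_dual_basis hN n_inv cC.
exists (\dim F), y, (fun i => (vbasis F)`_i); split=> [t|l].
  by rewrite yb mul1g.
exists (fun i j => trace_on F ( *%R (y i * (l * (vbasis F)`_j)))); split=> [j|i].
  have lb : l * (vbasis F)`_j \in F by apply: FT.
  rewrite {1}(coord_vbasis lb); apply: eq_bigr => i _; congr (_ *: _).
  rewrite [in RHS](coord_vbasis lb).
  have := scalar_sum (fun i : 'I_(\dim F) => coord (vbasis F) i (l * (vbasis F)`_j))
    (fun i : 'I_(\dim F) => (vbasis F)`_i) (trace_on_mul_scalar F (y i)) => ->.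
  rewrite (bigD1 i) //= tyb eqxx mulr1 big1 ?addr0 // => i' i'i.
  by rewrite tyb eq_sym (negPf i'i) mulr0.
set x := \sum_j _; apply/eqP; rewrite -subr_eq0; apply/eqP.
apply: (fixed_field_nondegenerate hN n_inv cC (FT _)) => z zF.
have key (j : 'I_(\dim F)) : trace_on F ( *%R ((l * y i - x) * (vbasis F)`_j)) = 0.
  have -> : l * y i - x = -1 *: x + l * y i by rewrite scaleN1r addrC.
  apply: etrans (trace_on_mul_scalarl F (vbasis F)`_j (-1) x (l * y i)) _.
  rewrite /= mulN1r addrC /x.
  have := scalar_sum (fun j : 'I_(\dim F) => trace_on F ( *%R (y i * (l * (vbasis F)`_j))))
    y (trace_on_mul_scalarl F (vbasis F)`_j) => ->.
  rewrite (bigD1 j) //= tyb eqxx mulr1 big1 ?addr0 => [|j' j'j].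
    by rewrite mulrA [y i * l]mulrC subrr.
  by rewrite tyb (negPf j'j) mulr0.
rewrite (coord_vbasis zF).
have := scalar_sum (fun i : 'I_(\dim F) => coord (vbasis F) i z)
    (fun i : 'I_(\dim F) => (vbasis F)`_i) (trace_on_mul_scalar F (l * y i - x)) => ->.
by rewrite big1 // => j _; rewrite key mulr0.
Qed.

(** Maschke's argument over L and G simultaneously: a K-linear projection onto [W] is averaged over
    the group and over the separability idempotent of L. The result [Phi] commutes with right
    multiplication and is multiplication by n on [W], so [Phi 1] divided by n is the left
    identity. *)
Lemma twisted_right_ideal_idempotent (W : {vspace tw}) :
  right_ideal W -> exists2 e, e \in W & forall w, w \in W -> e * w = w.
Proof.
move=> idW; have [m [y [b [yb swap]]]] := separability_idempotent.
have [y0 y0P] := fixed_field_trace_elt hN n_inv [group of [set: gT]].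
(* With weight 1 the average would produce the factor g, possibly zero in K; the weight [y0] turns
   it into n. *)
have {}y0P : \sum_s to y0 s = #|N|%:R.
  by rewrite setTI in y0P; rewrite -y0P; apply: eq_bigl => s; rewrite inE.
pose B s u u' : tw := projv W (mono s u) * mono s^-1%g (to (y0 * u') s^-1%g).
pose Phi w : tw := \sum_s \sum_j projv W (w * mono s (y j)) *
                                mono s^-1%g (to (y0 * b j) s^-1%g).
have PhiW w : w \in W -> Phi w = #|N|%:R *: w.
  move=> wW; transitivity (\sum_s w * mono 1%g (to y0 s^-1%g)).
    apply: eq_bigr => s _; transitivity (\sum_j w * mono 1%g (to (y0 * (y j * b j)) s^-1%g)).
      apply: eq_bigr => j _; rewrite projv_id ?idW // -mulrA twisted_monoM mulgV.
      by rewrite -galact_rM mulrCA.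
    rewrite -mulr_sumr -linear_sum -galact_sum -mulr_sumr.
    have := yb 1%g; rewrite group1 => yb1; congr (_ * mono _ (to _ _)).
    rewrite -[RHS]mulr1 -[in RHS](_ : \sum_i to (y i) 1%g * b i = 1) //.
    by congr (_ * _); apply: eq_bigr => i _; rewrite galact1.
  rewrite -mulr_sumr -linear_sum (reindex_inj invg_inj) /=.
  under eq_bigr do rewrite invgK.
  rewrite y0P natr_alg linearZ /= twisted_mono1 -scalerAr mulr1 //.
(* Group elements are absorbed by reindexing the sum over [s], scalars of L by [swap], which moves
   them across the separability idempotent. *)
have PhiE w : Phi w = Phi 1 * w.
  rewrite [in RHS](twisted_decomp w) mulr_sumr.
  transitivity (\sum_t Phi (mono t (w t))).
    rewrite {1}(twisted_decomp w) /Phi [RHS]exchange_big; apply: eq_bigr => s _.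
    rewrite [RHS]exchange_big; apply: eq_bigr => j _ /=.
    by rewrite mulr_suml linear_sum mulr_suml.
  apply: eq_bigr => t _; move: (w t) => l.
  rewrite /Phi mulr_suml [RHS](reindex_inj (mulgI t)) /=; apply: eq_bigr => s _.
  rewrite mulr_suml; have [M [Mb My]] := swap (to l s).
  transitivity (\sum_j projv W (mono (t * s)%g (to l s * y j)) *
                 mono s^-1%g (to (y0 * b j) s^-1%g)).
    by apply: eq_bigr => j _; rewrite twisted_monoM.
  transitivity (\sum_j projv W (mono (t * s)%g (y j)) *
                 mono s^-1%g (to (y0 * (to l s * b j)) s^-1%g)); last first.
    apply: eq_bigr => j _; rewrite mul1r -mulrA twisted_monoM.
    rewrite invMg mulgKV; congr (_ * mono _ _).
    rewrite -galactM mulgKV !galact_rM galactK; ring.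
  transitivity (\sum_j \sum_i M j i *: (projv W (mono (t * s)%g (y i)) *
                 mono s^-1%g (to (y0 * b j) s^-1%g))).
    apply: eq_bigr => j _; rewrite My !linear_sum mulr_suml; apply: eq_bigr => i _.
    by rewrite !linearZ /= scalerAl.
  rewrite exchange_big; apply: eq_bigr => j _ /=.
  rewrite Mb mulr_sumr galact_sum linear_sum mulr_sumr; apply: eq_bigr => i _.
  by rewrite -scalerAr galact_scale linearZ /= -scalerAr.
exists (#|N|%:R^-1 *: Phi 1) => [|w wW].
  rewrite rpredZ // rpred_sum // => s _; rewrite rpred_sum // => j _.
  by apply: idW; rewrite -{2}(limg_proj W) memv_img ?memvf.
by rewrite -scalerAl -PhiE PhiW // scalerA mulVf // scale1r.
Qed.

Lemma twisted_faithful (k : nat) (X : 'I_k -> rmod tw) :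
  simple_representatives X ->
  forall a, (forall i, rmod_act (X i) a = 0) -> a = 0.
Proof.
by move=> hX; apply: faithful_of_left_identities hX twisted_right_ideal_idempotent.
Qed.

Definition twisted_centre : {vspace tw} := 'C({:tw})%VS.

Lemma mem_twisted_centre z : z \in twisted_centre <-> (forall a, z * a = a * z).
Proof.
split=> [/centvP zC a|zC]; first by rewrite zC ?memvf.
by apply/centvP => a _; rewrite zC.
Qed.

(** Commuting with L forces the support into N; commuting with the group elements relates the
    coefficients along conjugacy classes. *)
Lemma twisted_centreP z : z \in twisted_centre <->
  (forall s, s \notin N -> z s = 0) /\
  (forall nu s, nu \in N -> z (nu ^ s)%g = to (z nu) s).
Proof.
rewrite mem_twisted_centre; split=> [zC|[z0 zJ] a].
  split=> [s sN|nu s nuN].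
    have [y ys] : exists y, to y s != y.
      apply: NNPP => ny; move/negP: sN; apply; apply/hN => y.
      by apply/eqP; apply: contra_notT ny => ys; exists y.
    have := congr1 (fun a : tw => a s) (zC (mono 1%g y)).
    rewrite twisted_mul_mono twisted_mono_mul invg1 mulg1 mul1g galact1.
    move/eqP; rewrite mulrC -subr_eq0 -mulrBl mulf_eq0 subr_eq0 eq_sym (negPf ys).
    by move/eqP.
  have := congr1 (fun a : tw => a (nu * s)%g) (zC (mono s 1)).
  by rewrite twisted_mul_mono twisted_mono_mul galact_r1 mul1r mulr1 mulgK.
rewrite (twisted_decomp a) mulr_sumr mulr_suml; apply: eq_bigr => t _.
move: (a t) => y; apply/ffunP => r; rewrite twisted_mul_mono twisted_mono_mul.
have -> : (t^-1 * r = (r * t^-1) ^ t)%g by rewrite conjgE mulgKV.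
have [nuN|nuN] := boolP ((r * t^-1)%g \in N).
  by rewrite zJ // ((hN _).1 (galact_kerJ hN t nuN)) mulrC.
rewrite !z0 ?galact0 ?mul0r ?mulr0 //; apply: contra nuN => rN.
by rewrite -(conjgK t (r * t^-1)%g) (galact_kerJ hN).
Qed.

End TwistedRing.

(** * Traces of matrix representations of a field *)

(** The subleading coefficient is minus the sum of the roots, hence additive; in this form it
    carries traces of representations. *)
Lemma coef_subleading_mul (R : nzRingType) (p q : {poly R}) :
  p \is monic -> q \is monic -> (1 < size p)%N -> (1 < size q)%N ->
  (p * q)`_((size p).-1 + (size q).-1).-1 = p`_(size p).-2 + q`_(size q).-2.
Proof.
move=> /monicP; rewrite lead_coefE => lp /monicP; rewrite lead_coefE => lq sp sq.
move: sp sq lp lq (@nth_default _ 0 p) (@nth_default _ 0 q).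
case: (size p) => [//|[//|m]] _; case: (size q) => [//|[//|d]] _ /= pm qd p0 q0.
have lt1 : (m.+1 < (m + d).+2)%N by lia.
have lt0 : (m < (m + d).+2)%N by lia.
rewrite coefM addnS (bigD1 (Ordinal lt1)) //= pm mul1r.
rewrite (bigD1 (Ordinal lt0)) /=; last by rewrite -val_eqE /=; lia.
have -> : ((m + d).+1 - m = d.+1)%N by lia.
rewrite subSS addKn qd mulr1 addrCA big1 ?addr0 // => j.
rewrite -!val_eqE /= => /andP[j1 j2].
have [jm|mj] := ltnP m.+1 j; first by rewrite p0 ?mul0r.
by rewrite q0 ?mulr0 //; lia.
Qed.

Lemma coef_subleading_exp (R : idomainType) (q : {poly R}) b :
  q \is monic -> (1 < size q)%N -> (0 < b)%N ->
  (q ^+ b)`_(b * (size q).-1).-1 = q`_(size q).-2 *+ b.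
Proof.
move=> qm sq; elim: b => [//|[|b] IHb] _; first by rewrite expr1 mul1n mulr1n.
have qbm : q ^+ b.+1 \is monic by rewrite monic_exp.
have sb : (size (q ^+ b.+1)).-1 = (b.+1 * (size q).-1)%N by rewrite size_exp mulnC.
have lt : (1 < size (q ^+ b.+1))%N.
  have : (0 < (size q).-1)%N by lia.
  move=> h; have : (0 < b.+1 * (size q).-1)%N by rewrite muln_gt0.
  lia.
rewrite exprS mulrC mulSn addnC -sb coef_subleading_mul // [RHS]mulrS addrC.
congr (_ + _); rewrite -IHb //; congr (_`_ _).
by rewrite -sb.
Qed.

Lemma monic_dvdp_exp (K : fieldType) (q p : {poly K}) n :
  q \is monic -> (forall r, r %| q -> (r %= q) || (r %= 1)) ->
  p \is monic -> p %| q ^+ n -> exists b, p = q ^+ b.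
Proof.
move=> qm qirr; elim: n p => [|n IHn] p pm pq.
  exists 0%N; apply/eqP; rewrite -eqp_monic ?monic1 // eqp_sym.
  by rewrite /eqp dvd1p pq.
have [qp|qp] := boolP (q %| p).
  move: pm pq; rewrite -(divpK qp) => pm; rewrite exprSr dvdp_mul2r ?monic_neq0 //.
  have {}pm : p %/ q \is monic by rewrite monicMr in pm.
  by move=> /(IHn _ pm)[b ->]; exists b.+1; rewrite exprSr.
apply: IHn => //; have := pq; rewrite exprS Gauss_dvdpr //.
rewrite -gcdp_eqp1; have /orP[e|//] := qirr _ (dvdp_gcdr p q).
by case/negP: qp; rewrite -(eqp_dvdl _ e) dvdp_gcdl.
Qed.

Section MatrixRepresentation.
Variables (K : fieldType) (F : fieldExtType K) (E : fieldType).
Variables (iota : {rmorphism K -> E}) (rho : nat) (R : F -> 'M[E]_rho).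
Hypothesis RD : forall x y, R (x + y) = R x + R y.
Hypothesis RM : forall x y, R (x * y) = R x *m R y.
Hypothesis RK : forall a : K, R a%:A = (iota a)%:M.

Let R0 : R 0 = 0. Proof. by apply: (addrI (R 0)); rewrite -RD !addr0. Qed.

Let RB x y : R (x - y) = R x - R y.
Proof. by apply: (addIr (R y)); rewrite -RD !subrK. Qed.

(** The extension of [R] to polynomials, from F[X] to matrices over E[X]. *)
Let Rpoly (p : {poly F}) : 'M[{poly E}]_rho :=
  \matrix_(i, j) map_poly (fun x => R x i j) p.

Let Rpoly_coef p i j n : (Rpoly p i j)`_n = R p`_n i j.
Proof. by rewrite mxE coef_map_id0 // R0 mxE. Qed.

Let R_sum (I : Type) (r : seq I) (P : pred I) (f : I -> F) :
  R (\sum_(i <- r | P i) f i) = \sum_(i <- r | P i) R (f i).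
Proof. by elim/big_rec2: _ => [|i x y _ <-]; rewrite ?R0. Qed.

Let RpolyM p q : Rpoly (p * q) = Rpoly p *m Rpoly q.
Proof.
apply/matrixP => i j; apply/polyP => n; rewrite Rpoly_coef coefM R_sum.
rewrite summxE mxE coef_sum; under [RHS]eq_bigr do rewrite coefM.
rewrite exchange_big; apply: eq_bigr => l _; rewrite RM mxE; apply: eq_bigr => h _.
by rewrite !Rpoly_coef.
Qed.

Variable w : F.

Lemma minPoly_base : exists q : {poly K},
  [/\ map_poly (in_alg F) q = minPoly 1 w, q \is monic, (1 < size q)%N
    & forall r, r %| q -> (r %= q) || (r %= 1)].
Proof.
have /polyOver1P[q qE] := minPolyOver 1 w; exists q; rewrite -qE; split=> //.
- by rewrite -(map_monic (in_alg F)) -qE monic_minPoly.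
- by rewrite -(size_map_poly (in_alg F)) -qE size_minPoly.
move=> r rq; have := @minPoly_irr _ _ 1%AS w (map_poly (in_alg F) r).
rewrite qE dvdp_map rq eqp_map -(rmorph1 (map_poly (in_alg F))) eqp_map; apply=> //.
exact: alg_polyOver.
Qed.

(** Over F the minimal polynomial factors as s (X - w). Applying [Rpoly] and taking determinants
    shows that the characteristic polynomial of [R w] divides a power of [q]; its descent [chi] to K
    is then itself a power of the irreducible [q]. *)
Lemma char_poly_representation (q chi : {poly K}) :
  map_poly (in_alg F) q = minPoly 1 w -> q \is monic ->
  (forall r, r %| q -> (r %= q) || (r %= 1)) ->
  char_poly (R w) = map_poly iota chi -> exists b, chi = q ^+ b.
Proof.
move=> qE qm qirr chiE.
have chim : chi \is monic by rewrite -(map_monic iota) -chiE char_poly_monic.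
apply: (monic_dvdp_exp (n := rho)) => //.
rewrite -(dvdp_map iota) rmorphXn /= -chiE.
have /factor_theorem[s sE] := root_minPoly 1 w.
have : Rpoly (map_poly (in_alg F) q) = (map_poly iota q)%:M.
  apply/matrixP => i j; apply/polyP => n; rewrite Rpoly_coef !mxE coef_map RK mxE.
  by rewrite coefMn coef_map.
rewrite qE sE RpolyM.
have -> : Rpoly ('X - w%:P) = char_poly_mx (R w).
  apply/matrixP => i j; apply/polyP => n; rewrite Rpoly_coef !mxE coefB coefX coefC.
  rewrite RB coefB coefMn coefX coefC !mxE; congr (_ - _).
    have -> : (n == 1%N)%:R = ((n == 1%N)%:R : K)%:A :> F.
      by case: eqP => _; rewrite ?scale1r ?scale0r.
    by rewrite RK mxE rmorph_nat.
  by case: eqP => _; rewrite ?R0 ?mxE.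
move/(congr1 determinant); rewrite det_mulmx det_scalar -/(char_poly _) => <-.
exact: dvdp_mull.
Qed.

Lemma trace_representation (q : {poly K}) b :
  q \is monic -> (1 < size q)%N -> (0 < rho)%N ->
  char_poly (R w) = map_poly iota (q ^+ b) ->
  rho = (b * (size q).-1)%N /\ \tr (R w) = iota (- (q`_(size q).-2 *+ b)).
Proof.
move=> qm sq rho0 chiE.
have rhoE : rho = (b * (size q).-1)%N.
  have := size_char_poly (R w); rewrite chiE size_map_poly => /(congr1 predn) /= <-.
  by rewrite size_exp mulnC.
split=> //; have b0 : (0 < b)%N by move: rho0; rewrite rhoE muln_gt0 => /andP[].
have := char_poly_trace (R w) rho0.
rewrite chiE coef_map /= {1}rhoE coef_subleading_exp // rmorphN => ->.
by rewrite opprK.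
Qed.
End MatrixRepresentation.

(** The derivative of [q] vanishes, so the degree is 0 in K; one less than the degree is then -1,
    and the next coefficient of the derivative is minus the subleading coefficient of [q]. *)
Lemma inseparable_subleading (K : fieldType) (F : fieldExtType K) (w : F) (q : {poly K}) :
  map_poly (in_alg F) q = minPoly 1 w -> q \is monic -> (1 < size q)%N ->
  ~~ separable_element 1 w -> q`_(size q).-2 = 0.
Proof.
move=> qE qm sq; rewrite separable_nz_der negbK -qE deriv_map map_poly_eq0 => /eqP q'.
have := monicP qm; rewrite lead_coefE; case: (size q) sq => [//|[//|d]] _ /= qd.
have d0 : d.+1%:R = 0 :> K.
  by have /polyP/(_ d) := q'; rewrite coef_deriv coef0 qd.
case: d d0 qd => [|d] d0 qd; first by move/eqP: d0; rewrite oner_eq0.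
have /polyP/(_ d) := q'; rewrite coef_deriv coef0 -mulr_natr.
have -> : d.+1%:R = -1 :> K by apply/eqP; rewrite -subr_eq0 opprK natr1 d0.
by rewrite mulrN1 => /eqP; rewrite oppr_eq0 => /eqP.
Qed.

Section RegularRepresentation.
Variables (K : fieldType) (F : fieldExtType K).
Local Notation b := (vbasis {:F}).

Definition regular_mx (w : F) : 'M[K]_(\dim {:F}) :=
  \matrix_(i, j) coord b j (w * b`_i).

Lemma regular_mxD x y : regular_mx (x + y) = regular_mx x + regular_mx y.
Proof. by apply/matrixP => i j; rewrite !mxE mulrDl linearD. Qed.

Lemma regular_mxM x y : regular_mx (x * y) = regular_mx x *m regular_mx y.
Proof.
apply/matrixP => i j; rewrite !mxE [x * y]mulrC -mulrA.
rewrite [x * b`_i](coord_vbasis (memvf _)) mulr_sumr linear_sum.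
by apply: eq_bigr => l _; rewrite !mxE -scalerAr linearZ.
Qed.

Lemma regular_mxK (a : K) : regular_mx a%:A = (idfun a)%:M.
Proof.
apply/matrixP => i j; rewrite !mxE mulr_algl linearZ /=.
by rewrite coord_free ?(basis_free (vbasisP _)) // mulr_natr.
Qed.

Lemma regular_mx_trace w : \tr (regular_mx w) = trace_on {:F} ( *%R w).
Proof. by apply: eq_bigr => i _; rewrite mxE. Qed.
End RegularRepresentation.

(* A primitive element gives the divisibility; separability is forced by the
   nonvanishing of the trace. *)
Lemma trace_ratio (K : fieldType) (F : fieldExtType K) (E : fieldType)
    (iota : {rmorphism K -> E}) rho (R : F -> 'M[E]_rho) :
  (forall x y, R (x + y) = R x + R y) ->
  (forall x y, R (x * y) = R x *m R y) ->
  (forall a : K, R a%:A = (iota a)%:M) ->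
  (forall w, exists chi, char_poly (R w) = map_poly iota chi) ->
  (exists w, \tr (R w) != 0) ->
  exists r, rho = (r * \dim {:F})%N /\
    forall w, \tr (R w) = iota (r%:R * trace_on {:F} ( *%R w)).
Proof.
move=> RD RM RK Rchi [w0 tw0].
have rho0 : (0 < rho)%N.
  rewrite lt0n; apply: contraNneq tw0 => e; apply/eqP/big1 => i _.
  by have := ltn_ord i; rewrite {2}e.
have d0 : (0 < \dim {:F})%N by rewrite adim_gt0.
(* [R w] and the regular representation of [w] have characteristic polynomials that are powers of
   the same [q]; the exponents control dimensions as well as traces. *)
have key w : exists (q : {poly K}) b b', [/\ map_poly (in_alg F) q = minPoly 1 w,
    q \is monic, (1 < size q)%N,
    rho = (b * (size q).-1)%N /\ \tr (R w) = iota (- (q`_(size q).-2 *+ b))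
  & \dim {:F} = (b' * (size q).-1)%N /\
    trace_on {:F} ( *%R w) = - (q`_(size q).-2 *+ b')].
  have [q [qE qm sq qirr]] := minPoly_base w; exists q.
  have [chi chiE] := Rchi w.
  have [b eb] := char_poly_representation RD RM RK qE qm qirr chiE.
  have chiE' : char_poly (regular_mx w) = map_poly idfun (char_poly (regular_mx w)).
    by rewrite map_poly_id.
  have [b' eb'] := char_poly_representation (@regular_mxD _ _) (@regular_mxM _ _)
    (@regular_mxK _ _) qE qm qirr chiE'.
  exists b, b'; split=> //.
    by apply: trace_representation => //; rewrite chiE eb.
  rewrite -regular_mx_trace; apply: (trace_representation (iota := idfun)) => //.
  by rewrite [LHS]chiE' -eb'.
(* Inseparable elements have trace 0, so [w0] is separable. If [w] were not, neither would [w0 + w]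
   be, and additivity of the trace would give trace 0 to [w0]. *)
have sep (w : F) : separable_element 1 w.
  have insep u : ~~ separable_element 1 u -> \tr (R u) = 0.
    move=> us; have [q [b [b' [qE qm sq [_ ->] _]]]] := key u.
    by rewrite (inseparable_subleading qE qm sq us) mul0rn oppr0 rmorph0.
  have sepB (x y : F) : separable_element 1 x -> separable_element 1 y ->
      separable_element 1 (x - y).
    move=> sx sy; apply: separable_add => //.
    by move/adjoin_separableP: sy; apply; rewrite rpredN memv_adjoin.
  apply: contraNT tw0 => wi; apply/eqP.
  have [w0s|/insep //] := boolP (separable_element 1 w0).
  have : \tr (R (w0 + w)) = 0.
    apply: insep; apply: contra wi => s; rewrite -(addrK w0 w) [w + _]addrC.
    exact: sepB.
  by rewrite RD linearD /= (insep w wi) addr0.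
have sepF : separable 1 {:F} by apply/separableP => y _; apply: sep.
have FE := eq_adjoin_separable_generator sepF (subvf _).
set g := separable_generator _ _ in FE.
have [q [b [b' [qE qm sq [rhoE _] [dE _]]]]] := key g.
(* For a generator the degree of [q] is that of F, so its exponent [b] is the multiplicity valid for
   every element. *)
have dq : (size q).-1 = \dim {:F}.
  have := size_minPoly 1 g; rewrite -qE size_map_poly => ->.
  by rewrite [in RHS]FE dim_Fadjoin dimv1 muln1.
exists b; split=> [|w]; first by rewrite -dq.
have [q' [c [c' [_ _ sq' [rhoE' ->] [dE' ->]]]]] := key w.
have -> : c = (b * c')%N.
  have s0 : (0 < (size q').-1)%N by move: sq'; case: (size q') => [|[]].
  apply/eqP; rewrite -(eqn_pmul2r s0) -mulnA -dE' -rhoE' rhoE dq //.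
by rewrite mulrN mulr_natl -mulrnA mulnC.
Qed.

(** * A subspace with its own unit, packaged as a field extension *)

Section CornerField.
Variables (K : fieldType) (A : falgType K) (U : {vspace A}) (e : A).
Hypotheses (eU : e \in U) (e0 : e != 0).
Hypothesis e1 : forall x, x \in U -> e * x = x.
Hypothesis UM : forall x y, x \in U -> y \in U -> x * y \in U.
Hypothesis UC : forall x y, x \in U -> y \in U -> x * y = y * x.
Hypothesis UV : forall x, x \in U -> x != 0 -> exists2 y, y \in U & x * y = e.

(** The unit is [e] and in general not that of [A], so the field structure needs a carrier separate
    from the subalgebras of [A]. *)
Definition corner : Type := subvs_of U.
HB.instance Definition _ := Vector.on corner.

Definition corner_one : corner := vsproj U e.
Definition corner_mul (x y : corner) : corner := vsproj U (vsval x * vsval y).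

Lemma val_corner_one : vsval corner_one = e.
Proof. exact: vsprojK. Qed.

Lemma val_corner_mul x y : vsval (corner_mul x y) = vsval x * vsval y.
Proof. by rewrite vsprojK // UM // subvsP. Qed.

Fact corner_mulA : associative corner_mul.
Proof. by move=> x y z; apply: subvs_inj; rewrite !val_corner_mul mulrA. Qed.
Fact corner_mulC : commutative corner_mul.
Proof. by move=> x y; apply: subvs_inj; rewrite !val_corner_mul UC ?subvsP. Qed.
Fact corner_mul1 : left_id corner_one corner_mul.
Proof. by move=> x; apply: subvs_inj; rewrite val_corner_mul val_corner_one e1 ?subvsP. Qed.
Fact corner_mulDl : left_distributive corner_mul +%R.
Proof.
by move=> x y z; apply: subvs_inj; rewrite linearD /= !val_corner_mul linearD mulrDl.
Qed.
Fact corner_one_neq0 : corner_one != 0.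
Proof.
by apply: contraNneq e0 => e00; rewrite -val_corner_one e00 linear0.
Qed.

HB.instance Definition _ := GRing.Zmodule_isComNzRing.Build corner
  corner_mulA corner_mulC corner_mul1 corner_mulDl corner_one_neq0.

Fact corner_scaleAl (c : K) (x y : corner) : c *: (x * y) = c *: x * y.
Proof.
by apply: subvs_inj; rewrite linearZ /= !val_corner_mul linearZ /= scalerAl.
Qed.
HB.instance Definition _ := GRing.Lmodule_isLalgebra.Build K corner corner_scaleAl.

Fact corner_scaleAr (c : K) (x y : corner) : c *: (x * y) = x * (c *: y).
Proof.
by apply: subvs_inj; rewrite linearZ /= !val_corner_mul linearZ /= scalerAr.
Qed.
HB.instance Definition _ := GRing.Lalgebra_isAlgebra.Build K corner corner_scaleAr.

Definition corner_lmul (x y : corner) : corner := x * y.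
Fact corner_lmul_is_linear x : linear (corner_lmul x).
Proof. by move=> c y z; rewrite /corner_lmul mulrDr scalerAr. Qed.
HB.instance Definition _ x := GRing.isLinear.Build K corner corner _ (corner_lmul x)
  (corner_lmul_is_linear x).

Definition corner_inv (x : corner) : corner :=
  if x == 0 then 0 else ((linfun (corner_lmul x))^-1)%VF 1.

Fact corner_mulVx x : x != 0 -> corner_inv x * x = 1.
Proof.
move=> x0; rewrite /corner_inv (negPf x0) mulrC.
have [y yU xy] : exists2 y, y \in U & vsval x * y = e.
  apply: UV; first exact: subvsP.
  by apply: contraNneq x0 => x0; apply/eqP/subvs_inj; rewrite x0 linear0.
have one_img : 1 \in limg (linfun (corner_lmul x)).
  apply/memv_imgP; exists (vsproj U y); rewrite ?memvf // lfunE /=.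
  by apply: subvs_inj; rewrite val_corner_mul vsprojK // xy val_corner_one.
by have := limg_lfunVK one_img; rewrite lfunE.
Qed.
Fact corner_inv0 : corner_inv 0 = 0.
Proof. by rewrite /corner_inv eqxx. Qed.

HB.instance Definition _ := GRing.ComNzRing_isField.Build corner
  corner_mulVx corner_inv0.

Lemma corner_field : exists (F : fieldExtType K) (f : 'Hom(F, A)),
  [/\ lker f = 0%VS, limg f = U, f 1 = e & forall x y, f (x * y) = f x * f y].
Proof.
exists (corner : fieldExtType K), (linfun (@vsval _ _ U)); split.
- apply/eqP/lker0P => x y; rewrite !lfunE; exact: subvs_inj.
- apply/vspaceP => x; apply/idP/idP => [/memv_imgP[y _ ->]|xU].
    by rewrite lfunE /= subvsP.
  by apply/memv_imgP; exists (vsproj U x); rewrite ?memvf // lfunE /= vsprojK.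
- by rewrite lfunE /= val_corner_one.
- by move=> x y; rewrite !lfunE /= val_corner_mul.
Qed.
End CornerField.

Lemma conjg_eq_cent1 (gT : finGroupType) (nu s : gT) :
  (nu ^ s == nu)%g = (s \in 'C[nu]%g).
Proof.
apply/eqP/cent1P => [e|cs]; last by rewrite conjgE -cs mulKg.
by rewrite /commute -{1}e conjgE mulKVg.
Qed.

(** * The form on the centre, computed by conjugacy classes *)

Section CentreForm.
Variables (K : fieldType) (L : fieldExtType K) (gT : finGroupType).
Variable to : galact L gT.
Local Notation tw := (twisted to).
Variable N : {group gT}.
Hypothesis hN : forall s, s \in N <-> (forall y : L, to y s = y).
Hypothesis n_inv : (#|N|%:R : K) != 0.
Local Notation Z := (twisted_centre to).
Local Notation F nu := (fixed_field to 'C[nu]%g).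

Lemma centre_supp z s : z \in Z -> s \notin N -> z s = 0.
Proof. by move=> /(twisted_centreP hN)[z0 _]; apply: z0. Qed.

Lemma centre_conj z nu s : z \in Z -> nu \in N -> z (nu ^ s)%g = to (z nu) s.
Proof. by move=> /(twisted_centreP hN)[_]; apply. Qed.

Lemma centre_coef_fixed z nu : z \in Z -> nu \in N -> z nu \in F nu.
Proof.
move=> zZ nuN; apply/mem_fixed_field => s /cent1P cs.
by rewrite -centre_conj // conjgE -cs mulKg.
Qed.

(** The coordinate along 1 makes the form K-valued and linear on the whole ring; on the centre the
    coefficient at 1 is Galois invariant, so the coordinate loses nothing. *)
Definition centre_form (z : tw) : K := coord [tuple (1 : L)] ord0 (z 1%g).

Lemma centre_form_is_scalar : scalar centre_form.
Proof. by move=> c a b; rewrite /centre_form -linearP; congr (coord _ _ _); rewrite !ffunE. Qed.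

Lemma centre_formE z : z \in Z -> (centre_form z)%:A = z 1%g.
Proof.
move=> zZ; have [|a az] := @galact_invariant _ _ _ to (z 1%g).
  by move=> s; rewrite -centre_conj ?conj1g // group1.
rewrite /centre_form az linearZ /=.
have := @coord_free _ _ _ [tuple (1 : L)] ord0 ord0; rewrite /= => -> //.
  by rewrite mulr1.
by rewrite seq1_free oner_eq0.
Qed.

Lemma centre_mul z w : z \in Z -> w \in Z -> z * w \in Z.
Proof.
move=> /mem_twisted_centre zZ /mem_twisted_centre wZ; apply/mem_twisted_centre => a.
by rewrite -mulrA wZ mulrA zZ mulrA.
Qed.

Lemma card_centN_neq0 nu : (#|'C_N[nu]%g|%:R : K) != 0.
Proof.
have /dvdnP[q Nq] : (#|'C_N[nu]%g| %| #|N|)%N by rewrite cardSg ?subsetIl.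
by move: n_inv; rewrite Nq natrM mulf_eq0 negb_or => /andP[].
Qed.

Lemma index_centN_neq0 nu : (#|N : 'C_N[nu]|%g%:R : K) != 0.
Proof.
have := Lagrange (subsetIl N 'C[nu]%g) => e.
by move: n_inv; rewrite -e natrM mulf_eq0 negb_or => /andP[].
Qed.

(** n times the trace of [f nu] is the sum over t of the conjugates of [c * f nu]. The t with a
    given nu^t form a coset of the centralizer and contribute |C_N(nu)| times the value of [f]
    there, by the choice of [c]; dividing leaves the index. *)
Lemma class_sum nu (f : gT -> L) : (forall s, f (nu ^ s)%g = to (f nu) s) ->
  \sum_(t in (nu ^: [set: gT])%g) f t =
    (#|N : 'C_N[nu]|%g%:R * trace_on (F nu) ( *%R (f nu)))%:A.
Proof.
move=> fJ; have [c cC] := fixed_field_trace_elt hN n_inv 'C[nu]%G.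
have fF : f nu \in F nu.
  by apply/mem_fixed_field => s /cent1P cs; rewrite -fJ conjgE -cs mulKg.
have := fixed_field_trace hN n_inv cC fF.
have -> : \sum_t to (c * f nu) t =
    #|'C_N[nu]%g|%:R * \sum_(t in (nu ^: [set: gT])%g) f t.
  rewrite (partition_big (fun t => nu ^ t)%g (fun u => u \in (nu ^: [set: gT])%g)) /=.
    rewrite mulr_sumr; apply: eq_bigr => _ /imsetP[t0 _ ->].
    have -> : (#|'C_N[nu]%g|%:R : L) = to (\sum_(s in 'C[nu]%G) to c s) t0.
      by rewrite cC galact_nat /= setIC.
    rewrite galact_sum mulr_suml (reindex_inj (mulIg t0)) /=.
    apply: eq_big => [s|s]; rewrite conjgM (inj_eq (conjg_inj _)) conjg_eq_cent1 //.
    move=> /cent1P cs; rewrite galact_rM -fJ galactM; congr (_ * f _).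
    by rewrite conjgM [(nu ^ s)%g]conjgE -cs mulKg.
  by move=> t _; apply: memJ_class.
move=> e; have C0 : (#|'C_N[nu]%g|%:R : L) != 0 by apply/natr_alg_neq0/card_centN_neq0.
apply: (mulfI C0); rewrite -e -(Lagrange (subsetIl N 'C[nu]%g)) natrM -mulrA; congr (_ * _).
by rewrite natr_alg mulr_algl scalerA.
Qed.

Lemma centre_form_mul z w : z \in Z -> w \in Z ->
  (centre_form (z * w))%:A = \sum_(t in N) z t^-1%g * w t.
Proof.
move=> zZ wZ; rewrite centre_formE ?centre_mul // twisted_mulE.
rewrite (bigID (fun t => t \in N)) /= [X in _ + X]big1 ?addr0 => [|t tN]; last first.
  by rewrite (centre_supp wZ tN) mulr0.
by apply: eq_bigr => t tN; rewrite mul1g ((hN t).1 tN).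
Qed.

Lemma centre_form_classes z w (Cl : {set gT}) :
  is_transversal Cl [set nu ^: [set: gT] | nu in N]%g N -> z \in Z -> w \in Z ->
  centre_form (z * w) = \sum_(nu in Cl)
    #|N : 'C_N[nu]|%g%:R * trace_on (F nu) ( *%R (z nu^-1%g * w nu)).
Proof.
move=> hCl zZ wZ; apply: (fmorph_inj (in_alg L)).
rewrite /= centre_form_mul // scaler_suml.
set P := [set _ | nu in N] in hCl.
have pP : partition P N by case/and3P: hCl.
have sClN : Cl \subset N by case/and3P: hCl.
rewrite (set_partition_big _ pP) /= -(pblock_transversal hCl).
rewrite big_imset /=; last exact: (pblock_inj hCl).
apply: eq_bigr => nu nuCl; have nuN : nu \in N by apply: (subsetP sClN).
have -> : pblock P nu = (nu ^: [set: gT])%g.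
  apply: def_pblock; first by case/and3P: pP.
    by apply/imsetP; exists nu.
  exact: class_refl.
rewrite (class_sum (f := fun t => z t^-1%g * w t)) // => s.
by rewrite -conjVg !centre_conj ?groupV // galact_rM.
Qed.

(** The central element supported on the class of [nu] with coefficient [y] at [nu]. For [y] fixed
    by the centralizer the picked conjugator does not matter. *)
Definition class_elt (nu : gT) (y : L) : tw :=
  [ffun s => if [pick t | nu ^ t == s]%g is Some t then to y t else 0].

Lemma class_eltJ nu y t : y \in F nu -> class_elt nu y (nu ^ t)%g = to y t.
Proof.
move=> /mem_fixed_field yF; rewrite ffunE; case: pickP => [u /eqP e|/(_ t)]; last by rewrite eqxx.
have cut : (u * t^-1)%g \in 'C[nu]%g by rewrite -conjg_eq_cent1 conjgM e conjgK.
by rewrite -[in RHS](yF _ cut) -galactM mulgKV.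
Qed.

Lemma class_elt0 nu y s : s \notin (nu ^: [set: gT])%g -> class_elt nu y s = 0.
Proof.
move=> snu; rewrite ffunE; case: pickP => // t /eqP e.
by case/negP: snu; apply/imsetP; exists t; rewrite ?inE.
Qed.

Lemma class_elt_centre nu y : nu \in N -> y \in F nu -> class_elt nu y \in Z.
Proof.
move=> nuN yF; have subN s : s \in (nu ^: [set: gT])%g -> s \in N.
  by move=> /imsetP[t _ ->]; exact: (galact_kerJ hN _ nuN).
apply/(twisted_centreP hN); split=> [s sN|mu s muN].
  by apply: class_elt0; apply: contra sN => /subN.
have [/imsetP[t _ ->]|mnu] := boolP (mu \in (nu ^: [set: gT])%g).
  by rewrite -conjgM !class_eltJ // galactM.
rewrite !class_elt0 ?galact0 //; apply: contra mnu.
by move=> /imsetP[t _ e]; apply/imsetP; exists (t * s^-1)%g; rewrite ?inE // conjgM -e conjgK.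
Qed.

Lemma centre_form_class_elt z nu y : z \in Z -> nu \in N -> y \in F nu ->
  centre_form (z * class_elt nu y) =
    #|N : 'C_N[nu]|%g%:R * trace_on (F nu) ( *%R (z nu^-1%g * y)).
Proof.
move=> zZ nuN yF; have wZ := class_elt_centre nuN yF.
apply: (fmorph_inj (in_alg L)); rewrite /= centre_form_mul //.
have wnu : class_elt nu y nu = y.
  by have := class_eltJ 1%g yF; rewrite conjg1 galact1.
rewrite -[in RHS]wnu -(class_sum (f := fun t => z t^-1%g * class_elt nu y t)); last first.
  by move=> s; rewrite -conjVg !centre_conj ?groupV // galact_rM.
rewrite big_mkcond [RHS]big_mkcond; apply: eq_bigr => t _.
case: (boolP (t \in (nu ^: _)%g)) => [/imsetP[s _ ->]|tnu].
  by rewrite (galact_kerJ hN).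
by rewrite (class_elt0 _ tnu) mulr0 if_same.
Qed.

Lemma fixed_field_centV nu : F nu^-1%g = F nu.
Proof.
congr (fixed_field to _); apply/setP => s.
by rewrite -!conjg_eq_cent1 conjVg (inj_eq invg_inj).
Qed.

(** Testing [z] against class elements at the inverse of [s] isolates the coefficient [z s] inside a
    nondegenerate trace form, multiplied by an index that is invertible because it divides n. *)
Lemma centre_form_nondegenerate z : z \in Z ->
  (forall w, w \in Z -> centre_form (z * w) = 0) -> z = 0.
Proof.
move=> zZ zw0; apply/ffunP => s; rewrite [RHS]ffunE.
have [sN|sN] := boolP (s \in N); last exact: centre_supp zZ sN.
have [c cC] := fixed_field_trace_elt hN n_inv 'C[s^-1]%G.
apply: (fixed_field_nondegenerate hN n_inv cC) => [|y yF].
  by rewrite fixed_field_centV centre_coef_fixed.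
have sVN : s^-1%g \in N by rewrite groupV.
have := zw0 _ (class_elt_centre sVN yF); rewrite centre_form_class_elt // invgK.
by move/eqP; rewrite mulf_eq0 (negPf (index_centN_neq0 _)) => /eqP.
Qed.
End CentreForm.

(** * The Wedderburn side of the centre *)

Lemma trace_on_iso (K : fieldType) (V V' : vectType K) (f : 'Hom(V, V'))
    (g : V -> V) (g' : V' -> V') :
  lker f = 0%VS -> linear g' -> (forall x, f (g x) = g' (f x)) ->
  trace_on fullv g = trace_on (limg f) g'.
Proof.
move=> kf g'L fg; have fK := lker0_lfunK (introT eqP kf).
rewrite (@trace_on_dual _ _ (limg f) _
  (fun (i : 'I_(\dim {:V})) y => coord (vbasis {:V}) i ((f^-1)%VF y))
  (fun i => f (vbasis {:V})`_i)) //.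
- by apply: eq_bigr => i _; rewrite -fg fK.
- by move=> i c x y; rewrite !linearP.
- by move=> i; rewrite memv_img ?memvf.
- by move=> _ /memv_imgP[x _ ->]; rewrite -fg memv_img ?memvf.
move=> _ /memv_imgP[x _ ->]; rewrite {1}(coord_vbasis (memvf x)) linear_sum.
by apply: eq_bigr => i _; rewrite linearZ fK.
Qed.

Section Wedderburn.
Variables (K : fieldType) (A : falgType K) (k : nat) (X : 'I_k -> rmod A).
Hypothesis hX : simple_representatives X.
Hypothesis faithful : forall a, (forall i, rmod_act (X i) a = 0) -> a = 0.
Local Notation Z := ('C({:A})%VS).

Let sX i : rmod_simple (X i). Proof. by case: hX. Qed.

Lemma mem_centre (z : A) : z \in Z <-> (forall a, z * a = a * z).
Proof.
split=> [/centvP zC a|zC]; first by rewrite zC ?memvf.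
by apply/centvP => a _; rewrite zC.
Qed.

Lemma faithful_eq (a b : A) : (forall i, rmod_act (X i) a = rmod_act (X i) b) -> a = b.
Proof.
move=> ab; apply/eqP; rewrite -subr_eq0; apply/eqP/faithful => i.
by rewrite linearB /= ab subrr.
Qed.

Lemma rmod_end_centerP i (f : 'End(X i)) : f \in rmod_end_center (X i) <->
  f \in rmod_end (X i) /\ forall g, g \in rmod_end (X i) -> (f \o g = g \o f)%VF.
Proof.
split=> [/memv_capP[fE /mem_lfun_cent fC]|[fE fC]]; first by [].
by apply/memv_capP; split=> //; apply/mem_lfun_cent.
Qed.

Lemma centre_act_center i z : z \in Z -> rmod_act (X i) z \in rmod_end_center (X i).
Proof.
move=> /mem_centre zC; apply/rmod_end_centerP; split.
  by apply/mem_rmod_end => a x; rewrite -!rmod_actMx zC.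
move=> g /mem_rmod_end gE; apply/lfunP => x.
by rewrite !comp_lfunE gE.
Qed.

(** Central endomorphisms lie in the bicommutants, hence are induced by one ring element. It acts on
    each module by a module endomorphism, so faithfulness makes it central. *)
Lemma centre_surj (f : forall i, 'End(X i)) :
  (forall i, f i \in rmod_end_center (X i)) ->
  exists2 z, z \in Z & forall i, rmod_act (X i) z = f i.
Proof.
move=> fC; have [_ isoX _] := hX.
have /fin_all_exists[t_ tP] i := rmod_end_basis (sX i).
have [|||z zP] := @centralizer_interpolation _ _ _ X sX isoX t_ _ _ f.
- by move=> i; case: (tP i).
- by move=> i; case: (tP i).
- by move=> i; have /memv_capP[] := fC i.
exists z => //; apply/mem_centre => a; apply: faithful_eq => i; rewrite !rmod_actM zP.
have /memv_capP[/mem_rmod_end fE _] := fC i.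
by apply/lfunP => x; rewrite !comp_lfunE fE.
Qed.

Definition isotypic i : {vspace A} := (\bigcap_(j < k | j != i) lker (rmod_act (X j)))%VS.

Lemma mem_isotypic i a : a \in isotypic i <-> forall j, j != i -> rmod_act (X j) a = 0.
Proof.
rewrite memvE; split=> [/subv_bigcapP aI j ji|aI].
  by have := aI j ji; rewrite -memvE memv_ker => /eqP.
by apply/subv_bigcapP => j ji; rewrite -memvE memv_ker aI.
Qed.

Lemma isotypic_eq i a b : a \in isotypic i -> b \in isotypic i ->
  rmod_act (X i) a = rmod_act (X i) b -> a = b.
Proof.
move=> /mem_isotypic aI /mem_isotypic bI ab; apply: faithful_eq => j.
by have [->|ji] := eqVneq j i; rewrite ?ab // aI ?bI.
Qed.

Lemma dim_isotypic_mul i :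
  (\dim (isotypic i) = (\dim {:X i} %/ \dim (rmod_end (X i))) * \dim {:X i})%N /\
  (\dim {:X i} = (\dim {:X i} %/ \dim (rmod_end (X i))) * \dim (rmod_end (X i)))%N.
Proof.
have [_ isoX _] := hX.
have /fin_all_exists[t_ tP] i' := rmod_end_basis (sX i').
have E0 : (0 < \dim (rmod_end (X i)))%N.
  rewrite lt0n dimv_eq0; apply/eqP => E0; have [X0 _] := sX i; apply: X0.
  apply/eqP; rewrite -subv0; apply/subvP => x _; rewrite memv0.
  have := rmod_end1 (X i); rewrite E0 memv0 => /eqP id0.
  by rewrite -[x]id_lfunE id0 lfunE.
have [_ _ st] := tP i.
have xE : (\dim {:X i} %/ \dim (rmod_end (X i)))%N = size (t_ i) by rewrite -st mulnK.
rewrite xE st; split=> //; apply: dim_isotypic => //.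
- by move=> j; case: (tP j).
- by move=> j; case: (tP j).
Qed.

Lemma rmod_end_center1 i : \1%VF \in rmod_end_center (X i).
Proof.
apply/rmod_end_centerP; split; first exact: rmod_end1.
by move=> g _; rewrite comp_lfun1l comp_lfun1r.
Qed.

Lemma rmod_end_center_comp i (f g : 'End(X i)) :
  f \in rmod_end_center (X i) -> g \in rmod_end_center (X i) ->
  (f \o g)%VF \in rmod_end_center (X i).
Proof.
move=> /rmod_end_centerP[fE fC] /rmod_end_centerP[gE gC].
apply/rmod_end_centerP; split; first exact: rmod_end_comp.
by move=> h hE; rewrite -comp_lfunA gC // comp_lfunA fC // comp_lfunA.
Qed.

Lemma rmod_end_center_inverse i (f : 'End(X i)) :
  f \in rmod_end_center (X i) -> f <> 0 ->
  exists2 g, g \in rmod_end_center (X i) & (g \o f = \1)%VF.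
Proof.
move=> /rmod_end_centerP[fE fC] f0.
have [g gE [gf fg]] := rmod_end_inverse (sX i) fE f0; exists g => //.
apply/rmod_end_centerP; split=> // h hE.
rewrite -[LHS]comp_lfun1r -fg -!comp_lfunA (comp_lfunA h) -(fC h hE) comp_lfunA.
by rewrite !comp_lfunA gf comp_lfun1l.
Qed.

Definition comp_left (V : vectType K) (f g : 'End(V)) : 'End(V) := (f \o g)%VF.

Lemma comp_left_is_linear (V : vectType K) (f : 'End(V)) : linear (comp_left f).
Proof. by move=> c g h; rewrite /comp_left comp_lfunDr comp_lfunZr. Qed.
HB.instance Definition _ (V : vectType K) (f : 'End(V)) :=
  GRing.isLinear.Build K 'End(V) 'End(V) _ (comp_left f) (comp_left_is_linear f).

Definition comp_left_lfun (V : vectType K) (f : 'End(V)) : 'End('End(V)) :=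
  linfun (comp_left f).

Lemma comp_left_lfun_is_linear (V : vectType K) : linear (@comp_left_lfun V).
Proof.
move=> c f g; apply/lfunP => h; rewrite !lfunE /= !lfunE /= !lfunE /comp_left.
by rewrite comp_lfunDl comp_lfunZl.
Qed.
HB.instance Definition _ (V : vectType K) :=
  GRing.isLinear.Build K 'End(V) 'End('End(V)) _ (@comp_left_lfun V)
    (@comp_left_lfun_is_linear V).

(** Makes the quotient of dimensions defining d_i^2 exact: the endomorphism ring has a basis over
    its centre acting by left composition. *)
Lemma dim_rmod_end_center_dvd i : (\dim (rmod_end_center (X i)) %| \dim (rmod_end (X i)))%N.
Proof.
pose E := (linfun (@comp_left_lfun (X i)) @: rmod_end_center (X i))%VS.
have EP e : e \in E <-> exists2 f, f \in rmod_end_center (X i) & e = comp_left_lfun f.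
  split=> [/memv_imgP[f fC ->]|[f fC ->]]; first by exists f; rewrite ?lfunE.
  by apply/memv_imgP; exists f; rewrite ?lfunE.
have [||||t [_ _ st]] := @orbit_basis _ _ E (rmod_end (X i)).
- apply/EP; exists \1%VF; first exact: rmod_end_center1.
  by apply/lfunP => g; rewrite id_lfunE lfunE /= /comp_left comp_lfun1l.
- move=> _ _ /EP[f fC ->] /EP[g gC ->]; apply/EP; exists (f \o g)%VF.
    exact: rmod_end_center_comp.
  by apply/lfunP => h; rewrite comp_lfunE !lfunE /= /comp_left comp_lfunA.
- move=> _ /EP[f fC ->] f0; have [|g gC gf] := rmod_end_center_inverse fC.
    by move=> f00; apply: f0; rewrite f00 linear0.
  exists (comp_left_lfun g); first by apply/EP; exists g.
  apply/lfunP => h; rewrite comp_lfunE !lfunE /= /comp_left comp_lfunA gf.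
  by rewrite comp_lfun1l.
- move=> _ h /EP[f /rmod_end_centerP[fE _] ->] hE; rewrite lfunE /=.
  exact: rmod_end_comp.
rewrite -st; have -> : \dim E = \dim (rmod_end_center (X i)).
  apply: limg_dim_eq; apply/eqP; rewrite -subv0; apply/subvP => f /memv_capP[_].
  rewrite memv_ker lfunE /= memv0 => /eqP/lfunP/(_ \1%VF).
  by rewrite !lfunE /= /comp_left comp_lfun1r => ->.
exact: dvdn_mull.
Qed.

Definition isotypic_centre i : {vspace A} := (Z :&: isotypic i)%VS.

Lemma isotypic_centre_unit i :
  exists e, [/\ e \in isotypic_centre i, rmod_act (X i) e = \1%VF
    & forall a, a \in isotypic i -> a * e = a].
Proof.
pose f j : 'End(X j) := if j == i then \1%VF else 0.
have [j|e eZ eP] := @centre_surj f.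
  by rewrite /f; case: eqP => _; rewrite ?rmod_end_center1 ?mem0v.
have ei : rmod_act (X i) e = \1%VF by rewrite eP /f eqxx.
have eI : e \in isotypic i.
  by apply/mem_isotypic => j /negPf ji; rewrite eP /f ji.
exists e; split=> // [|a aI]; first by apply/memv_capP.
apply: (@isotypic_eq i) => //; last by rewrite rmod_actM ei comp_lfun1l.
by apply/mem_isotypic => j ji; rewrite rmod_actM ((mem_isotypic i a).1 aI j ji) comp_lfun0r.
Qed.

Lemma isotypic_centre_act i f : f \in rmod_end_center (X i) ->
  exists2 z, z \in isotypic_centre i & rmod_act (X i) z = f.
Proof.
move=> fC; have [e [eZI ei _]] := isotypic_centre_unit i.
have [eZ eI] := memv_capP eZI.
(* The family equal to [f] at [i] and to 0 elsewhere; the cast is forced by the dependence of the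
   type on [j]. *)
pose f' j : 'End(X j) := if i =P j is ReflectT ij then ecast j 'End(X j) ij f else 0.
have [j|z zZ zP] := @centre_surj f'.
  by rewrite /f'; case: eqP => [ij|_]; rewrite ?mem0v //; case: j / ij.
exists (z * e).
  apply/memv_capP; split.
    apply/mem_centre => a; rewrite -mulrA ((mem_centre _).1 eZ) mulrA.
    by rewrite ((mem_centre _).1 zZ) mulrA.
  apply/mem_isotypic => j ji.
  by rewrite rmod_actM ((mem_isotypic i e).1 eI j ji) comp_lfun0l.
rewrite rmod_actM ei comp_lfun1l zP /f'; case: eqP => // ii.
by rewrite (eq_axiomK ii).
Qed.

(** The central component presented as an abstract field extension of K, so that [trace_ratio] can
    be applied to it. *)
Lemma isotypic_field i : exists (F : fieldExtType K) (f : 'Hom(F, A)),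
  [/\ lker f = 0%VS, limg f = isotypic_centre i,
      rmod_act (X i) (f 1) = \1%VF & forall x y, f (x * y) = f x * f y].
Proof.
have [e [eZI ei eP]] := isotypic_centre_unit i; have [eZ eI] := memv_capP eZI.
have e0 : e != 0.
  apply/eqP => e0; have [X0 _] := sX i; apply: X0; apply/eqP; rewrite -subv0.
  apply/subvP => x _; rewrite memv0 -[x]id_lfunE -ei e0 linear0.
  by rewrite lfunE.
have mulU x y : x \in isotypic_centre i -> y \in isotypic_centre i ->
    x * y \in isotypic_centre i.
  move=> /memv_capP[/mem_centre xZ /mem_isotypic xI] /memv_capP[/mem_centre yZ yI].
  apply/memv_capP; split; last first.
    by apply/mem_isotypic => j ji; rewrite rmod_actM xI // comp_lfun0r.
  by apply/mem_centre => a; rewrite -mulrA yZ mulrA xZ mulrA.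
have [||x xU|//|x y xU _|x xU x0|F [f [kf lf f1 fM]]] := @corner_field _ _ (isotypic_centre i) e.
- exact: eZI.
- exact: e0.
- have /memv_capP[/mem_centre xZ xI] := xU; rewrite -xZ; exact: eP.
- by have /memv_capP[/mem_centre xZ xI] := xU.
- have /memv_capP[xZ xI] := xU.
  have [|g gC gf] := rmod_end_center_inverse (centre_act_center i xZ).
    move=> x00; case/eqP: x0; apply: (@isotypic_eq i) => //; first exact: mem0v.
    by rewrite x00 linear0.
  have [y yU yg] := isotypic_centre_act gC; exists y => //.
  apply: (@isotypic_eq i) => //; first by have /memv_capP[] := mulU x y xU yU.
  by rewrite rmod_actM yg gf ei.
by exists F, f; rewrite f1.
Qed.

End Wedderburn.

Lemma char_poly_similar (E : fieldType) m (P Q R : 'M[E]_m) :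
  P *m Q = 1%:M -> char_poly (P *m R *m Q) = char_poly R.
Proof.
move=> PQ; pose up := map_mx (@polyC E).
have upM m1 m2 m3 (B : 'M_(m1, m2)) (C : 'M_(m2, m3)) : up _ _ (B *m C) = up _ _ B *m up _ _ C.
  exact: map_mxM.
have PQ' : up _ _ P *m up _ _ Q = 1%:M by rewrite -upM PQ /up map_mx1.
rewrite /char_poly /char_poly_mx -!/(up _ _ _) !upM.
have -> : 'X%:M - up _ _ P *m up _ _ R *m up _ _ Q =
          up _ _ P *m ('X%:M - up _ _ R) *m up _ _ Q.
  by rewrite mulmxBr mulmxBl scalar_mxC -!mulmxA PQ' mulmx1.
rewrite !det_mulmx mulrAC -det_mulmx PQ' det1 mul1r //.
Qed.

Lemma idempotent_factor (E : fieldType) m (M : 'M[E]_m) : M *m M = M ->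
  exists r (C : 'M_(m, r)) (D : 'M_(r, m)),
    [/\ r = \rank M, C *m D = M & D *m C = 1%:M].
Proof.
move=> MM; exists (\rank M), (col_base M), (row_base M); split=> //.
  exact: mulmx_base.
apply: (row_full_inj (col_base_full M)); apply: (row_free_inj (row_base_free M)).
by rewrite mulmx1 (mulmxA (col_base M)) mulmx_base -(mulmxA M) mulmx_base.
Qed.

Lemma left_transversal (gT : finGroupType) (N : {group gT}) :
  exists (x : 'I_(#|gT| %/ #|N|) -> gT) (l : gT -> 'I_(#|gT| %/ #|N|)),
    (forall s, ((x (l s))^-1 * s)%g \in N) /\
    (forall j nu, nu \in N -> l (x j * nu)%g = j).
Proof.
pose Q := lcosets N [set: gT].
have cQ : #|Q| = (#|gT| %/ #|N|)%N.
  by rewrite card_lcosets -[#|gT|]cardsT divgS ?subsetT.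
rewrite -cQ; pose x (j : 'I_#|Q|) := repr (enum_val j).
have lQ s : (s *: N)%g \in Q by apply/lcosetsP; exists s.
have xE j : enum_val j = (x j *: N)%g.
  have /lcosetsP[t _ e] := enum_valP j; rewrite /x e.
  by apply/esym/lcoset_eqP; apply: (mem_repr t); apply: lcoset_refl.
exists x, (fun s => enum_rank_in (lQ 1%g) (s *: N)%g); split=> [s|j nu nuN].
  by rewrite -mem_lcoset -xE enum_rankK_in // lcoset_refl.
have -> : (x j * nu *: N)%g = enum_val j by rewrite xE lcosetM lcoset_id.
exact: enum_valK_in.
Qed.

(** * Traces and dimensions of the isotypic components *)

Section IsotypicTrace.
Variables (K : fieldType) (L : fieldExtType K) (gT : finGroupType).
Variable to : galact L gT.
Local Notation tw := (twisted to).
Variable N : {group gT}.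
Hypothesis hN : forall s, s \in N <-> (forall y : L, to y s = y).
Hypothesis n_inv : (#|N|%:R : K) != 0.
Local Notation Z := (twisted_centre to).
Local Notation n := #|N|.
Let nu_ (i : 'I_n) : gT := enum_val i.

Let nuN i : nu_ i \in N. Proof. exact: enum_valP. Qed.

(** The group matrix of [z]: right multiplication by a central [z] on L[N], in row convention. It is
    L-linear because N acts trivially on L. *)
Definition centre_mx (z : tw) : 'M[L]_n := \matrix_(i, j) z ((nu_ i)^-1 * nu_ j)%g.

Lemma centre_mx_is_scalar c (a b : tw) :
  centre_mx (c *: a + b) = c%:A *: centre_mx a + centre_mx b.
Proof. by apply/matrixP => i j; rewrite !mxE !ffunE mulr_algl. Qed.

Lemma mul_centreE (a w : tw) x nu : w \in Z -> nu \in N ->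
  (a * w) (x * nu)%g = \sum_i a (x * nu_ i)%g * w ((nu_ i)^-1 * nu)%g.
Proof.
move=> wZ nuIN; rewrite twisted_mulE.
rewrite (bigID (fun t => t \in N)) /= [X in _ + X]big1 ?addr0 => [|t tN]; last first.
  by rewrite (centre_supp hN wZ tN) mulr0.
rewrite -(big_enum_val (fun u => a (x * u)%g * w (u^-1 * nu)%g)) /=.
have inj : injective (fun u => u^-1 * nu)%g.
  by move=> u u' /mulIg/invg_inj.
rewrite (reindex_inj inj) /=; apply: eq_big => [u|u tN].
  by rewrite groupMr // groupV.
by rewrite ((hN _).1 tN) invMg invgK -mulgA mulKVg.
Qed.

Lemma centre_mxM z w : w \in Z -> centre_mx (z * w) = centre_mx z *m centre_mx w.
Proof.
move=> wZ; apply/matrixP => i j; rewrite !mxE mul_centreE //.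
by apply: eq_bigr => l _; rewrite !mxE.
Qed.

Lemma centre_mx_trace z : \tr (centre_mx z) = n%:R * z 1%g.
Proof.
rewrite /mxtrace; under eq_bigr do rewrite mxE mulVg.
by rewrite sumr_const card_ord mulr_natl.
Qed.

(* Conjugation by s permutes N, so that Galois conjugation of the entries of
   centre_mx z amounts to a similarity. *)
Lemma centre_mx_galact s : exists P Q : 'M[L]_n,
  [/\ P *m Q = 1%:M, Q *m P = 1%:M
    & forall z, z \in Z -> map_mx (galact_by to s) (centre_mx z) = P *m centre_mx z *m Q].
Proof.
have JN u i : (nu_ i ^ u)%g \in N by exact: (galact_kerJ hN _ (nuN i)).
pose p u i : 'I_n := enum_rank_in (JN u i) (nu_ i ^ u)%g.
have pE u i : nu_ (p u i) = (nu_ i ^ u)%g by rewrite /nu_ enum_rankK_in.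
have pK u : cancel (p u) (p u^-1%g).
  by move=> i; apply: enum_val_inj; rewrite -!/(nu_ _) !pE -conjgM mulgV conjg1.
pose P u : 'M[L]_n := \matrix_(i, j) (p u i == j)%:R.
have PX u (M : 'M[L]_n) : P u *m M = \matrix_(i, j) M (p u i) j.
  apply/matrixP => i j; rewrite !mxE (bigD1 (p u i)) //= !mxE eqxx mul1r.
  by rewrite big1 ?addr0 // => l; rewrite mxE eq_sym => /negPf ->; rewrite mul0r.
have XP u (M : 'M[L]_n) : M *m P u^-1%g = \matrix_(i, j) M i (p u j).
  apply/matrixP => i j; rewrite !mxE (bigD1 (p u j)) //= !mxE pK eqxx mulr1.
  rewrite big1 ?addr0 // => l lj; rewrite mxE; case: eqP => [e|]; rewrite ?mulr0 //.
  by case/eqP: lj; rewrite -e -{1}[u]invgK pK.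
have PP u : P u *m P u^-1%g = 1%:M.
  apply/matrixP => i j; rewrite XP !mxE (can_eq (pK u)) //.
exists (P s), (P s^-1%g); split=> // [|z zZ]; first by rewrite -{2}[s]invgK PP.
apply/matrixP => i j; rewrite XP PX !mxE !pE /galact_by -(centre_conj hN) ?groupM ?groupV //.
by rewrite conjMg conjVg.
Qed.

Lemma dim_galact_field : \dim {:L} = (#|gT| %/ #|N|)%N.
Proof.
have [c cC] := fixed_field_trace_elt hN n_inv 1%G.
have := dim_fixed_field hN n_inv cC; rewrite mul1g => <-; congr (\dim _).
apply/vspaceP => y; rewrite memvf; apply/esym/mem_fixed_field => s /set1P ->.
exact: galact1.
Qed.

Variables (k : nat) (X : 'I_k -> rmod tw).
Hypothesis hX : simple_representatives X.
Let faithful := twisted_faithful hN n_inv hX.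

(** Right multiplication by the idempotent [e] acts on each left coset of N through the same matrix
    [E]. There are h cosets, so the component is h copies of the row space of [E], each of
    K-dimension h times the rank. *)
Lemma dim_isotypic_rank i (e : tw) : e \in isotypic_centre X i ->
  (forall a, a \in isotypic X i -> a * e = a) ->
  (\dim (isotypic X i) = \dim {:L} * \dim {:L} * \rank (centre_mx e))%N.
Proof.
move=> /memv_capP[eZ eI] eP; set E := centre_mx e.
have EE : E *m E = E by rewrite -centre_mxM // eP.
have [rho [C [D [rhoE CD DC]]]] := idempotent_factor EE.
have [x [l [xl lx]]] := left_transversal N.
pose T : vectType K := {ffun 'I_(#|gT| %/ #|N|) * 'I_rho -> L}.
pose ix s : 'I_n := enum_rank_in (xl s) ((x (l s))^-1 * s)%g.
have ixE s : (x (l s) * nu_ (ix s))%g = s.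
  by rewrite /nu_ enum_rankK_in ?mulKVg.
have ixx j i' : ix (x j * nu_ i')%g = i'.
  by apply: enum_val_inj; rewrite enum_rankK_in // lx // mulKg.
pose Phi (a : tw) : T := [ffun lj => \sum_i' a (x lj.1 * nu_ i')%g * C i' lj.2].
pose Psi (t : T) : tw := [ffun s => \sum_j t (l s, j) * D j (ix s)].
have PhiPsi t : Phi (Psi t) = t.
  apply/ffunP => -[j0 j]; rewrite ffunE /=.
  transitivity (\sum_j' t (j0, j') * (D *m C) j' j).
    under eq_bigr do rewrite ffunE lx // ixx mulr_suml.
    rewrite exchange_big; apply: eq_bigr => j' _ /=.
    by rewrite mxE mulr_sumr; apply: eq_bigr => i' _; rewrite mulrA.
  rewrite DC (bigD1 j) //= mxE eqxx mulr1 big1 ?addr0 // => j' /negPf j'j.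
  by rewrite mxE j'j mulr0.
have PsiPhi a : Psi (Phi a) = a * e.
  apply/ffunP => s; rewrite ffunE -{3}(ixE s) mul_centreE //.
  under eq_bigr do rewrite ffunE mulr_suml /=.
  rewrite exchange_big; apply: eq_bigr => i' _ /=.
  under eq_bigr do rewrite -mulrA.
  rewrite -mulr_sumr; congr (_ * _).
  by have /matrixP/(_ i' (ix s)) := CD; rewrite !mxE.
have PsiL : linear Psi.
  move=> c t t'; apply/ffunP => s; rewrite !ffunE scaler_sumr -big_split.
  by apply: eq_bigr => j _; rewrite !ffunE mulrDl scalerAl.
pose PsiM := GRing.isLinear.Build K T tw _ Psi PsiL.
pose Psi' : {linear T -> tw} := HB.pack Psi PsiM.
have idI a : a * e \in isotypic X i.
  apply/mem_isotypic => j ji.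
  by rewrite rmod_actM ((mem_isotypic X i e).1 eI j ji) comp_lfun0l.
have <- : limg (linfun Psi') = isotypic X i.
  apply/vspaceP => a; apply/idP/idP => [/memv_imgP[t _ ->]|aI].
    by rewrite lfunE /= -[t]PhiPsi PsiPhi.
  by apply/memv_imgP; exists (Phi a); rewrite ?memvf // lfunE /= PsiPhi eP.
rewrite limg_dim_eq; last first.
  apply/eqP; rewrite capfv; apply/lker0P => t t'; rewrite !lfunE /= => tt'.
  by rewrite -[t]PhiPsi tt' PhiPsi.
rewrite dimvf /dim /= card_prod !card_ord -dim_galact_field -dimvf.
by rewrite -rhoE mulnAC.
Qed.

(* The field Z(A) e acts on the L-space e L[N] by matrices R x; Galois invariance
   brings their characteristic polynomials down to K. *)
Lemma isotypic_trace i : exists r : nat,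
  (\dim (isotypic X i) =
     \dim {:L} * \dim {:L} * (r * \dim (rmod_end_center (X i))))%N /\
  forall z, z \in isotypic_centre X i ->
    n%:R * centre_form z =
    r%:R * trace_on (rmod_end_center (X i)) (fun w => (rmod_act (X i) z \o w)%VF).
Proof.
have [F [f [kf lf f1 fM]]] := isotypic_field hX faithful i.
have fU x : f x \in isotypic_centre X i by rewrite -lf memv_img ?memvf.
have fZ x : f x \in Z by have /memv_capP[] := fU x.
have fI x : f x \in isotypic X i by have /memv_capP[] := fU x.
set e := f 1; have eP a : a \in isotypic X i -> a * e = a.
  move=> aI; apply: (isotypic_eq faithful) (aI) _; last by rewrite rmod_actM f1 comp_lfun1l.
  apply/mem_isotypic => j ji.
  by rewrite rmod_actM ((mem_isotypic X i a).1 aI j ji) comp_lfun0r.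
set E := centre_mx e.
have eZ : e \in Z by exact: (fZ 1).
have eI : e \in isotypic X i by exact: (fI 1).
have EE : E *m E = E by rewrite -centre_mxM ?eP.
have [rho [C [D [rhoE CD DC]]]] := idempotent_factor EE.
pose M x := centre_mx (f x).
have ME x : M x *m E = M x by rewrite -centre_mxM ?eP ?fI.
have EM x : E *m M x = M x.
  rewrite -centre_mxM ?fZ //; congr (centre_mx _).
  by have /mem_twisted_centre -> := fZ 1; apply: eP.
(* Compression to the image of [E], so that 1 goes to the identity matrix and [R] is a unital
   representation. *)
pose R x : 'M[L]_rho := D *m M x *m C.
have RD x y : R (x + y) = R x + R y.
  rewrite /R -mulmxDl -mulmxDr; congr (_ *m _ *m _).
  by have := centre_mx_is_scalar 1 (f x) (f y); rewrite !scale1r /M linearD.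
have RM x y : R (x * y) = R x *m R y.
  rewrite /R /M fM centre_mxM // -/(M x) -/(M y) -{1}(ME x) -CD.
  by rewrite !mulmxA.
have RK (a : K) : R a%:A = (in_alg L a)%:M.
  rewrite /R /M linearZ /= -/e.
  have := centre_mx_is_scalar a e 0; rewrite addr0 => ->.
  have -> : centre_mx (0 : tw) = 0 by apply/matrixP => i' j; rewrite !mxE ffunE.
  rewrite addr0 -scalemxAr -scalemxAl -/E -CD mulmxA DC mul1mx DC.
  by rewrite scalemx1.
(* The conjugated factors, corrected by [P] and [Q], give a second rank factorisation of the same
   [E]. Two such factorisations differ by an invertible matrix, so the conjugate of [R x] is similar
   to [R x]. *)
have Rgal s x : map_poly (galact_by to s) (char_poly (R x)) = char_poly (R x).
  have [P [Q [PQ QP PM]]] := centre_mx_galact s.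
  pose D' := map_mx (galact_by to s) D *m P; pose C' := Q *m map_mx (galact_by to s) C.
  have D'C' : D' *m C' = 1%:M.
    by rewrite mulmxA -(mulmxA _ P) PQ mulmx1 -map_mxM DC map_mx1.
  have C'D' : C' *m D' = E.
    rewrite mulmxA -(mulmxA Q) -map_mxM CD PM ?fZ // -/E !mulmxA QP mul1mx.
    by rewrite -mulmxA QP mulmx1.
  rewrite map_char_poly -(@char_poly_similar _ _ (D' *m C) (D *m C') (R x)); last first.
    by rewrite mulmxA -(mulmxA D') CD -C'D' mulmxA D'C' mul1mx D'C'.
  congr char_poly; rewrite /R !map_mxM PM ?fZ // -/(M x).
  transitivity (D' *m M x *m C'); first by rewrite /D' /C' !mulmxA.
  rewrite -{1}(EM x) -{1}(ME x) -CD; by rewrite !mulmxA.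
have Rchi x : exists chi, char_poly (R x) = map_poly (in_alg L) chi.
  apply/polyOver1P/polyOverP => j; apply/(galact_fix to) => s.
  by rewrite -[in RHS](Rgal s) coef_map.
have Rtr x : \tr (R x) = (n%:R * centre_form (f x))%:A.
  rewrite /R mxtrace_mulC mulmxA CD EM centre_mx_trace -(centre_formE hN) ?fZ //.
  by rewrite -[RHS]/(in_alg L _) rmorphM rmorph_nat.
(* Otherwise the form would vanish on all multiples of [e] in the centre, and nondegeneracy would
   give e = 0, so [X i] would be zero. *)
have [w w0] : exists w, \tr (R w) != 0.
  apply: NNPP => Rw0; have e0 : e = 0.
    apply: (centre_form_nondegenerate hN n_inv (fZ 1)) => w wZ.
    have ewZ : f 1 * w \in isotypic_centre X i.
      apply/memv_capP; split; first exact: centre_mul (fZ 1) wZ.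
      apply/mem_isotypic => j ji.
      by rewrite rmod_actM ((mem_isotypic X i _).1 (fI 1) j ji) comp_lfun0r.
    have /memv_imgP[x _ fx] : f 1 * w \in limg f by rewrite lf.
    apply/eqP; apply: contra_notT Rw0 => ew0; exists x; rewrite Rtr -fx.
    by rewrite scaler_eq0 oner_eq0 orbF mulf_neq0.
  have [sX _ _] := hX; have [X0 _] := sX i; apply: X0; apply/eqP; rewrite -subv0.
  apply/subvP => u _; rewrite memv0 -[u]id_lfunE -f1 -/e e0 linear0.
  by rewrite lfunE.
have [r [rhoF trE]] := trace_ratio RD RM RK Rchi (ex_intro _ w w0).
pose g : 'Hom(F, 'End(X i)) := (rmod_act (X i) \o f)%VF.
have kg : lker g = 0%VS.
  apply/eqP; rewrite -subv0; apply/subvP => x; rewrite memv_ker comp_lfunE => /eqP gx.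
  have : f x = 0.
    by apply: (isotypic_eq faithful) (fI x) (mem0v _) _; rewrite gx linear0.
  by move/eqP; rewrite -memv_ker kf.
have lg : limg g = rmod_end_center (X i).
  apply/vspaceP => u; apply/idP/idP => [/memv_imgP[x _ ->]|].
    by rewrite comp_lfunE; apply: centre_act_center (fZ x).
  move=> /(isotypic_centre_act hX faithful)[z]; rewrite -lf => /memv_imgP[x _ ->] <-.
  by apply/memv_imgP; exists x; rewrite ?memvf ?comp_lfunE.
have dg : \dim (rmod_end_center (X i)) = \dim {:F}.
  by rewrite -lg limg_dim_eq // kg capv0.
exists r; split=> [|z].
  by rewrite (dim_isotypic_rank (fU 1)) // -/e -/E -rhoE dg rhoF.
rewrite -lf => /memv_imgP[x _ ->]; apply: (fmorph_inj (in_alg L)).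
rewrite /= -Rtr trE /=; congr (_ * _)%:A; rewrite -lg.
apply: trace_on_iso => // [c u u'|y]; first by rewrite comp_lfunDr comp_lfunZr.
by rewrite !comp_lfunE fM; have /mem_twisted_centre -> := fZ x; rewrite rmod_actM.
Qed.

End IsotypicTrace.

Section TraceFormula.
Variables (K : fieldType) (L : fieldExtType K) (gT : finGroupType).
Variable to : galact L gT.
Local Notation tw := (twisted to).
Variable N : {group gT}.
Hypothesis hN : forall s, s \in N <-> (forall y : L, to y s = y).
Hypothesis n_inv : (#|N|%:R : K) != 0.
Local Notation Z := (twisted_centre to).
Variables (k : nat) (X : 'I_k -> rmod tw).
Hypothesis hX : simple_representatives X.
Variable d : 'I_k -> nat.
Hypothesis hd : forall i, (d i ^ 2)%N =
  (\dim_(rmod_end_center (X i)) (rmod_end (X i)))%N.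
Let faithful := twisted_faithful hN n_inv hX.

Definition wedderburn_ratio i : nat :=
  (\dim_(rmod_end (X i)) (fullv : {vspace X i}) * d i %/ \dim {:L})%N.

(** The component has dimension x_i^2 d_i^2 c_i as an isotypic component and h^2 r c_i by the rank
    computation. So (x_i d_i)^2 = h^2 r, which shows that h divides x_i d_i and identifies r. *)
Lemma isotypic_trace_ratio i z : z \in isotypic_centre X i ->
  #|N|%:R * centre_form z = (wedderburn_ratio i ^ 2)%:R *
    trace_on (rmod_end_center (X i)) (fun w => (rmod_act (X i) z \o w)%VF).
Proof.
move=> zU; have [r [dI /(_ z zU) ->]] := isotypic_trace hN n_inv hX i.
suff -> : r = (wedderburn_ratio i ^ 2)%N by [].
have [dX xX] := dim_isotypic_mul hX faithful i.
have [c eK] := dvdnP (dim_rmod_end_center_dvd hX i).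
have c0 : (0 < \dim (rmod_end_center (X i)))%N.
  rewrite lt0n dimv_eq0; apply/eqP => c0; have [sX _ _] := hX.
  have [X0 _] := sX i; apply: X0; apply/eqP; rewrite -subv0.
  apply/subvP => x _; have := rmod_end_center1 X i; rewrite c0 !memv0 => /eqP id0.
  by rewrite -[x]id_lfunE id0 lfunE.
have dc : c = (d i ^ 2)%N by rewrite hd eK mulnK.
rewrite /wedderburn_ratio; set x := (\dim_(rmod_end (X i)) _)%N in dX xX *.
have h0 : (0 < \dim {:L})%N by rewrite adim_gt0.
have e : ((x * d i) ^ 2 = \dim {:L} ^ 2 * r)%N.
  apply/eqP; rewrite -(eqn_pmul2r c0); apply/eqP.
  rewrite -[RHS]mulnA -[(_ ^ 2)%N in RHS]mulnn -dI dX xX eK dc expnMn -mulnn; ring.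
have /dvdnP[q qE] : (\dim {:L} %| x * d i)%N.
  by rewrite -(dvdn_pexp2r _ _ (isT : 0 < 2)%N) e dvdn_mulr.
rewrite qE mulnK //; apply/eqP; rewrite -(eqn_pmul2l (_ : 0 < \dim {:L} ^ 2)%N).
  by rewrite -e qE expnMn mulnC.
by rewrite expn_gt0 h0.
Qed.

(** If the ratio vanished in K, the form would vanish on the whole central component, against its
    nondegeneracy. *)
Lemma wedderburn_ratio_neq0 i : (wedderburn_ratio i)%:R != 0 :> K.
Proof.
apply/eqP => q0; have [e [eU ei eP]] := isotypic_centre_unit hX faithful i.
have [eZ eI] := memv_capP eU.
suff e0 : e = 0.
  have [sX _ _] := hX; have [X0 _] := sX i; apply: X0; apply/eqP; rewrite -subv0.
  apply/subvP => u _; rewrite memv0 -[u]id_lfunE -ei e0 linear0.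
  by rewrite lfunE.
apply: (centre_form_nondegenerate hN n_inv eZ) => w wZ.
have ewU : e * w \in isotypic_centre X i.
  apply/memv_capP; split; first exact: centre_mul eZ wZ.
  apply/mem_isotypic => j ji.
  by rewrite rmod_actM ((mem_isotypic X i _).1 eI j ji) comp_lfun0r.
have := isotypic_trace_ratio ewU; rewrite natrX q0 expr0n mul0r => /eqP.
by rewrite mulf_eq0 (negPf n_inv) => /eqP.
Qed.

Lemma centre_trace_formula z : z \in Z -> centre_form z =
  \sum_i #|N|%:R^-1 * (wedderburn_ratio i)%:R ^+ 2 *
    trace_on (rmod_end_center (X i)) (fun w => (rmod_act (X i) z \o w)%VF).
Proof.
move=> zZ; have /fin_all_exists[e eP] i := isotypic_centre_unit hX faithful i.
have zU i : z * e i \in isotypic_centre X i.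
  have [/memv_capP[eZ /mem_isotypic eI] _ _] := eP i.
  apply/memv_capP; split; first exact: centre_mul zZ eZ.
  by apply/mem_isotypic => j ji; rewrite rmod_actM eI // comp_lfun0l.
have zi i : rmod_act (X i) (z * e i) = rmod_act (X i) z.
  by have [_ ei _] := eP i; rewrite rmod_actM ei comp_lfun1l.
have zE : z = \sum_i 1 *: (z * e i).
  apply: (faithful_eq faithful) => j; rewrite linear_sum (bigD1 j) //= scale1r zi.
  rewrite big1 ?addr0 // => i ij; rewrite scale1r.
  by have /memv_capP[_ /mem_isotypic ->] := zU i; rewrite // eq_sym.
rewrite {1}zE (scalar_sum _ _ (centre_form_is_scalar (to := to))).
apply: eq_bigr => i _; rewrite mul1r; apply: (mulfI n_inv).
rewrite (isotypic_trace_ratio (zU i)) zi natrX !mulrA mulfV // mul1r //.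
Qed.

End TraceFormula.

(** * Volumes of the two lattices *)

Section TraceVolumes.
Variables (K : fieldType) (S : subringClosed K) (v : K -> int).
Hypothesis vS : valuation_ring S v.
Variables (V : vectType K) (U : {vspace V}).

Lemma volume_unique M z z' : volume S v U M z -> volume S v U M z' -> z = z'.
Proof.
move=> Mz Mz'; have [l _ e] := volume_length vS Mz Mz' (fun x Mx => Mx).
have [l' _ e'] := volume_length vS Mz' Mz (fun x Mx => Mx).
have : 0 <= z' - z by rewrite -e.
have : 0 <= z - z' by rewrite -e'.
lia.
Qed.

(** The classical finiteness argument for integral closures: [M] contains a lattice and, the form
    being integral on [M], lies in the dual of that lattice. *)
Lemma volume_exists_integral (beta : V -> V -> K) M :
  (forall x, scalar (beta x)) -> (forall y, scalar (beta^~ y)) ->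
  (forall y, y \in U -> (forall z, z \in U -> beta y z = 0) -> y = 0) ->
  is_submodule S M -> (forall x, M x -> x \in U) ->
  (forall x, x \in U -> exists2 s, s != 0 & M (s *: x)) ->
  (forall x y, M x -> M y -> beta x y \in S) -> exists z, volume S v U M z.
Proof.
move=> bl br nd sM MU spM bM; have [M0 [z0 [vM0 M0M]]] := volume_inside v sM spM.
have [q /(_ _ _ vM0) vD] := volume_dual vS bl br nd.
apply: (volume_exists vS sM _ vD spM) => x Mx; split; first exact: MU.
by move=> y /M0M My; apply: bM.
Qed.

(** In a basis of the lattice, an operator preserving it has an integral matrix. *)
Lemma volume_trace M z (g : V -> V) : volume S v U M z -> linear g ->
  (forall x, x \in U -> g x \in U) -> (forall x, M x -> M (g x)) ->
  trace_on U g \in S.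
Proof.
move=> [B [uB MP _]] gL gU gM.
have bU i : vcomb (row i B) \in U by apply: vcomb_mem.
rewrite (@trace_on_dual _ _ U _ (fun i x => (vcoord U x *m invmx B) 0 i)
  (fun i => vcomb (row i B))) //.
- rewrite rpred_sum // => i _; have /gM/MP[_ /mxOverP] : M (vcomb (row i B)).
    apply/MP; split=> //; rewrite vcombK rowE; apply: lat_mul => //.
    by apply/mxOverP => a b; rewrite mxE rpred_nat.
  exact.
- by move=> i c x y; rewrite linearD linearZ /= mulmxDl -scalemxAl !mxE.
move=> x xU; rewrite -{1}(vcoordK xU) -{1}(mulmxKV uB (vcoord U x)).
by rewrite mulmx_sum_row linear_sum; apply: eq_bigr => i _; rewrite linearZ.
Qed.

End TraceVolumes.

Lemma trace_on_mulZ (K : fieldType) (A : falgType K) (U : {vspace A}) c (a : A) :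
  trace_on U ( *%R (c *: a)) = c * trace_on U ( *%R a).
Proof.
rewrite /trace_on mulr_sumr; apply: eq_bigr => i _.
by rewrite -scalerAl linearZ.
Qed.

(** * The lattice on the class side: the centre of the integral twisted group ring *)

Section TwistedLattices.
Variables (K : fieldType) (L : fieldExtType K) (gT : finGroupType).
Variable to : galact L gT.
Local Notation tw := (twisted to).
Variable N : {group gT}.
Hypothesis hN : forall s, s \in N <-> (forall y : L, to y s = y).
Hypothesis n_inv : (#|N|%:R : K) != 0.
Local Notation Z := (twisted_centre to).
Variables (S : subringClosed K) (v : K -> int).
Hypothesis vS : valuation_ring S v.
Local Notation T := (integral_closure S L).

Lemma twisted_over_mul (a b : tw) :
  twisted_over to T a -> twisted_over to T b -> twisted_over to T (a * b).
Proof.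
move=> aT bT s; rewrite twisted_mulE; apply: integral_closure_sum => t _.
by apply: integral_closureM (bT t); apply: integral_closure_galact.
Qed.

(** Commuting with integral elements suffices, because every monomial becomes integral after
    multiplication by a nonzero scalar. *)
Lemma twisted_centerP (z : tw) :
  twisted_center to T z <-> z \in Z /\ twisted_over to T z.
Proof.
split=> [[zT zC]|[/mem_twisted_centre zZ zT]]; last by [].
split=> //; apply/mem_twisted_centre => a; rewrite (twisted_decomp a).
rewrite mulr_sumr mulr_suml; apply: eq_bigr => t _.
have [s [s0 sS sT]] := integral_closure_spans vS (a t).
apply: (scalerI s0); rewrite scalerAr scalerAl -linearZ; apply: zC => u.
rewrite twisted_monoE; case: eqP => _; first exact: sT.
exact: integral_closure0.
Qed.

Lemma fixed_field_trace_integral (C : {group gT}) y :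
  y \in fixed_field to C -> T y -> trace_on (fixed_field to C) ( *%R y) \in S.
Proof.
move=> yF yT; have [c cC] := fixed_field_trace_elt hN n_inv C.
apply: (@integral_closure_base K S L v vS).
rewrite (fixed_field_trace_cosets hN n_inv cC yF); apply: integral_closure_sum => Y _.
exact: integral_closure_galact.
Qed.

Lemma fixed_field_lattice (C : {group gT}) : exists (t t' : int) (delta : nat),
  [/\ volume S v (fixed_field to C) (fun y => T y /\ y \in fixed_field to C) t,
      volume S v (fixed_field to C) (trace_dual S *%R (fixed_field to C)
        (fun y => T y /\ y \in fixed_field to C)) t',
      has_length S (trace_dual S *%R (fixed_field to C)
        (fun y => T y /\ y \in fixed_field to C))
        (fun y => T y /\ y \in fixed_field to C) delta
    & delta%:Z = t - t'].
Proof.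
set F := fixed_field to C; pose M y := T y /\ y \in F.
have [c cC] := fixed_field_trace_elt hN n_inv C.
pose beta (x y : L) := trace_on F ( *%R (x * y)).
have bl x : scalar (beta x) by apply: trace_on_mul_scalar.
have br y : scalar (beta^~ y) by apply: trace_on_mul_scalarl.
have nd y : y \in F -> (forall z, z \in F -> beta y z = 0) -> y = 0.
  exact: (fixed_field_nondegenerate hN n_inv cC).
have bM x y : M x -> M y -> beta x y \in S.
  move=> [xT xF] [yT yF]; apply: fixed_field_trace_integral.
    exact: fixed_fieldM.
  exact: integral_closureM.
have sM : is_submodule S M.
  split=> [|x y [xT xF] [yT yF]|s x sS [xT xF]].
  - by split; [exact: integral_closure0 | exact: mem0v].
  - by split; [exact: integral_closureD | exact: rpredD].
  - by split; [exact: integral_closureZ | exact: rpredZ].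
have [|x xF|t vt] := volume_exists_integral vS bl br nd sM _ _ bM.
- by move=> x [].
- have [s [s0 sS sT]] := integral_closure_spans vS x.
  by exists s => //; split; rewrite ?rpredZ.
have [q /(_ _ _ vt) vt'] := volume_dual vS bl br nd.
have [|delta ld ed] := volume_length vS vt' vt.
  by move=> x Mx; split; [case: Mx | move=> y; apply: bM].
by exists t, (q - t), delta.
Qed.

Definition centre_dual (M : tw -> Prop) (z : tw) : Prop :=
  z \in Z /\ forall w, M w -> centre_form (z * w) \in S.

Lemma centre_form_bilinearr (z : tw) : scalar (fun w : tw => centre_form (z * w)).
Proof.
by move=> c a b; rewrite -(centre_form_is_scalar (to := to)) mulrDr -scalerAr.
Qed.

Lemma centre_form_bilinearl (w : tw) : scalar (fun z : tw => centre_form (z * w)).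
Proof.
by move=> c a b; rewrite -(centre_form_is_scalar (to := to)) mulrDl -scalerAl.
Qed.

(** This single [q] is fed to the computations on both sides, which is why it disappears from the
    result. *)
Lemma centre_volume_dual : exists q : int, forall M z,
  volume S v Z M z -> volume S v Z (centre_dual M) (q - z).
Proof.
apply: (volume_dual vS (beta := fun z w : tw => centre_form (z * w))).
- exact: centre_form_bilinearr.
- exact: centre_form_bilinearl.
- exact: (centre_form_nondegenerate hN n_inv).
Qed.

Section Classes.
Variable Cl : {set gT}.
Hypothesis hCl : is_transversal Cl [set nu ^: [set: gT] | nu in N]%g N.
Let nu_ (i : 'I_#|Cl|) : gT := enum_val i.

Let ClN nu : nu \in Cl -> nu \in N.
Proof. by case/and3P: hCl => _ /subsetP + _; apply. Qed.

Let nuN i : nu_ i \in N. Proof. exact/ClN/enum_valP. Qed.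

Let pP : partition [set nu ^: [set: gT] | nu in N]%g N.
Proof. by case/and3P: hCl. Qed.

Let pblockE nu : nu \in N ->
  pblock [set nu ^: [set: gT] | nu in N]%g nu = (nu ^: [set: gT])%g.
Proof.
move=> nN; apply: def_pblock; first by case/and3P: pP.
  by apply/imsetP; exists nu.
exact: class_refl.
Qed.

Lemma class_rep t : t \in N -> exists i s, t = (nu_ i ^ s)%g.
Proof.
move=> tN; have : pblock [set nu ^: [set: gT] | nu in N]%g t
    \in [set nu ^: [set: gT] | nu in N]%g.
  by apply: pblock_mem; rewrite (cover_partition pP).
rewrite -{2}(pblock_transversal hCl) => /imsetP[nu nuCl].
rewrite (pblockE tN) (pblockE (ClN nuCl)) => e.
have /imsetP[s _ ->] : t \in (nu ^: [set: gT])%g by rewrite -e; exact: class_refl.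
by exists (enum_rank_in nuCl nu), s; rewrite /nu_ enum_rankK_in.
Qed.

Lemma class_rep_disjoint i j : i != j -> nu_ j \notin (nu_ i ^: [set: gT])%g.
Proof.
apply: contraNN => /class_eqP e; apply/eqP/enum_val_inj.
apply: (pblock_inj hCl); rewrite ?enum_valP //.
by rewrite !pblockE ?ClN ?enum_valP // -/(nu_ _) -/(nu_ _) e.
Qed.

Lemma centre_volume_classes : exists C : int, forall (M_ : 'I_#|Cl| -> L -> Prop) z_,
  (forall i, volume S v (fixed_field to 'C[nu_ i]%g) (M_ i) (z_ i)) ->
  volume S v Z (fun z : tw => z \in Z /\ forall i, M_ i (z (nu_ i))) (C + \sum_i z_ i).
Proof.
apply: (volume_sum vS (V_ := fun i : 'I_#|Cl| => L : vectType K)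
  (U_ := fun i => fixed_field to 'C[nu_ i]%g) (p_ := fun i (z : tw) => z (nu_ i))).
- by move=> i c a b; rewrite !ffunE.
- by move=> z zZ i; apply: (centre_coef_fixed hN).
- move=> z zZ z0; apply/ffunP => t; rewrite [RHS]ffunE.
  have [tN|tN] := boolP (t \in N); last exact: (centre_supp hN zZ tN).
  by have [i [s ->]] := class_rep tN; rewrite (centre_conj hN) // z0 galact0.
move=> y yF; exists (\sum_i class_elt to (nu_ i) (y i)).
  by rewrite rpred_sum // => i _; apply: (class_elt_centre hN).
move=> i; rewrite sum_ffunE (bigD1 i) //=.
have -> : class_elt to (nu_ i) (y i) (nu_ i) = y i.
  by have := class_eltJ 1%g (yF i); rewrite conjg1 galact1.
by rewrite big1 ?addr0 // => j ji; rewrite class_elt0 // class_rep_disjoint.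
Qed.

Lemma twisted_center_classes (z : tw) : twisted_center to T z <->
  z \in Z /\ forall i, T (z (nu_ i)) /\ z (nu_ i) \in fixed_field to 'C[nu_ i]%g.
Proof.
split=> [/twisted_centerP[zZ zT]|[zZ zT]].
  by split=> // i; split=> //; apply: (centre_coef_fixed hN).
apply/twisted_centerP; split=> // t.
have [tN|tN] := boolP (t \in N); last first.
  by rewrite (centre_supp hN zZ tN); apply: integral_closure0.
have [i [s ->]] := class_rep tN; rewrite (centre_conj hN) //.
by apply: integral_closure_galact; case: (zT i).
Qed.

Lemma index_centNV nu : #|N : 'C_N[nu^-1]|%g = #|N : 'C_N[nu]|%g.
Proof.
congr #|_ : _|%g; apply/setP => s; rewrite !in_setI.
by rewrite -!conjg_eq_cent1 conjVg (inj_eq invg_inj).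
Qed.

(** The form pairs the coefficient at nu with that at its inverse, which may belong to another
    class; but both have the same centralizer and index, so the condition splits over the
    representatives, with the index as a scaling. *)
Lemma centre_dual_classes (z : tw) : centre_dual (twisted_center to T) z <->
  z \in Z /\ forall i, trace_dual S *%R (fixed_field to 'C[nu_ i]%g)
    (fun y => T y /\ y \in fixed_field to 'C[nu_ i]%g)
    (#|N : 'C_N[nu_ i]|%g%:R *: z (nu_ i)).
Proof.
split=> [[zZ zD]|[zZ zD]]; split=> //.
  move=> i; have zF : z (nu_ i) \in fixed_field to 'C[nu_ i]%g.
    exact: (centre_coef_fixed hN).
  split=> [|y [yT yF]]; first exact: rpredZ.
  have nuVN : (nu_ i)^-1%g \in N by rewrite groupV.
  have yF' : y \in fixed_field to 'C[(nu_ i)^-1]%g by rewrite fixed_field_centV.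
  have := zD _ (_ : twisted_center to T (class_elt to (nu_ i)^-1%g y)).
  rewrite (centre_form_class_elt hN n_inv) // invgK index_centNV fixed_field_centV.
  rewrite -scalerAl trace_on_mulZ; apply.
  apply/twisted_centerP; split; first exact: (class_elt_centre hN).
  move=> s; rewrite ffunE; case: pickP => [t _|_]; last exact: integral_closure0.
  exact: integral_closure_galact.
move=> w /twisted_centerP[wZ wT]; have /mem_twisted_centre -> := zZ.
rewrite (centre_form_classes hN n_inv hCl wZ zZ) rpred_sum // => nu nuCl.
have [i ->] : exists i, nu = nu_ i.
  by exists (enum_rank_in nuCl nu); rewrite /nu_ enum_rankK_in.
have [zF zi] := zD i.
have wF : w (nu_ i)^-1%g \in fixed_field to 'C[nu_ i]%g.
  by rewrite -fixed_field_centV (centre_coef_fixed hN) ?groupV.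
have := zi _ (conj (wT _) wF); rewrite -scalerAl trace_on_mulZ.
by rewrite [z (nu_ i) * _]mulrC.
Qed.

Lemma twisted_center_volume q :
  (forall M z, volume S v Z M z -> volume S v Z (centre_dual M) (q - z)) ->
  exists (t : int) (delta : gT -> nat), [/\ volume S v Z (twisted_center to T) t,
    forall nu, has_length S (trace_dual S *%R (fixed_field to 'C[nu]%g)
        (fun y => T y /\ y \in fixed_field to 'C[nu]%g))
        (fun y => T y /\ y \in fixed_field to 'C[nu]%g) (delta nu)
    & t + t = q + \sum_(nu in Cl) ((delta nu)%:Z +
        v (#|N : 'C_N[nu]|%g%:R) * (#|gT| %/ #|('C[nu] * N)%g|)%:Z)].
Proof.
move=> qP; have [C CP] := centre_volume_classes.
have /fin_all_exists[t0 /fin_all_exists[t1 /fin_all_exists[delta latP]]] nu :=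
  fixed_field_lattice 'C[nu]%G.
pose t := C + \sum_i t0 (nu_ i).
have vt : volume S v Z (twisted_center to T) t.
  have vi i : volume S v (fixed_field to 'C[nu_ i]%g)
      (fun y => T y /\ y \in fixed_field to 'C[nu_ i]%g) (t0 (nu_ i)).
    by case: (latP (nu_ i)).
  have := CP _ _ vi; by apply: volume_ext => z; apply: iff_sym; apply: twisted_center_classes.
pose s i : K := #|N : 'C_N[nu_ i]|%g%:R.
have s0 i : s i != 0 by exact: (index_centN_neq0 n_inv).
have vd i : volume S v (fixed_field to 'C[nu_ i]%g) (fun y =>
    trace_dual S *%R (fixed_field to 'C[nu_ i]%g)
      (fun y => T y /\ y \in fixed_field to 'C[nu_ i]%g) (s i *: y))
    (t1 (nu_ i) - v (s i) * (\dim (fixed_field to 'C[nu_ i]%g))%:Z).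
  by apply: volume_scale => //; case: (latP (nu_ i)).
have vt' := volume_ext (fun z => iff_sym (centre_dual_classes z)) (CP _ _ vd).
(* The dual has volume [q - t] by duality and, classwise, [C] plus the scaled dual volumes;
   comparison with [t] eliminates [C]. *)
have e := volume_unique vS (qP _ _ vt) vt'.
exists t, delta; split=> // [nu|]; first by case: (latP nu).
rewrite big_enum_val /=.
have -> : \sum_(i < #|Cl|) ((delta (enum_val i))%:Z + v #|N : 'C_N[enum_val i]|%g%:R *
    (#|gT| %/ #|('C[enum_val i] * N)%g|)%:Z) =
  \sum_i (t0 (nu_ i) - (t1 (nu_ i) - v (s i) * (\dim (fixed_field to 'C[nu_ i]%g))%:Z)).
  apply: eq_bigr => i _; have [_ _ _ ->] := latP (nu_ i).
  have [c cC] := fixed_field_trace_elt hN n_inv 'C[nu_ i]%G.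
  by rewrite (dim_fixed_field hN n_inv cC) opprB addrA addrAC.
rewrite sumrB; move/eqP: e; rewrite subr_eq => /eqP ->; rewrite {1}/t; ring.
Qed.

End Classes.

End TwistedLattices.

Lemma fin_gen_submodule (K : fieldType) (S : subringClosed K) (V : lmodType K)
    (M : V -> Prop) : fin_gen S M -> is_submodule S M.
Proof.
move=> [m [b bP]]; split=> [|x y /bP[c cS ->] /bP[c' c'S ->]|s x sS /bP[c cS ->]]; apply/bP.
- exists (fun=> 0) => [j|]; first exact: rpred0.
  by rewrite big1 // => j _; rewrite scale0r.
- exists (fun j => c j + c' j) => [j|]; first exact: rpredD.
  by rewrite -big_split; apply: eq_bigr => j _; rewrite scalerDl.
- exists (fun j => s * c j) => [j|]; first exact: rpredM.
  by rewrite scaler_sumr; apply: eq_bigr => j _; rewrite scalerA.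
Qed.

Lemma linear_comp_trace (K : fieldType) (V : vectType K) (U : {vspace 'End(V)}) :
  (forall f : 'End(V), scalar (fun g : 'End(V) => trace_on U (fun w => ((f \o g) \o w)%VF))) /\
  (forall g : 'End(V), scalar (fun f : 'End(V) => trace_on U (fun w => ((f \o g) \o w)%VF))).
Proof.
split=> f c x y; rewrite /trace_on mulr_sumr -big_split; apply: eq_bigr => j _ /=.
  by rewrite comp_lfunDr -comp_lfunZr comp_lfunDl -comp_lfunZl linearP.
by rewrite comp_lfunDl -comp_lfunZl comp_lfunDl -comp_lfunZl linearP.
Qed.

(** * The lattice on the Wedderburn side: the product of the centres of the orders *)

Section EndomorphismLattices.
Variables (K : fieldType) (L : fieldExtType K) (gT : finGroupType).
Variable to : galact L gT.
Local Notation tw := (twisted to).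
Variable N : {group gT}.
Hypothesis hN : forall s, s \in N <-> (forall y : L, to y s = y).
Hypothesis n_inv : (#|N|%:R : K) != 0.
Local Notation Z := (twisted_centre to).
Variables (S : subringClosed K) (v : K -> int).
Hypothesis vS : valuation_ring S v.
Variables (k : nat) (X : 'I_k -> rmod tw).
Hypothesis hX : simple_representatives X.
Variable d : 'I_k -> nat.
Hypothesis hd : forall i, (d i ^ 2)%N =
  (\dim_(rmod_end_center (X i)) (rmod_end (X i)))%N.
Variable V : forall i, X i -> Prop.
Arguments V : clear implicits.
Hypothesis V_order : forall i, is_order S (rmod_end (X i)) (lattice_end (V i)).
Let faithful := twisted_faithful hN n_inv hX.
Local Notation Zc i := (rmod_end_center (X i)).
Local Notation ZS i := (lattice_end_center (V i)).
Local Notation tr i f := (trace_on (Zc i) (fun w => (f \o w)%VF)).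
Let e_ i : K := #|N|%:R^-1 * (wedderburn_ratio X d i)%:R ^+ 2.

Let e_neq0 i : e_ i != 0.
Proof.
by rewrite mulf_neq0 ?invr_eq0 // expf_neq0 // (wedderburn_ratio_neq0 hN n_inv hX hd).
Qed.

(** The order spans the endomorphism ring over K, so commuting with the order already means being
    central. *)
Lemma lattice_end_centerP i f : ZS i f <-> f \in Zc i /\ lattice_end (V i) f.
Proof.
split=> [[fO fC]|[/rmod_end_centerP[fE fC] fO]]; last first.
  by split=> // g [gE _]; apply: fC.
split=> //; apply/rmod_end_centerP; split=> [|g gE]; first by case: fO.
have [_ _ _ _ /(_ g)[/(_ gE)[m [c [b [bO ->]]]] _]] := V_order i.
apply/lfunP => x; rewrite !comp_lfunE !sum_lfunE linear_sum; apply: eq_bigr => j _.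
by rewrite !scale_lfunE linearZ /= -!comp_lfunE fC.
Qed.

Lemma lattice_end_center_submodule i : is_submodule S (ZS i).
Proof.
have [_ _ _ /fin_gen_submodule[O0 OD OZ] _] := V_order i.
split=> [|f g /lattice_end_centerP[fZ fO] /lattice_end_centerP[gZ gO]|
         s f sS /lattice_end_centerP[fZ fO]]; apply/lattice_end_centerP.
- by split; [exact: mem0v | ].
- by split; [exact: rpredD | exact: OD].
- by split; [exact: rpredZ | exact: OZ].
Qed.

Lemma centre_form_act i z w : z \in isotypic_centre X i -> w \in Z ->
  centre_form (z * w) = e_ i * tr i (rmod_act (X i) z \o rmod_act (X i) w)%VF.
Proof.
move=> /memv_capP[zZ /mem_isotypic zI] wZ.
rewrite (centre_trace_formula hN n_inv hX hd) ?centre_mul // (bigD1 i) //=.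
have /mem_twisted_centre -> := zZ; rewrite rmod_actM big1 ?addr0 // => j ji.
rewrite rmod_actM zI // comp_lfun0l /trace_on big1 ?mulr0 // => l _.
by rewrite comp_lfun0l linear0.
Qed.

(** Inherited from the form on the centre: an [f] orthogonal to everything lifts to a central
    element orthogonal to the whole centre. *)
Lemma center_trace_nondegenerate i f : f \in Zc i ->
  (forall g, g \in Zc i -> tr i (f \o g)%VF = 0) -> f = 0.
Proof.
move=> fC fg0; have [z zU zf] := isotypic_centre_act hX faithful fC.
have /memv_capP[zZ zI] := zU.
rewrite -zf (centre_form_nondegenerate hN n_inv zZ) ?linear0 // => w wZ.
by rewrite (centre_form_act zU wZ) zf fg0 ?mulr0 //; apply: centre_act_center.
Qed.

Lemma center_lattice i : exists (t t' : int) (delta : nat),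
  [/\ volume S v (Zc i) (ZS i) t,
      volume S v (Zc i) (trace_dual S (fun z w => (z \o w)%VF) (Zc i) (ZS i)) t',
      has_length S (trace_dual S (fun z w => (z \o w)%VF) (Zc i) (ZS i)) (ZS i) delta
    & delta%:Z = t - t'].
Proof.
have [O1 _ OM Ofg Osp] := V_order i.
have [O0 OD OZ] := fin_gen_submodule Ofg.
have [||f fZ|t vt] := @volume_exists_fin_gen _ _ _ vS _ (Zc i) _ _
  (lattice_end_center_submodule i) _ Ofg.
- by move=> f /lattice_end_centerP[].
- by move=> f /lattice_end_centerP[].
- have /memv_capP[fE _] := fZ; have [/(_ fE)[m [c [b [bO fb]]]] _] := Osp f.
  have [s [s0 sS scS]] := val_denominator vS c; exists s => //.
  apply/lattice_end_centerP; split; first exact: rpredZ.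
  rewrite fb scaler_sumr; under eq_bigr do rewrite scalerA.
  exact: (submodule_sum (fin_gen_submodule Ofg)) scS bO.
have [bl br] := linear_comp_trace (Zc i).
have [q /(_ _ _ vt) vt'] := volume_dual vS
  (beta := fun f g : 'End(X i) => tr i (f \o g)%VF) bl br (@center_trace_nondegenerate i).
have [|delta ld ed] := volume_length vS vt' vt; last by exists t, (q - t), delta.
move=> f fZ; have /lattice_end_centerP[fC fO] := fZ; split=> // g gZ.
have /lattice_end_centerP[gC gO] := gZ.
(* Composition with [f] and [g] preserves the lattice, so its trace is integral and the lattice lies
   in its dual. *)
apply: (volume_trace vt) => [c x y|h hC|h /lattice_end_centerP[hC hO]].
- by rewrite comp_lfunDr comp_lfunZr.
- by apply: rmod_end_center_comp => //; apply: rmod_end_center_comp.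
apply/lattice_end_centerP; split.
  by apply: rmod_end_center_comp => //; apply: rmod_end_center_comp.
by apply: (OM) => //; apply: (OM).
Qed.

(** The preimage of the product of the centres of the orders under [omega]; both lattices can thus
    be compared inside the centre. *)
Definition act_lattice (z : tw) : Prop := z \in Z /\ forall i, ZS i (rmod_act (X i) z).

Lemma centre_volume_acts : exists C : int, forall (M_ : forall i, 'End(X i) -> Prop) z_,
  (forall i, volume S v (Zc i) (M_ i) (z_ i)) ->
  volume S v Z (fun z : tw => z \in Z /\ forall i, M_ i (rmod_act (X i) z))
    (C + \sum_i z_ i).
Proof.
apply: (volume_sum vS (V_ := fun i => 'End(X i) : vectType K)
  (U_ := fun i => Zc i) (p_ := fun i (z : tw) => rmod_act (X i) z)).
- by move=> i c a b; rewrite linearP.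
- by move=> z zZ i; apply: centre_act_center.
- by move=> z _ z0; apply: faithful.
- exact: (centre_surj hX faithful).
Qed.

Lemma act_lattice_dual (z : tw) : centre_dual S act_lattice z <->
  z \in Z /\ forall i, trace_dual S (fun z w => (z \o w)%VF) (Zc i) (ZS i)
    (e_ i *: rmod_act (X i) z).
Proof.
have trZ i c (f : 'End(X i)) : tr i (c *: f)%VF = c * tr i f.
  rewrite /trace_on mulr_sumr; apply: eq_bigr => j _.
  by rewrite -comp_lfunZl linearZ.
split=> [[zZ zD]|[zZ zD]]; split=> //.
  move=> i; split=> [|f fZ]; first by rewrite rpredZ // centre_act_center.
  have /lattice_end_centerP[fC fO] := fZ.
  have [w wU wf] := isotypic_centre_act hX faithful fC.
  have /memv_capP[wZ /mem_isotypic wI] := wU.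
  (* [w] acts as [f] on [X i] and as 0 on the other modules, so pairing with it tests the component
     at [i] alone. *)
  have : act_lattice w.
    split=> // j; have [->|ji] := eqVneq j i; first by rewrite wf.
    by rewrite wI //; case: (lattice_end_center_submodule j).
  move/zD; have /mem_twisted_centre -> := zZ.
  rewrite (centre_form_act wU zZ) wf -comp_lfunZl trZ.
  have /rmod_end_centerP[fE _] := fC.
  have /rmod_end_centerP[_ ->] // := centre_act_center X i zZ.
move=> w [wZ wO]; rewrite (centre_trace_formula hN n_inv hX hd) ?centre_mul //.
rewrite rpred_sum // => i _; have [_ /(_ _ (wO i))] := zD i.
rewrite -comp_lfunZl trZ.
by have /mem_twisted_centre -> := zZ; rewrite rmod_actM.
Qed.

Lemma act_lattice_volume q :
  (forall M z, volume S v Z M z -> volume S v Z (centre_dual S M) (q - z)) ->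
  exists (t : int) (delta : 'I_k -> nat), [/\ volume S v Z act_lattice t,
    forall i, has_length S (trace_dual S (fun z w => (z \o w)%VF) (Zc i) (ZS i))
      (ZS i) (delta i)
    & t + t = q + \sum_i ((delta i)%:Z + v (e_ i) * (\dim (Zc i))%:Z)].
Proof.
move=> qP; have [C CP] := centre_volume_acts.
have /fin_all_exists[t0 /fin_all_exists[t1 /fin_all_exists[delta latP]]] := center_lattice.
pose t := C + \sum_i t0 i.
have vi i : volume S v (Zc i) (ZS i) (t0 i) by case: (latP i).
have vt : volume S v Z act_lattice t := CP _ _ vi.
have vd i : volume S v (Zc i) (fun f => trace_dual S (fun z w => (z \o w)%VF) (Zc i) (ZS i)
    (e_ i *: f)) (t1 i - v (e_ i) * (\dim (Zc i))%:Z).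
  by apply: volume_scale => //; case: (latP i).
have vt' := volume_ext (fun z => iff_sym (act_lattice_dual z)) (CP _ _ vd).
have e := volume_unique vS (qP _ _ vt) vt'.
exists t, delta; split=> // [i|]; first by case: (latP i).
have -> : \sum_i ((delta i)%:Z + v (e_ i) * (\dim (Zc i))%:Z) =
  \sum_i (t0 i - (t1 i - v (e_ i) * (\dim (Zc i))%:Z)).
  by apply: eq_bigr => i _; have [_ _ _ ->] := latP i; rewrite opprB addrA addrAC.
rewrite sumrB; move/eqP: e; rewrite subr_eq => /eqP ->; rewrite {1}/t; ring.
Qed.

End EndomorphismLattices.

Unset Implicit Arguments.

(** * The colength formula *)

Theorem proposition2p25
  (K : fieldType) (L : fieldExtType K) (gT : finGroupType) (to : galact L gT)
  (N : {group gT}) (hN : forall s, s \in N <-> (forall y : L, to y s = y))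
  (n_inv : (#|N|%:R : K) != 0)
  (k : nat) (X : 'I_k -> rmod (twisted to)) (hX : simple_representatives X)
  (d : 'I_k -> nat)
  (hd : forall i, (0 < d i)%N /\
     (d i ^ 2)%N = (\dim_(rmod_end_center (X i)) (rmod_end (X i)))%N)
  (S : subringClosed K) (pi : K) (hS : is_dvr S pi)
  (v : K -> int) (hv : is_padic_valuation S pi v)
  (V : forall i, X i -> Prop)
  (V_fg : forall i,
     fin_gen_submod (twisted_over to (integral_closure S L)) (V i))
  (V_full : forall i, spans (V i) fullv)
  (V_max : forall i, is_maximal_order S (rmod_end (X i)) (lattice_end (V i)))
  (Cl : {set gT})
  (hCl : is_transversal Cl [set nu ^: [set: gT] | nu in N]%g N) :
  let T := integral_closure S L in
  let g := #|gT| in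
  let h : nat := \dim {:L} in
  let n := #|N| in
  let x i : nat := (\dim_(rmod_end (X i)) (fullv : {vspace X i}))%N in
  let c i : nat := \dim (rmod_end_center (X i)) in
  let L_ nu := fixed_field to 'C[nu]%g in
  let T_ nu := fun y : L => T y /\ y \in L_ nu in
  let h_ nu := (g %/ #|('C[nu] * N)%g|)%N in
  exists (deltaT : gT -> nat) (deltaZ : 'I_k -> nat) (l : nat),
    [/\ forall nu, nu \in Cl ->
          has_length S (trace_dual S *%R (L_ nu) (T_ nu)) (T_ nu) (deltaT nu),
        forall i,
          has_length S
            (trace_dual S (fun z w => (z \o w)%VF) (rmod_end_center (X i))
               (lattice_end_center (V i)))
            (lattice_end_center (V i)) (deltaZ i),
        has_length S (prod_lattice_end_center V)
          (omega_image X (twisted_center to T)) l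
      & (l%:R : rat) = 1 / 2%:R *
          ((\sum_(nu in Cl) ((deltaT nu)%:Z
              + v (#|N : 'C_N[nu]|%g%:R) * (h_ nu)%:Z))
           - (\sum_(i < k) ((deltaZ i)%:Z
              + v (n%:R^-1 * ((x i * d i) %/ h)%N%:R ^+ 2) * (c i)%:Z)))%:~R].
Proof.
move=> T g h n x c L_ T_ h_.
have vS := dvr_valuation_ring hS hv.
have hd2 i : (d i ^ 2)%N = (\dim_(rmod_end_center (X i)) (rmod_end (X i)))%N.
  by case: (hd i).
have V_order i : is_order S (rmod_end (X i)) (lattice_end (V i)).
  by case: (V_max i).
have faithful := twisted_faithful hN n_inv hX.
have [q qP] := centre_volume_dual hN n_inv vS.
have [t [deltaT [vt lT et]]] := twisted_center_volume hN n_inv vS hCl qP.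
have [t' [deltaZ [vt' lZ et']]] := act_lattice_volume hN n_inv vS hX hd2 V_order qP.
(* A central element acts by a module endomorphism, which preserves [V i] because the coefficients
   of its generators can be multiplied by [z]. *)
have sub z : twisted_center to T z -> act_lattice V z.
  move=> /(twisted_centerP vS)[zZ zT]; split=> // i.
  apply/(lattice_end_centerP V_order); split; first exact: centre_act_center.
  split; first by have /rmod_end_centerP[] := centre_act_center X i zZ.
  move=> u; have [m [b bP]] := V_fg i; move=> /bP[a aT ->]; apply/bP.
  exists (fun j => a j * z) => [j|]; first exact: twisted_over_mul.
  by rewrite linear_sum; apply: eq_bigr => j _; rewrite rmod_actMx.
have [l ll el] := volume_length vS vt' vt sub.
exists deltaT, deltaZ, l; split.
- by move=> nu _; apply: lT.
- exact: lZ.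
(* The length was found inside the centre; [omega] is injective by faithfulness and reaches the
   whole product of centres by [centre_surj]. *)
- apply: (has_length_img (f := omega X)) ll => [r a b|a b /(congr1 (@dprod_proj _ _ _)) ab|p|p].
  + apply: Defs.dprodP => i; rewrite dprod_projE linearP.
    by rewrite [RHS]dprod_projE !dprod_projE.
  + apply: (faithful_eq faithful) => i.
    by have := congr1 (fun f => f i) ab; rewrite !dprod_projE.
  + split=> [pO|[z [zZ zO] ->] i]; last by rewrite dprod_projE.
    have [|z zZ zp] := centre_surj hX faithful (f := dprod_proj p).
      by move=> i; have /(lattice_end_centerP V_order)[] := pO i.
    exists z; last by apply: Defs.dprodP => i; rewrite dprod_projE zp.
    by split=> // i; rewrite zp.
  + by [].
(* Each volume is known only through its double, which contains [q]; doubling the difference cancels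
   [q] and accounts for the factor one half. *)
have e2 : (l%:Z + l%:Z) = \sum_(nu in Cl) ((deltaT nu)%:Z
     + v (#|N : 'C_N[nu]|%g%:R) * (h_ nu)%:Z)
   - \sum_(i < k) ((deltaZ i)%:Z
     + v (n%:R^-1 * ((x i * d i) %/ h)%N%:R ^+ 2) * (c i)%:Z).
  rewrite el addrACA et -opprD et' opprD addrACA subrr add0r //.
by rewrite -e2 -PoszD -pmulrn natrD; field.
Qed.
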